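(* Let $n\ge 1$ be an integer and let $0<\varepsilon<1$. For every $\xi\in T$ put $E_\xi=\{z\in\mathbb{C}:\ \varepsilon\le |z|<1,\ z/|z|=\xi\}$. Then for all $\xi\in T$, $$\Omega_n(D)=\Omega_n(E_\xi)=1+2n .$$
   Context: $D=\{z\in\mathbb{C}:|z|<1\}$ is the open unit disc and $T=\{z\in\mathbb{C}:|z|=1\}$ is the unit circle. $H^\infty$ is the space of bounded analytic functions on $D$ with norm $\|f\|_{H^\infty}=\sup_{z\in D}|f(z)|$; on $T$ such functions are identified with their (a.e. defined) boundary values. $m$ denotes normalized Lebesgue measure on $T$. For $E\subseteq D$, $b_n(E)$ is the set of all finite Blaschke products $B_n$ with exactly $n$ zeros (counted with multiplicity), all belonging to $E$; that is, up to a unimodular constant factor, $B_n(z)=\prod_{k=1}^n\frac{z-a_k}{1-\overline{a_k}z}$ with $a_1,\dots,a_n\in E$. For $E\subseteq D$ define $$\Omega_n(E)=\sup\left\{\left\|T_{B_n}h\right\|_{H^\infty}:\ h\in H^\infty,\ \|h\|_{H^\infty}\le 1,\ B_n\in b_n(E)\right\},$$ where, for $z\in D$, $$(T_{B_n}h)(z)=\int_T\frac{\overline{B_n(\zeta)}\,h(\zeta)}{\zeta-z}\,\zeta\,dm(\zeta)=\frac{1}{2\pi i}\int_T\frac{h(\zeta)}{B_n(\zeta)(\zeta-z)}\,d\zeta .$$ Equivalently, $\Omega_n(E)$ is the supremum over $B_n\in b_n(E)$ of the norms of the Toeplitz operators $T_{B_n}$ on $H^\infty$. *)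

(* Defs.v *)
From HB Require Import structures.
From mathcomp Require Import all_boot all_order all_algebra.
From mathcomp Require Import all_classical all_reals all_analysis.
From mathcomp Require Import complex.

Set Implicit Arguments.
Unset Strict Implicit.
Unset Printing Implicit Defensive.
Import Order.TTheory GRing.Theory Num.Theory.
Import numFieldNormedType.Exports.

Local Open Scope classical_set_scope.
Local Open Scope ring_scope.
Local Open Scope complex_scope.

(* The norm `|z| of z : R[i] has values in R[i]; Normc.normc z is the same
   modulus with values in R. R[i]^o is R[i] with its norm topology, as a normed
   space over itself. *)

Definition disc (R : realType) : set R[i] := [set z | `|z| < 1].

Definition circle (R : realType) : set R[i] := [set z | `|z| = 1].

(* Derivability in direction 1, over the scalar field R[i], is complex
   differentiability. *)
Definition analytic_on_disc (R : realType) (f : R[i] -> R[i]) : Prop :=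
  forall z, disc z -> derivable (f : R[i]^o -> R[i]^o) z 1.

Definition Hinf_norm (R : realType) (f : R[i] -> R[i]) : \bar R :=
  ereal_sup [set (Normc.normc (f z))%:E | z in @disc R].

(* Elements of H^oo are represented by functions on R[i] whose values outside
   the disc are irrelevant. *)
Definition Hinf (R : realType) (f : R[i] -> R[i]) : Prop :=
  analytic_on_disc f /\ (Hinf_norm f < +oo)%E.

(* Radial limit of f at zeta. For f in H^oo it exists for almost every zeta in
   the circle (Fatou); elsewhere lim takes a default value. *)
Definition boundary_value (R : realType) (f : R[i] -> R[i]) (zeta : R[i])
    : R[i] :=
  lim ((f (r%:C * zeta) : R[i]^o) @[r --> (1 : R)^'-]).

Definition circle_pt (R : realType) (t : R) : R[i] :=
  cos (2 * pi * t) +i* sin (2 * pi * t).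

(* Integral over the circle against normalized Lebesgue measure m, which is the
   image under circle_pt of Lebesgue measure on [0, 1]. *)
Definition circle_integral (R : realType) (g : R[i] -> R[i]) : R[i] :=
  (\int[@lebesgue_measure R]_(t in `[0, 1]) complex.Re (g (circle_pt t)))
  +i* (\int[@lebesgue_measure R]_(t in `[0, 1]) complex.Im (g (circle_pt t))).

Definition blaschke_products (R : realType) (n : nat) (E : set R[i])
    : set (R[i] -> R[i]) :=
  [set B | exists (c : R[i]) (a : 'I_n -> R[i]),
    [/\ circle c, forall k, E (a k) &
        B = (fun z => c * \prod_(k < n) ((z - a k) / (1 - (a k)^* * z)))]].

Definition toeplitz (R : realType) (B h : R[i] -> R[i]) (z : R[i]) : R[i] :=
  circle_integral
    (fun zeta => (B zeta)^* * boundary_value h zeta / (zeta - z) * zeta).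

Definition Omega (R : realType) (n : nat) (E : set R[i]) : \bar R :=
  ereal_sup [set x : \bar R | exists (h B : R[i] -> R[i]),
    [/\ Hinf h, (Hinf_norm h <= 1)%E, blaschke_products n E B &
        x = Hinf_norm (toeplitz B h)]].

Definition ray (R : realType) (eps : R) (xi : R[i]) : set R[i] :=
  [set z | eps%:C <= `|z| < 1 /\ z / `|z| = xi].

(* Main.v *)
(* Upper bound: for r < 1 the integral of conj(B(zeta)) h(r zeta) zeta/(zeta - z)
   is unchanged when one adds h(r zeta) conj(c) b(zeta) w zeta/(1 - w zeta), where
   w = conj z, c is the constant of B and b is the product of the factors
   b_{conj a_k}(w^2 zeta): this function is analytic and vanishes at 0. Since
   zeta/(zeta - z) = P_z - w zeta/(1 - w zeta) on the circle, P being the Poisson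
   kernel, the sum is conj(B) h(r zeta) times
     P_z - w zeta/(1 - w zeta) (1 - prod_k b_{a_k}(zeta) b_{conj a_k}(w^2 zeta)),
   and telescoping the product bounds its modulus by
   P_z + sum_k (P_{a_k} + P_{conj(a_k) z^2}), whose mean is 1 + 2n. Fatou's theorem and
   dominated convergence then give the bound for r = 1.

   Lower bound: put the zeros of B and of h alternately at (1 - tau^i) xi, i = 1, 2,
   ..., 2n, and evaluate at z = (1 - tau^(2n+1)) xi. By Lagrange interpolation and
   Cauchy's formula (T_B h)(z) is a sum of n + 1 terms, one of which tends to 1 and
   the others to 2 as tau -> 0. *)

Require Import Defs.
From HB Require Import structures.
From mathcomp Require Import all_boot all_order all_algebra.
From mathcomp Require Import all_classical all_reals all_analysis.
From mathcomp Require Import measurable_realfun.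
From mathcomp Require Import complex zify ring lra.

Set Implicit Arguments.
Unset Strict Implicit.
Unset Printing Implicit Defensive.
Import Order.TTheory GRing.Theory Num.Theory.
Import numFieldNormedType.Exports.

Local Open Scope classical_set_scope.
Local Open Scope ring_scope.

Import Normc.
Local Open Scope complex_scope.
Local Notation Re := (@complex.Re _).
Local Notation Im := (@complex.Im _).
Local Notation "z ^*" := (conjc z) : ring_scope.

(** * Complex limits and derivability *)

(** The parameters conj a and w^2 are such that, for w nonzero, 1 - b_a(zeta) b_{conj a}(w^2 zeta)
    vanishes at zeta = 1/w, the pole of w zeta/(1 - w zeta): there the second factor is b_{conj
    a}(w), the inverse of b_a(1/w). With the pole cancelled, each factor costs only two Poisson
    kernels, wherever z lies. The dilation makes the added function analytic beyond the closed disc,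
    so its circle mean is its value at 0.

    The obstacle is r -> 1: boundary values are radial limits, so their existence almost everywhere
    is needed. By a change of radius the correlation of h(r zeta) and h(s zeta) depends on rs alone;
    squared L^2 distances of dilations are then second differences of a bounded midpoint convex
    function, and along suitable radii the L^1 distances are summable. The limit represents h by a
    Poisson integral, whose radial limits exist at Lebesgue points.

    In the lower bound, a zero of B and the next zero of h lie on the same side of every other node
    in use, so the ratio of their factors there tends to 1; at the zero of B itself the pair leaves
    a factor -1, which meets a weight tending to -2. *)

Section complex_modulus.
Variable R : realType.
Implicit Types (z w : R[i]) (x y : R).

Lemma norm_normc z : `|z| = (normc z)%:C.
Proof. by case: z. Qed.

Lemma normc_ge0 z : 0 <= normc z.
Proof. by rewrite -ler0c -norm_normc. Qed.

Lemma normcB z w : normc (z - w) = normc (w - z).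
Proof. by rewrite -normcN opprB. Qed.

Lemma normc_eq0 z : (normc z == 0) = (z == 0).
Proof. by rewrite -[LHS](inj_eq (@complexI R)) -norm_normc normr_eq0. Qed.

Lemma normc_gt0 z : (0 < normc z) = (z != 0).
Proof. by rewrite lt_def normc_eq0 normc_ge0 andbT. Qed.

Lemma normc_real x : normc x%:C = `|x|.
Proof. by rewrite /= expr0n addr0 sqrtr_sqr. Qed.

Lemma normc_conj z : normc z^* = normc z.
Proof. by case: z => a b /=; rewrite sqrrN. Qed.

Lemma sqr_normc_conj z : (normc z ^+ 2)%:C = z * z^*.
Proof. by rewrite rmorphXn /= -norm_normc sqr_normc. Qed.

Lemma normcX z n : normc (z ^+ n) = normc z ^+ n.
Proof. by elim: n => [|n ih]; rewrite ?expr0 ?normc1 // !exprS normcM ih. Qed.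

Lemma normc_prod n (f : 'I_n -> R[i]) :
  normc (\prod_(k < n) f k) = \prod_(k < n) normc (f k).
Proof. by rewrite (big_morph (@normc R) (@normcM R) (normc1 R)). Qed.

Lemma normc_Re z : `|Re z| <= normc z.
Proof.
by case: z => a b /=; rewrite -sqrtr_sqr ler_wsqrtr // lerDl sqr_ge0.
Qed.

Lemma normc_Im z : `|Im z| <= normc z.
Proof.
by case: z => a b /=; rewrite -sqrtr_sqr ler_wsqrtr // lerDr sqr_ge0.
Qed.

Lemma normc_ReIm z : normc z <= `|Re z| + `|Im z|.
Proof.
case: z => a b; have -> : a +i* b = a%:C + b%:C * 'i by simpc.
rewrite (le_trans (le_normcD _ _)) // normcM !normc_real /=.
rewrite expr0n expr1n add0r sqrtr1 !(mulr0, mulr1, mul0r).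
by rewrite subr0 !(addr0, add0r).
Qed.

Lemma ler_dist_normc z w : `|normc z - normc w| <= normc (z - w).
Proof.
have h (u v : R[i]) : normc u - normc v <= normc (u - v).
  by rewrite lerBlDr (le_trans _ (le_normcD _ _)) // subrK.
by rewrite ler_norml h andbT lerNl opprB normcB.
Qed.

Lemma Re_mulC x z : Re (x%:C * z) = x * Re z.
Proof. by case: z => a b /=; rewrite mul0r subr0. Qed.

Lemma Im_mulC x z : Im (x%:C * z) = x * Im z.
Proof. by case: z => a b /=; rewrite mul0r addr0. Qed.

Lemma ReM z w : Re (z * w) = Re z * Re w - Im z * Im w.
Proof. by case: z w => [a b] [c d]. Qed.

Lemma ImM z w : Im (z * w) = Re z * Im w + Im z * Re w.
Proof. by case: z w => [a b] [c d]. Qed.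

Lemma ReD z w : Re (z + w) = Re z + Re w.
Proof. by case: z w => [a b] [c d]. Qed.

Lemma ImD z w : Im (z + w) = Im z + Im w.
Proof. by case: z w => [a b] [c d]. Qed.

Lemma ReN z : Re (- z) = - Re z.
Proof. by case: z. Qed.

Lemma ImN z : Im (- z) = - Im z.
Proof. by case: z. Qed.

Lemma Re_conj z : Re z^* = Re z.
Proof. by case: z. Qed.

Lemma Im_conj z : Im z^* = - Im z.
Proof. by case: z. Qed.

Lemma complexP z w : Re z = Re w -> Im z = Im w -> z = w.
Proof. by case: z w => [a b] [c d] /= -> ->. Qed.

End complex_modulus.

Section complex_limits.
Variable R : realType.

(* Limits and continuity in R[i] are phrased with the real-valued modulus. *)
Definition ccvg (T : Type) (F : set_system T) (f : T -> R[i]) (l : R[i]) :=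
  forall e : R, 0 < e -> \forall x \near F, normc (f x - l) < e.

Definition cnbhs (z : R[i]) : set_system R[i] :=
  [set A | exists2 d : R, 0 < d & forall w, normc (w - z) < d -> A w].

Global Instance cnbhs_filter z : Filter (cnbhs z).
Proof.
split=> [|P Q [d d0 hP] [e e0 hQ]|P Q PQ [d d0 hP]].
- by exists 1.
- exists (Num.min d e); first by rewrite lt_min d0.
  by move=> w; rewrite lt_min => /andP[wd we]; split; [exact: hP|exact: hQ].
- by exists d => // w /hP /PQ.
Qed.

Definition ccont (f : R[i] -> R[i]) (z : R[i]) := ccvg (cnbhs z) f (f z).

Section filter.
Context (T : Type) (F : set_system T) {FF : Filter F}.
Implicit Types (f g : T -> R[i]) (l m : R[i]).

Lemma ccvg_ReImP f l : ccvg F f l <->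
  (Re (f x) @[x --> F] --> Re l) /\ (Im (f x) @[x --> F] --> Im l).
Proof.
split=> [h|[/cvgrPdist_lt hr /cvgrPdist_lt hi] e e0].
  split; apply/cvgrPdist_lt => e e0; apply: filterS (h _ e0) => x.
    by rewrite normcB -ReN -ReD; apply/le_lt_trans/normc_Re.
  by rewrite normcB -ImN -ImD; apply/le_lt_trans/normc_Im.
have e20 : 0 < e / 2 by rewrite divr_gt0.
apply: filterS2 (hr _ e20) (hi _ e20) => x xr xi.
rewrite normcB (le_lt_trans (normc_ReIm _)) // ReD ImD ReN ImN.
by rewrite [ltRHS]splitr ltrD.
Qed.

Lemma ccvg_cst l : ccvg F (fun=> l) l.
Proof. by apply/ccvg_ReImP; split; exact: cvg_cst. Qed.

Lemma ccvgD f g l m : ccvg F f l -> ccvg F g m ->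
  ccvg F (fun x => f x + g x) (l + m).
Proof.
move=> /ccvg_ReImP[fr fi] /ccvg_ReImP[gr gi]; apply/ccvg_ReImP.
under eq_fun do rewrite ReD; under [X in X @ F --> Im _]eq_fun do rewrite ImD.
by rewrite ReD ImD; split; apply: cvgD.
Qed.

Lemma ccvgN f l : ccvg F f l -> ccvg F (fun x => - f x) (- l).
Proof.
move=> /ccvg_ReImP[fr fi]; apply/ccvg_ReImP.
under eq_fun do rewrite ReN; under [X in X @ F --> Im _]eq_fun do rewrite ImN.
by rewrite ReN ImN; split; apply: cvgN.
Qed.

Lemma ccvgB f g l m : ccvg F f l -> ccvg F g m ->
  ccvg F (fun x => f x - g x) (l - m).
Proof. by move=> fl gm; apply: ccvgD => //; exact: ccvgN. Qed.

Lemma ccvgM f g l m : ccvg F f l -> ccvg F g m ->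
  ccvg F (fun x => f x * g x) (l * m).
Proof.
move=> /ccvg_ReImP[fr fi] /ccvg_ReImP[gr gi]; apply/ccvg_ReImP.
under eq_fun do rewrite ReM; under [X in X @ F --> Im _]eq_fun do rewrite ImM.
by rewrite ReM ImM; split; [apply: cvgB|apply: cvgD]; apply: cvgM.
Qed.

Lemma ccvg_conj f l : ccvg F f l -> ccvg F (fun x => (f x)^*) l^*.
Proof.
move=> fl e e0; apply: filterS (fl e e0) => x.
by rewrite -rmorphB normc_conj.
Qed.

Lemma ccvg_real (f : T -> R) (l : R) :
  f @ F --> l -> ccvg F (fun x => (f x)%:C) l%:C.
Proof. by move=> h; apply/ccvg_ReImP; split => //=; exact: cvg_cst. Qed.

Lemma cvg_normc f l : ccvg F f l -> normc (f x) @[x --> F] --> normc l.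
Proof.
move=> fl; apply/cvgrPdist_lt => e e0; apply: filterS (fl e e0) => x.
by rewrite normcB; exact/le_lt_trans/ler_dist_normc.
Qed.

Lemma ccvgV f l : l != 0 -> ccvg F f l -> ccvg F (fun x => (f x)^-1) l^-1.
Proof.
have invE (z : R[i]) : z^-1 = ((normc z ^+ 2)^-1)%:C * z^*.
  by rewrite invc_norm norm_normc fmorphV rmorphXn.
move=> l0 fl; rewrite invE; under eq_fun do rewrite invE.
apply: ccvgM; last exact: ccvg_conj.
apply: ccvg_real; apply: cvgV; first by rewrite expf_neq0 // normc_eq0.
by rewrite !expr2; apply: cvgM; exact: cvg_normc.
Qed.

Lemma ccvg_prod n (f : 'I_n -> T -> R[i]) (l : 'I_n -> R[i]) :
  (forall k, ccvg F (f k) (l k)) ->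
  ccvg F (fun x => \prod_(k < n) f k x) (\prod_(k < n) l k).
Proof.
elim: n f l => [|n ih] f l h.
  by under eq_fun do rewrite big_ord0; rewrite big_ord0; exact: ccvg_cst.
under eq_fun do rewrite big_ord_recr; rewrite big_ord_recr /=.
by apply: ccvgM => //; apply: (ih (fun k => f (widen_ord (leqnSn n) k))).
Qed.

Lemma ccvg_sum n (f : 'I_n -> T -> R[i]) (l : 'I_n -> R[i]) :
  (forall k, ccvg F (f k) (l k)) ->
  ccvg F (fun x => \sum_(k < n) f k x) (\sum_(k < n) l k).
Proof.
elim: n f l => [|n ih] f l h.
  by under eq_fun do rewrite big_ord0; rewrite big_ord0; exact: ccvg_cst.
under eq_fun do rewrite big_ord_recr; rewrite big_ord_recr /=.
by apply: ccvgD => //; apply: (ih (fun k => f (widen_ord (leqnSn n) k))).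
Qed.

Lemma ccont_ccvg (f : R[i] -> R[i]) g l :
  ccont f l -> ccvg F g l -> ccvg F (f \o g) (f l).
Proof.
move=> cf gl e e0; have [d d0 h] := cf e e0.
by apply: filterS (gl d d0) => x /h.
Qed.

Lemma ccvg_lim (f : T -> R[i]) l :
  ProperFilter F -> ccvg F f l -> lim ((f x : R[i]^o) @[x --> F]) = l.
Proof.
move=> PF fl; apply: cvg_lim => //; apply/cvgrPdist_lt => e.
(* Positivity in [R[i]] forces a zero imaginary part, so a radius in [R[i]] is a real number. *)
case: e => a b; rewrite ltcE /= => /andP[/eqP -> a0].
apply: filterS (fl _ a0) => x /=.
by rewrite norm_normc complexr0 ltcR normcB.
Qed.

End filter.

Lemma ccvg_id z : ccvg (cnbhs z) id z.
Proof. by move=> e e0; exists e. Qed.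

Lemma nbhs_cnbhs (z : R[i]) : nbhs (z : R[i]^o) = cnbhs z.
Proof.
apply/seteqP; split => A.
  move=> /nbhs_ballP[e /= e0 h].
  move: e0 h; case: e => a b; rewrite ltcE /= => /andP[/eqP -> a0] h.
  exists a => // w wz; apply: h; rewrite /ball /= norm_normc normcB.
  by rewrite complexr0 ltcR.
move=> [d d0 h]; apply/nbhs_ballP; exists d%:C => /=; first by rewrite ltcR.
by move=> w; rewrite /ball /= norm_normc ltcR normcB; exact: h.
Qed.

End complex_limits.

Section complex_derivability.
Variable R : realType.
Local Notation C := R[i]^o.
Implicit Types (f g : R[i] -> R[i]) (z : R[i]).

Definition cdiff f z := derivable (f : C -> C) z 1.

(** Caratheodory's form of differentiability: the slope is a function continuous at z, so no
    quotient occurs. The chain rule becomes algebra, Goursat's local estimate reads off the linear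
    part, and the same slope is the integrand behind Cauchy's formula. *)
Lemma cdiff_slopeP f z : cdiff f z <->
  exists2 phi, ccont phi z & forall w, f w = f z + phi w * (w - z).
Proof.
split=> [/cvg_ex[/= d /cvgrPdist_lt h]|[phi cphi h]].
  exists (fun w => if w == z then d else (f w - f z) / (w - z)); last first.
    move=> w; case: eqVneq => [->|wz]; first by rewrite subrr mulr0 addr0.
    by rewrite divfK ?subr_eq0 // addrC subrK.
  move=> e e0; rewrite eqxx; have /h : 0 < e%:C by rewrite ltcR.
  rewrite near_withinE /= => {}h.
  have : nbhs (0 : C) (fun t => t != 0 ->
      `|d - t^-1 *: (f (t *: 1 + z) - f z)| < e%:C) by [].
  rewrite nbhs_cnbhs.
  case=> a a0 ha; exists a => // w wz /=; case: eqVneq => [_|wz0].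
    by rewrite subrr normc0.
  have := ha (w - z); rewrite subr0 => /(_ wz); rewrite subr_eq0 => /(_ wz0).
  rewrite norm_normc ltcR normcB /= [_ *: 1]mulr1 subrK.
  by rewrite [_ *: _]mulrC.
apply/cvg_ex; exists (phi z); apply/cvgrPdist_lt => e.
case: e => a b; rewrite ltcE /= => /andP[/eqP -> a0].
rewrite near_withinE.
suff : nbhs (0 : C) (fun t => t != 0 ->
    `|phi z - t^-1 *: (f (t *: 1 + z) - f z)| < a +i* 0) by [].
rewrite nbhs_cnbhs.
have [d d0 hd] := cphi _ a0; exists d => // w; rewrite subr0 => wd w0.
rewrite norm_normc complexr0 ltcR normcB /= h addrAC subrr add0r.
rewrite [_ *: 1]mulr1 addrK [_ *: _]mulrC mulfK //.
by apply: hd; rewrite addrK.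
Qed.

Lemma cdiff_cont f z : cdiff f z -> ccont f z.
Proof.
move=> /cdiff_slopeP[phi cphi h]; rewrite /ccont (funext h).
rewrite subrr mulr0 addr0 -[X in ccvg _ _ X]addr0 -(mulr0 (phi z)).
apply: ccvgD; first exact: ccvg_cst.
apply: ccvgM => //; rewrite -(subrr z); apply: ccvgB; first exact: ccvg_id.
exact: ccvg_cst.
Qed.

Lemma cdiff_cst (c : R[i]) z : cdiff (fun=> c) z.
Proof. exact: derivable_cst. Qed.

Lemma cdiff_id z : cdiff id z.
Proof. exact: derivable_id. Qed.

Lemma cdiffB f g z : cdiff f z -> cdiff g z -> cdiff (fun w => f w - g w) z.
Proof. exact: derivableB. Qed.

Lemma cdiffM f g z : cdiff f z -> cdiff g z -> cdiff (fun w => f w * g w) z.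
Proof. exact: derivableM. Qed.

Lemma cdiffV f z : f z != 0 -> cdiff f z -> cdiff (fun w => (f w)^-1) z.
Proof. exact: derivableV. Qed.

Lemma cdiff_prod n (f : 'I_n -> R[i] -> R[i]) z :
  (forall k, cdiff (f k) z) -> cdiff (fun w => \prod_(k < n) f k w) z.
Proof.
elim: n f => [|n ih] f hf.
  by under eq_fun do rewrite big_ord0; exact: cdiff_cst.
under eq_fun do rewrite big_ord_recr.
by apply: cdiffM => //; apply: (ih (fun k => f (widen_ord (leqnSn n) k))).
Qed.

Lemma cdiff_comp f g z : cdiff f z -> cdiff g (f z) -> cdiff (g \o f) z.
Proof.
move=> df /cdiff_slopeP[psi cpsi hg]; have cf := cdiff_cont df.
case/cdiff_slopeP: df => phi cphi hf; apply/cdiff_slopeP.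
exists (fun w => psi (f w) * phi w).
  by apply: ccvgM => //; exact: (ccont_ccvg cpsi cf).
by move=> w; rewrite /= hg [in X in _ * X]hf addrAC subrr add0r mulrA.
Qed.

(** Schwarz reflection. It is what makes conj(h(q / conj v)) analytic in v in
    [correlation_product]. *)
Lemma cdiff_conj f z : cdiff f z^* -> cdiff (fun w => (f w^*)^*) z.
Proof.
move=> /cdiff_slopeP[phi cphi h]; apply/cdiff_slopeP.
exists (fun w => (phi w^*)^*).
  by apply: ccvg_conj; apply: (ccont_ccvg cphi); apply: ccvg_conj; exact: ccvg_id.
by move=> w; rewrite h rmorphD rmorphM rmorphB /= !conjcK.
Qed.

End complex_derivability.

(** * Integrals over the circle *)

Section circle_integrals.
Variable R : realType.
Local Notation mu := (@lebesgue_measure R).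
Local Notation I01 := (`[0, 1]%classic : set R).

(** Continuity on the whole line rather than on [0, 1], so that integrability holds on every segment
    and primitives can start to the left of 0. *)
Definition rcont (f : R -> R[i]) := forall t, ccvg (nbhs t) f (f t).

Definition Cint (f : R -> R[i]) : R[i] :=
  (\int[mu]_(t in `[0, 1]) Re (f t)) +i* (\int[mu]_(t in `[0, 1]) Im (f t)).

Lemma circle_integralE (g : R[i] -> R[i]) :
  circle_integral g = Cint (g \o @circle_pt R).
Proof. by []. Qed.

Lemma rcont_Re f : rcont f -> continuous (fun t => Re (f t)).
Proof. by move=> cf t; have /ccvg_ReImP[] := cf t. Qed.

Lemma rcont_Im f : rcont f -> continuous (fun t => Im (f t)).
Proof. by move=> cf t; have /ccvg_ReImP[] := cf t. Qed.

Lemma rcont_normc f : rcont f -> continuous (fun t => normc (f t)).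
Proof. by move=> cf t; apply: cvg_normc; exact: cf. Qed.

Lemma continuous_itv_integrable (u : R -> R) a b : continuous u ->
  mu.-integrable `[a, b] (EFin \o u).
Proof.
move=> cu; apply: continuous_compact_integrable; first exact: segment_compact.
exact: continuous_subspaceT.
Qed.

Lemma CintD f g : rcont f -> rcont g ->
  Cint (fun t => f t + g t) = Cint f + Cint g.
Proof.
move=> cf cg; apply: complexP; rewrite ?ReD ?ImD /=.
  under eq_Rintegral do rewrite ReD.
  by rewrite RintegralD //; apply: continuous_itv_integrable; exact: rcont_Re.
under eq_Rintegral do rewrite ImD.
by rewrite RintegralD //; apply: continuous_itv_integrable; exact: rcont_Im.
Qed.

Lemma CintZ c f : rcont f -> Cint (fun t => c * f t) = c * Cint f.
Proof.
move=> cf; have ir := continuous_itv_integrable 0 1 (rcont_Re cf).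
have ii := continuous_itv_integrable 0 1 (rcont_Im cf).
have ir' x : mu.-integrable I01 (EFin \o (fun t => x * Re (f t))).
  by apply: eq_integrable (integrableZl _ x ir).
have ii' x : mu.-integrable I01 (EFin \o (fun t => x * Im (f t))).
  by apply: eq_integrable (integrableZl _ x ii).
apply: complexP; rewrite ?ReM ?ImM /=.
  under eq_Rintegral do rewrite ReM.
  by rewrite RintegralB // !RintegralZl.
under eq_Rintegral do rewrite ImM.
by rewrite RintegralD // !RintegralZl.
Qed.

Lemma rcont_cst c : rcont (fun=> c).
Proof. by move=> t; exact: ccvg_cst. Qed.

Lemma rcontD f g : rcont f -> rcont g -> rcont (fun t => f t + g t).
Proof. by move=> cf cg t; exact: ccvgD. Qed.

Lemma rcontN f : rcont f -> rcont (fun t => - f t).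
Proof. by move=> cf t; exact: ccvgN. Qed.

Lemma rcontB f g : rcont f -> rcont g -> rcont (fun t => f t - g t).
Proof. by move=> cf cg t; exact: ccvgB. Qed.

Lemma rcontM f g : rcont f -> rcont g -> rcont (fun t => f t * g t).
Proof. by move=> cf cg t; exact: ccvgM. Qed.

Lemma rcontV f : (forall t, f t != 0) -> rcont f -> rcont (fun t => (f t)^-1).
Proof. by move=> f0 cf t; exact: ccvgV. Qed.

Lemma rcont_conj f : rcont f -> rcont (fun t => (f t)^*).
Proof. by move=> cf t; exact: ccvg_conj. Qed.

Lemma rcont_prod n (f : 'I_n -> R -> R[i]) :
  (forall k, rcont (f k)) -> rcont (fun t => \prod_(k < n) f k t).
Proof. by move=> cf t; apply: ccvg_prod => k; exact: cf. Qed.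

Lemma rcont_sum n (f : 'I_n -> R -> R[i]) :
  (forall k, rcont (f k)) -> rcont (fun t => \sum_(k < n) f k t).
Proof. by move=> cf t; apply: ccvg_sum => k; exact: cf. Qed.

Lemma CintN f : rcont f -> Cint (fun t => - f t) = - Cint f.
Proof.
by move=> cf; rewrite -mulN1r -CintZ //; congr Cint; apply/funext => t; rewrite mulN1r.
Qed.

Lemma CintB f g : rcont f -> rcont g ->
  Cint (fun t => f t - g t) = Cint f - Cint g.
Proof. by move=> cf cg; rewrite CintD ?CintN //; exact: rcontN. Qed.

Lemma Cint_sum n (f : 'I_n -> R -> R[i]) : (forall k, rcont (f k)) ->
  Cint (fun t => \sum_(k < n) f k t) = \sum_(k < n) Cint (f k).
Proof.
elim: n f => [|n ih] f cf.
  rewrite big_ord0 -[RHS](mul0r (Cint (fun=> 0))) -CintZ; last exact: rcont_cst.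
  by congr Cint; apply/funext => t; rewrite big_ord0 mul0r.
rewrite big_ord_recr /= -ih // -CintD //; last exact: rcont_sum.
by congr Cint; apply/funext => t; rewrite big_ord_recr.
Qed.

Lemma Cint_conj f : rcont f -> Cint (fun t => (f t)^*) = (Cint f)^*.
Proof.
move=> cf; apply: complexP; rewrite ?Re_conj ?Im_conj /=.
  by under eq_Rintegral do rewrite Re_conj.
under eq_Rintegral do rewrite Im_conj -mulN1r.
rewrite RintegralZl ?mulN1r //.
by apply: continuous_itv_integrable; exact: rcont_Im.
Qed.

Lemma Rintegral_cst01 (c : R) : \int[mu]_(t in `[0, 1]) c = c.
Proof.
rewrite Rintegral_cst //= lebesgue_measure_itv /= lte_fin ltr01.
by rewrite -EFinB subr0 mulr1.
Qed.

Lemma Cint_cst c : Cint (fun=> c) = c.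
Proof. by rewrite /Cint !Rintegral_cst01; case: c. Qed.

Lemma Re_Cint f : Re (Cint f) = \int[mu]_(t in `[0, 1]) Re (f t).
Proof. by []. Qed.

(** Rotating an integral onto the positive axis turns its modulus into a real part. This gives
    [normc_Cint_le] with constant 1, as the sharp value 1 + 2n requires. For z = 0 the factor is 0,
    whence the inequality. *)
Lemma unimodular_factor (z : R[i]) :
  exists2 c : R[i], normc c <= 1 & c * z = (normc z)%:C.
Proof.
have [->|z0] := eqVneq z 0.
  by exists 0; rewrite ?normc0 ?ler01 // mul0r.
exists (z^* / (normc z)%:C).
  by rewrite normcM normcV normc_conj normc_real ger0_norm ?normc_ge0 ?divff ?normc_eq0.
rewrite mulrAC mulrC [z^* * z]mulrC -sqr_normc_conj -fmorphV -rmorphM expr2.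
by rewrite /= mulrA mulVf ?mul1r // normc_eq0.
Qed.

Lemma normc_Cint_le f (u : R -> R) : rcont f -> mu.-integrable I01 (EFin \o u) ->
  (forall t, t \in `[0, 1] -> normc (f t) <= u t) ->
  normc (Cint f) <= \int[mu]_(t in `[0, 1]) u t.
Proof.
move=> cf iu fu; have [c c1 cE] := unimodular_factor (Cint f).
have cf' : rcont (fun t => c * f t) by apply: rcontM => //; exact: rcont_cst.
have -> : normc (Cint f) = Re (Cint (fun t => c * f t)) by rewrite CintZ // cE.
rewrite Re_Cint; apply: le_Rintegral => //.
  by apply: continuous_itv_integrable; exact: rcont_Re.
move=> t tI; apply: le_trans (fu t tI); rewrite (le_trans (ler_norm _)) //.
by rewrite (le_trans (normc_Re _)) // normcM ler_piMl // normc_ge0.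
Qed.

(** Integrability of [u] is part of the conclusion because boundary functions are obtained only as
    almost everywhere limits. *)
Lemma Rintegral_dominated_cvg (un : nat -> R -> R) (u : R -> R) (M : R) :
  (forall n, measurable_fun I01 (un n)) -> measurable_fun I01 u ->
  (forall n t, t \in `[0, 1] -> `|un n t| <= M) ->
  {ae mu, forall t, t \in `[0, 1] -> un n t @[n --> \oo] --> u t} ->
  mu.-integrable I01 (EFin \o u) /\
  \int[mu]_(t in `[0, 1]) un n t @[n --> \oo] --> \int[mu]_(t in `[0, 1]) u t.
Proof.
move=> mun mu_ bun hcvg.
have [||||||iu _ h] := @dominated_convergence _ _ _ mu I01 _
  (fun n => EFin \o un n) (EFin \o u) (EFin \o cst M).
- exact: measurable_itv.
- by move=> n; apply/measurable_EFinP; exact: mun.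
- exact/measurable_EFinP.
- have [N [mN N0 sN]] := hcvg; exists N; split => //.
  apply: subset_trans sN => t h1 h2; apply: h1 => tI.
  by apply: cvg_EFin; [near=> n|exact: h2].
- by apply: continuous_itv_integrable => x; exact: cvg_cst.
- apply: aeW => t n tI; rewrite /= lee_fin; exact: bun.
split => //; apply: fine_cvg; rewrite fineK //; exact: integrable_fin_num.
Unshelve. all: by end_near. Qed.

Lemma Cint_cvg (fn : nat -> R -> R[i]) (f : R -> R[i]) (M : R) :
  (forall n, rcont (fn n)) -> rcont f ->
  (forall n t, t \in `[0, 1] -> normc (fn n t) <= M) ->
  (forall t, t \in `[0, 1] -> ccvg \oo (fn ^~ t) (f t)) ->
  ccvg \oo (fun n => Cint (fn n)) (Cint f).
Proof.
move=> cfn cf bfn h.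
have mC (u : R -> R) : continuous u -> measurable_fun I01 u.
  move=> cu; have /integrableP[] := continuous_itv_integrable 0 1 cu.
  by move=> /measurable_EFinP.
apply/ccvg_ReImP; split.
  apply: (@Rintegral_dominated_cvg (fun n t => Re (fn n t)) _ M _ _ _ _).2.
  - by move=> n; apply: mC; exact: rcont_Re.
  - by apply: mC; exact: rcont_Re.
  - by move=> n t tI; apply: le_trans (bfn n t tI); exact: normc_Re.
  - by apply: aeW => t tI; have /ccvg_ReImP[] := h t tI.
apply: (@Rintegral_dominated_cvg (fun n t => Im (fn n t)) _ M _ _ _ _).2.
- by move=> n; apply: mC; exact: rcont_Im.
- by apply: mC; exact: rcont_Im.
- by move=> n t tI; apply: le_trans (bfn n t tI); exact: normc_Im.
- by apply: aeW => t tI; have /ccvg_ReImP[] := h t tI.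
Qed.

Lemma normc_circle_pt (t : R) : normc (circle_pt t) = 1.
Proof. by rewrite /circle_pt /= cos2Dsin2 sqrtr1. Qed.

Lemma circle_pt_conj (t : R) : circle_pt t * (circle_pt t)^* = 1.
Proof. by rewrite -sqr_normc_conj normc_circle_pt expr1n. Qed.

Lemma circle_pt_neq0 (t : R) : circle_pt t != 0.
Proof. by rewrite -normc_gt0 normc_circle_pt ltr01. Qed.

Lemma circle_ptV (t : R) : (circle_pt t)^-1 = (circle_pt t)^*.
Proof.
by apply: (mulfI (circle_pt_neq0 t)); rewrite circle_pt_conj divff // circle_pt_neq0.
Qed.

Lemma circle_pt0 : circle_pt 0 = 1 :> R[i].
Proof. by rewrite /circle_pt mulr0 cos0 sin0. Qed.

Lemma circle_pt1 : circle_pt 1 = 1 :> R[i].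
Proof. by rewrite /circle_pt mulr1 mulr_natl cos2pi sin2pi. Qed.

Lemma rcont_circle_pt : rcont (@circle_pt R).
Proof.
have h : continuous (fun t : R => 2 * pi * t).
  by move=> t; apply: cvgM; [exact: cvg_cst|exact: cvg_id].
move=> t; apply/ccvg_ReImP; split => /=.
  by apply: (cvg_comp _ _ (h t)); exact: continuous_cos.
by apply: (cvg_comp _ _ (h t)); exact: continuous_sin.
Qed.

Lemma ccont_rcont (f : R[i] -> R[i]) (g : R -> R[i]) : rcont g ->
  (forall t, ccont f (g t)) -> rcont (fun t => f (g t)).
Proof. by move=> cg cf t; apply: (ccont_ccvg (cf t)); exact: cg. Qed.

End circle_integrals.

(** * Goursat's theorem in polar coordinates *)

Section goursat.
Variable R : realType.
Local Notation mu := (@lebesgue_measure R).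

(* J is an additive function of rectangles [x1, x2] x [y1, y2], used for the integral
   of a form along the boundary of a polar cell. *)
Lemma bisection_null (J : R -> R -> R -> R -> R[i]) (a h c k : R) :
  0 <= h -> 0 <= k ->
  (forall x1 x2 x3 y1 y2, J x1 x3 y1 y2 = J x1 x2 y1 y2 + J x2 x3 y1 y2) ->
  (forall x1 x2 y1 y2 y3, J x1 x2 y1 y3 = J x1 x2 y1 y2 + J x1 x2 y2 y3) ->
  (forall p q, a <= p <= a + h -> c <= q <= c + k ->
    forall e, 0 < e -> exists2 d, 0 < d & forall x y s, 0 < s < d ->
    a <= x -> x + s * h <= a + h -> x <= p <= x + s * h ->
    c <= y -> y + s * k <= c + k -> y <= q <= y + s * k ->
    normc (J x (x + s * h) y (y + s * k)) <= e * s ^+ 2) ->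
  J a (a + h) c (c + k) = 0.
Proof.
move=> h0 k0 addx addy loc; apply/eqP; rewrite -normc_eq0.
apply: contraT => M0; set M := normc _ in M0.
have {}M0 : 0 < M by rewrite lt_def M0 normc_ge0.
pose s n : R := (2^-1) ^+ n.
have s0 n : 0 < s n by rewrite exprn_gt0.
have sS n : s n = s n.+1 + s n.+1.
  by rewrite /s exprS; lra.
pose cell n (p : R * R) := normc (J p.1 (p.1 + s n * h) p.2 (p.2 + s n * k)).
(* By additivity one of the four quarters carries at least a quarter of the modulus of the cell. *)
have step (np : nat * (R * R)) : exists q : R * R,
  [/\ np.2.1 <= q.1 <= np.2.1 + s np.1.+1 * h,
      np.2.2 <= q.2 <= np.2.2 + s np.1.+1 * k &
      cell np.1 np.2 <= 4 * cell np.1.+1 q].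
  case: np => n [x y] /=.
  have hs : 0 <= s n.+1 * h by rewrite mulr_ge0 // ltW.
  have ks : 0 <= s n.+1 * k by rewrite mulr_ge0 // ltW.
  have E : cell n (x, y) <= cell n.+1 (x, y) + cell n.+1 (x + s n.+1 * h, y)
    + (cell n.+1 (x, y + s n.+1 * k) + cell n.+1 (x + s n.+1 * h, y + s n.+1 * k)).
    rewrite /cell /= (sS n) !mulrDl !addrA.
    rewrite (addx x (x + s n.+1 * h)).
    rewrite !(addy _ _ y (y + s n.+1 * k) (y + s n.+1 * k + s n.+1 * k)).
    rewrite (le_trans (le_normcD _ _)) //.
    have -> (u v w z : R) : u + v + w + z = (u + w) + (v + z) by ring.
    by rewrite lerD // le_normcD.
  have [h1|h1] := lerP (cell n (x, y)) (4 * cell n.+1 (x, y)).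
    by exists (x, y); rewrite /= !lexx !lerDl hs ks.
  have [h2|h2] := lerP (cell n (x, y)) (4 * cell n.+1 (x + s n.+1 * h, y)).
    by exists (x + s n.+1 * h, y); rewrite /= !lexx !lerDl hs ks.
  have [h3|h3] := lerP (cell n (x, y)) (4 * cell n.+1 (x, y + s n.+1 * k)).
    by exists (x, y + s n.+1 * k); rewrite /= !lexx !lerDl hs ks.
  exists (x + s n.+1 * h, y + s n.+1 * k); rewrite /= !lexx !lerDl hs ks.
  split=> //; lra.
have [next nextP] := choice step.
pose P := fix P n := if n is m.+1 then next (m, P m) else (a, c).
have PM n : M * s n ^+ 2 <= cell n (P n).
  elim: n => [|n ih]; first by rewrite /cell /s expr0 expr1n !mul1r mulr1.
  have [_ _] := nextP (n, P n); rewrite /= -/(P n.+1).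
  have -> : M * s n.+1 ^+ 2 = M * s n ^+ 2 / 4.
    by rewrite (sS n); field.
  lra.
(* Lower ends increase and upper ends decrease, so the supremum of the lower ends lies in every
   interval. This is applied to the two coordinates separately. *)
have nest (u : nat -> R) (v l : R) : 0 <= l -> u 0%N = v ->
    (forall n, u n <= u n.+1 <= u n + s n.+1 * l) ->
    exists p, forall n, [/\ v <= u n, u n + s n * l <= v + l & u n <= p <= u n + s n * l].
  move=> l0 u0 hu.
  have up m n : u n <= u (n + m)%N.
    elim: m => [|m ih]; first by rewrite addn0.
    by rewrite addnS (le_trans ih) //; case/andP: (hu (n + m)%N).
  have down m n : u (n + m)%N + s (n + m)%N * l <= u n + s n * l.
    elim: m => [|m ih]; first by rewrite addn0.
    rewrite addnS; apply: le_trans ih; case/andP: (hu (n + m)%N) => _ h1.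
    by rewrite (sS (n + m)%N) mulrDl addrA lerD2r.
  have ub m n : u m <= u n + s n * l.
    have [mn|nm] := leqP m n.
      rewrite (le_trans (up (n - m)%N m)) // subnKC // lerDl mulr_ge0 //.
      exact: ltW.
    rewrite (le_trans _ (down (m - n)%N n)) // subnKC; last exact: ltnW.
    by rewrite lerDl mulr_ge0 // ltW.
  exists (sup (range u)) => n; split.
  - by rewrite -u0; have := up n 0%N; rewrite add0n.
  - by have := down n 0%N; rewrite add0n u0 /s expr0 mul1r.
  apply/andP; split.
    apply: ub_le_sup; last by exists n.
    by exists (u 0%N + s 0%N * l) => _ [m _ <-].
  apply: ge_sup; first by exists (u 0%N); exists 0%N.
  by move=> _ [m _ <-].
have [p hp] : exists p, forall n, [/\ a <= (P n).1, (P n).1 + s n * h <= a + h &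
    (P n).1 <= p <= (P n).1 + s n * h].
  by apply: (nest (fun n => (P n).1)) => // n; case: (nextP (n, P n)).
have [q hq] : exists q, forall n, [/\ c <= (P n).2, (P n).2 + s n * k <= c + k &
    (P n).2 <= q <= (P n).2 + s n * k].
  by apply: (nest (fun n => (P n).2)) => // n; case: (nextP (n, P n)).
have pI : a <= p <= a + h.
  by case: (hp 0%N) => _ _; rewrite /s expr0 mul1r.
have qI : c <= q <= c + k.
  by case: (hq 0%N) => _ _; rewrite /s expr0 mul1r.
(* The chosen cells have modulus at least M 4^-n by [PM]; the local estimate with constant M / 2 at
   their common point contradicts this. *)
have M20 : 0 < M / 2 by rewrite divr_gt0.
have [d d0 hd] := loc p q pI qI (M / 2) M20.
have [n sn] : exists n, s n < d.
  have : s n @[n --> \oo] --> (0 : R).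
    apply: cvg_expr; rewrite gtr0_norm ?invr_gt0 // invf_lt1 //; lra.
  move=> /cvgrPdist_lt/(_ _ d0)[N _ hN]; exists N.
  by have := hN N (leqnn N); rewrite sub0r normrN gtr0_norm.
have [x1 x2 x3] := hp n; have [y1 y2 y3] := hq n.
have sn' : 0 < s n < d by rewrite s0 sn.
have := hd _ _ _ sn' x1 x2 x3 y1 y2 y3.
rewrite -/(cell n (P n)) => le1; have le2 := PM n.
have : M * s n ^+ 2 <= M / 2 * s n ^+ 2 by exact: le_trans le2 le1.
rewrite ler_pM2r ?exprn_gt0 //; lra.
Qed.

Definition cderiv (F : R -> R[i]) (x : R) (l : R[i]) :=
  is_derive x 1 (fun t => Re (F t)) (Re l) /\
  is_derive x 1 (fun t => Im (F t)) (Im l).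

Lemma cderiv_cst c x : cderiv (fun=> c) x 0.
Proof. by split; exact: is_derive_cst. Qed.

Lemma cderivD F G x l m : cderiv F x l -> cderiv G x m ->
  cderiv (fun t => F t + G t) x (l + m).
Proof.
move=> [Fr Fi] [Gr Gi]; split; rewrite ?ReD ?ImD.
  by under eq_fun do rewrite ReD; exact: is_deriveD.
by under eq_fun do rewrite ImD; exact: is_deriveD.
Qed.

Lemma cderivM F G x l m : cderiv F x l -> cderiv G x m ->
  cderiv (fun t => F t * G t) x (l * G x + F x * m).
Proof.
move=> [Fr Fi] [Gr Gi]; split.
  under eq_fun do rewrite ReM.
  apply: is_derive_eq; rewrite ReD !ReM /GRing.scale /=; ring.
under eq_fun do rewrite ImM.
apply: is_derive_eq; rewrite ImD !ImM /GRing.scale /=; ring.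
Qed.

Lemma cderivZ c F x l : cderiv F x l -> cderiv (fun t => c * F t) x (c * l).
Proof.
by move=> /(cderivM (cderiv_cst c x)); rewrite mul0r add0r.
Qed.

Lemma cderivN F x l : cderiv F x l -> cderiv (fun t => - F t) x (- l).
Proof.
move=> /(cderivZ (-1)); rewrite mulN1r.
by under eq_fun do rewrite mulN1r.
Qed.

Lemma cderivB F G x l m : cderiv F x l -> cderiv G x m ->
  cderiv (fun t => F t - G t) x (l - m).
Proof. by move=> hF hG; apply: cderivD => //; exact: cderivN. Qed.

Lemma cderiv_real x : cderiv (fun r => r%:C) x 1.
Proof. by split => /=; [exact: is_derive_id|exact: is_derive_cst]. Qed.

Lemma cderiv_circle_pt t :
  cderiv (@circle_pt R) t ((2 * pi)%:C * 'i * circle_pt t).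
Proof.
have hl : is_derive t 1 (fun u : R => 2 * pi * u) (2 * pi).
  by apply: is_derive_eq; rewrite /GRing.scale /= mulr1.
split => /=.
  have := @is_derive1_comp _ cos _ t _ _ (is_derive_cos (2 * pi * t)) hl.
  by move=> h; apply: is_derive_eq; ring.
have := @is_derive1_comp _ sin _ t _ _ (is_derive_sin (2 * pi * t)) hl.
by move=> h; apply: is_derive_eq; ring.
Qed.

(** The mean value theorem is applied to each component, whence the factor 2. It is harmless: the
    lemma serves only for Lipschitz bounds and orders of smallness. *)
Lemma cderiv_le F F' (x1 x2 e : R) : x1 <= x2 ->
  (forall x, x1 <= x <= x2 -> cderiv F x (F' x)) ->
  (forall x, x1 <= x <= x2 -> normc (F' x) <= e) ->
  normc (F x2 - F x1) <= 2 * e * (x2 - x1).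
Proof.
move=> x12 dF bF.
have real_part (u u' : R -> R) : (forall x, x1 <= x <= x2 -> is_derive x 1 u (u' x)) ->
    (forall x, x1 <= x <= x2 -> `|u' x| <= e) -> `|u x2 - u x1| <= e * (x2 - x1).
  move=> du bu; have [||c] := MVT_segment x12 (f := u) (df := u').
  - by move=> x; rewrite in_itv /= => /andP[h1 h2]; apply: du; rewrite !ltW.
  - apply: derivable_within_continuous => x; rewrite in_itv /= => /du h.
    exact: ex_derive.
  rewrite in_itv /= => cI ->; rewrite normrM [X in _ * X]ger0_norm ?subr_ge0 //.
  by rewrite ler_wpM2r ?subr_ge0 // bu.
rewrite (le_trans (normc_ReIm _)) // ReD ImD ReN ImN -mulrA mulr_natl mulr2n.
apply: lerD.
  apply: (real_part (fun x => Re (F x)) (fun x => Re (F' x))).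
    by move=> x /dF[].
  by move=> x /bF; exact/le_trans/normc_Re.
apply: (real_part (fun x => Im (F x)) (fun x => Im (F' x))).
  by move=> x /dF[].
by move=> x /bF; exact/le_trans/normc_Im.
Qed.

Lemma circle_pt_lip (s t : R) :
  normc (circle_pt s - circle_pt t) <= 4 * pi * `|s - t|.
Proof.
wlog ts : s t / t <= s.
  by move=> h; case: (leP t s) => [/h //|/ltW/h]; rewrite normcB distrC.
rewrite ger0_norm ?subr_ge0 //.
have := @cderiv_le (@circle_pt R) _ t s (2 * pi) ts (fun x _ => cderiv_circle_pt x).
rewrite !mulrA -natrM; apply => x _.
rewrite !normcM normc_circle_pt mulr1 normc_real /= expr0n expr1n add0r.
by rewrite sqrtr1 mulr1 ger0_norm // mulr_ge0 // pi_ge0.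
Qed.

(** The derivative is computed strictly to the right of the base point [a], so base points are later
    taken below the range in use. *)
Definition cprim (a : R) (f : R -> R[i]) (x : R) : R[i] :=
  (\int[mu]_(t in `[a, x]) Re (f t)) +i* (\int[mu]_(t in `[a, x]) Im (f t)).

Lemma cderiv_cprim a f x : rcont f -> a < x -> cderiv (cprim a f) x (f x).
Proof.
move=> cf ax; have xx1 : x < x + 1 by rewrite ltrDl.
have real_part (u : R -> R) : continuous u ->
    is_derive x 1 (fun y => \int[mu]_(t in `[a, y]) u t) (u x).
  move=> cu; have [|h1 h2] := @continuous_FTC1_closed _ u a x (x + 1) xx1 _ ax (cu x).
    exact: continuous_itv_integrable.
  by rewrite derive1E in h2; exact: DeriveDef h1 h2.
by split; apply: real_part; [exact: rcont_Re|exact: rcont_Im].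
Qed.

Lemma cprimB a f : rcont f -> a < 0 -> cprim a f 1 - cprim a f 0 = Cint f.
Proof.
move=> cf a0.
have real_part (u : R -> R) : continuous u ->
    \int[mu]_(t in `[a, 1]) u t - \int[mu]_(t in `[a, 0]) u t =
    \int[mu]_(t in `[0, 1]) u t.
  move=> cu; rewrite Rintegral_itvB ?bnd_simp ?ltW ?ltr01 //; last first.
    exact: continuous_itv_integrable.
  rewrite Rintegral_itv_obnd_cbnd //.
  apply: integrableS (continuous_itv_integrable 0 1 cu) => //.
  by apply: subset_itvr; rewrite bnd_simp.
by apply: complexP; rewrite ?ReD ?ImD ?ReN ?ImN /= real_part //;
  [exact: rcont_Re|exact: rcont_Im].
Qed.

End goursat.

(** * Independence of circle means from the radius *)

Section circle_mean.
Variable R : realType.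
Local Notation mu := (@lebesgue_measure R).
Local Notation pt := (@circle_pt R).

(** Retraction of the line onto [a, b]: composing with it extends a function of the radius from an
    annulus to all radii, as [rcont] demands. *)
Definition clamp (a b r : R) := Num.max a (Num.min b r).

Lemma clamp_id a b r : a <= r <= b -> clamp a b r = r.
Proof. by move=> /andP[h1 h2]; rewrite /clamp min_r // max_r. Qed.

Lemma clamp_in a b r : a <= b -> a <= clamp a b r <= b.
Proof. by move=> ab; rewrite /clamp le_max lexx ge_max ab ge_min lexx. Qed.

Lemma clamp_cont a b : continuous (clamp a b).
Proof.
move=> r; apply: continuous_max; first exact: cvg_cst.
by apply: continuous_min; [exact: cvg_cst|exact: cvg_id].
Qed.

(* RR and TT are radial and angular primitives of f dz, so the cell form is the
   integral of f dz over the boundary of a polar cell, and its additivity is an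
   algebraic identity. *)
Definition cell_form (RR TT : R -> R -> R[i]) (x1 x2 y1 y2 : R) : R[i] :=
  RR x2 y1 - RR x1 y1 - (RR x2 y2 - RR x1 y2)
  + (TT x2 y2 - TT x2 y1) - (TT x1 y2 - TT x1 y1).

Lemma cell_formDx RR TT x1 x2 x3 y1 y2 : cell_form RR TT x1 x3 y1 y2 =
  cell_form RR TT x1 x2 y1 y2 + cell_form RR TT x2 x3 y1 y2.
Proof. by rewrite /cell_form; ring. Qed.

Lemma cell_formDy RR TT x1 x2 y1 y2 y3 : cell_form RR TT x1 x2 y1 y3 =
  cell_form RR TT x1 x2 y1 y2 + cell_form RR TT x1 x2 y2 y3.
Proof. by rewrite /cell_form; ring. Qed.

(** Goursat's local estimate. The linear part of f at the point has a primitive, hence contributes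
    nothing around a closed cell; the remainder is o(s) on a boundary of length O(s), which gives
    o(s^2). *)
Lemma cell_form_small (f : R[i] -> R[i]) (RR TT : R -> R -> R[i]) (a b p q : R) :
  0 < a -> a <= b ->
  (forall t r, a <= r <= b -> cderiv (RR^~ t) r (f (r%:C * pt t) * pt t)) ->
  (forall r t, a <= r <= b -> 0 <= t -> cderiv (TT r) t
    (f (r%:C * pt t) * ((2 * pi)%:C * 'i * (r%:C * pt t)))) ->
  a <= p <= b -> 0 <= q <= 1 -> cdiff f (p%:C * pt q) ->
  forall e, 0 < e -> exists2 d, 0 < d & forall x y s, 0 < s < d ->
    a <= x -> x + s * (b - a) <= b -> x <= p <= x + s * (b - a) ->
    0 <= y -> y + s <= 1 -> y <= q <= y + s ->
    normc (cell_form RR TT x (x + s * (b - a)) y (y + s)) <= e * s ^+ 2.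
Proof.
move=> a0 ab RRd TTd pI qI /cdiff_slopeP[phi cphi fE] e e0.
have b0 : 0 < b by exact: lt_le_trans ab.
set z0 := p%:C * pt q in fE cphi *.
(* s K1 bounds the distance from [z0] within the cell: a radial part and b times the Lipschitz
   constant 4 pi of [circle_pt]. *)
pose K1 : R := (b - a) + b * (4 * pi).
have pi0 : 0 < pi :> R by exact: pi_gt0.
have K10 : 0 < K1 by rewrite /K1; have := mulr_gt0 b0 pi0; lra.
(* Sum over two radial and two angular sides, each with the factor 2 of [cderiv_le]. *)
pose K2 : R := 4 * K1 * (b - a) + 4 * K1 * (2 * pi * b).
have K20 : 0 < K2.
  have := mulr_gt0 K10 (mulr_gt0 b0 pi0); have ba0 : 0 <= b - a by lra.
  have := mulr_ge0 (ltW K10) ba0; rewrite /K2; lra.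
have eta0 : 0 < e / K2 by rewrite divr_gt0.
set eta := e / K2 in eta0.
have [d d0 hd] := cphi eta eta0.
exists (d / K1); first by rewrite divr_gt0.
move=> x y s /andP[s0 sd] ax xb xp cy yk yq.
have Dz r t : x <= r <= x + s * (b - a) -> y <= t <= y + s ->
    normc (r%:C * pt t - z0) <= s * K1.
  move=> rI tI; have -> : r%:C * pt t - z0 = (r - p)%:C * pt t + p%:C * (pt t - pt q).
    by rewrite rmorphB /= /z0; ring.
  rewrite (le_trans (le_normcD _ _)) // !normcM normc_circle_pt mulr1 !normc_real.
  rewrite /K1 mulrDr lerD //.
    rewrite ler_norml; apply/andP; split; lra.
  rewrite mulrCA ler_pM ?normc_ge0 //.
    rewrite ger0_norm; lra.
  rewrite (le_trans (circle_pt_lip _ _)) // [leRHS]mulrC ler_wpM2l //.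
    by rewrite mulr_ge0 // ltW.
  rewrite ler_norml; apply/andP; split; lra.
pose L z := f z0 + phi z0 * (z - z0).
have fL r t : x <= r <= x + s * (b - a) -> y <= t <= y + s ->
    normc (f (r%:C * pt t) - L (r%:C * pt t)) <= eta * (s * K1).
  move=> rI tI; rewrite fE /L -/z0.
  have -> (u v w : R[i]) : u + v - (u + w) = v - w by ring.
  rewrite -mulrBl normcM ler_pM ?normc_ge0 //; last exact: Dz.
  by apply/ltW/hd; rewrite (le_lt_trans (Dz _ _ rI tI)) // -ltr_pdivlMr.
(* A primitive of the linear part [L]. Subtracting it along each side leaves the cell form
   unchanged, since its values at the corners cancel. *)
pose PP z := f z0 * z + phi z0 * (2^-1 * (z * z) - z0 * z).
have s0' := ltW s0.
have sba : 0 <= s * (b - a) by rewrite mulr_ge0 // subr_ge0.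
have RL t : y <= t <= y + s -> normc ((RR (x + s * (b - a)) t - PP ((x + s * (b - a))%:C * pt t)) -
    (RR x t - PP (x%:C * pt t))) <= 2 * (eta * (s * K1)) * (s * (b - a)).
  move=> tI; have := @cderiv_le _ (fun r => RR r t - PP (r%:C * pt t))
    (fun r => (f (r%:C * pt t) - L (r%:C * pt t)) * pt t) x (x + s * (b - a))
    (eta * (s * K1)).
  rewrite [x + _ - x]addrAC subrr add0r; apply; first by rewrite lerDl.
    move=> r rI; rewrite mulrBl; apply: cderivB; first by apply: RRd; apply/andP; split; lra.
    have h1 : cderiv (fun r : R => r%:C * pt t) r (pt t).
      have := cderivZ (pt t) (cderiv_real r); rewrite mulr1.
      by under eq_fun do rewrite mulrC.
    have -> : L (r%:C * pt t) * pt t = f z0 * pt t + phi z0 *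
        (2^-1 * (pt t * (r%:C * pt t) + r%:C * pt t * pt t) - z0 * pt t).
      have -> : pt t * (r%:C * pt t) + r%:C * pt t * pt t = 2 * (r%:C * pt t * pt t) by ring.
      by rewrite mulKf ?pnatr_eq0 // /L; ring.
    exact: cderivD (cderivZ (f z0) h1)
      (cderivZ (phi z0) (cderivB (cderivZ (2^-1) (cderivM h1 h1)) (cderivZ z0 h1))).
  by move=> r rI; rewrite normcM normc_circle_pt mulr1; exact: fL.
have TL r : x <= r <= x + s * (b - a) -> normc ((TT r (y + s) - PP (r%:C * pt (y + s))) -
    (TT r y - PP (r%:C * pt y))) <= 2 * (eta * (s * K1) * (2 * pi * b)) * s.
  move=> rI; have := @cderiv_le _ (fun t => TT r t - PP (r%:C * pt t))
    (fun t => (f (r%:C * pt t) - L (r%:C * pt t)) * ((2 * pi)%:C * 'i * (r%:C * pt t)))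
    y (y + s) (eta * (s * K1) * (2 * pi * b)).
  have rI' : a <= r <= b by apply/andP; split; lra.
  rewrite [y + _ - y]addrAC subrr add0r; apply; first by rewrite lerDl.
    move=> t tI; rewrite mulrBl; apply: cderivB; first by apply: TTd => //; lra.
    have h1 : cderiv (fun t => r%:C * pt t) t ((2 * pi)%:C * 'i * (r%:C * pt t)).
      by have := cderivZ r%:C (cderiv_circle_pt t); rewrite [r%:C * (_ * _)]mulrCA.
    set c := (2 * pi)%:C * 'i in h1 *; set v := r%:C * pt t in h1 *.
    have -> : L v * (c * v) = f z0 * (c * v) + phi z0 *
        (2^-1 * (c * v * v + v * (c * v)) - z0 * (c * v)).
      have -> : c * v * v + v * (c * v) = 2 * (c * v * v) by ring.
      by rewrite mulKf ?pnatr_eq0 // /L; ring.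
    exact: cderivD (cderivZ (f z0) h1)
      (cderivZ (phi z0) (cderivB (cderivZ (2^-1) (cderivM h1 h1)) (cderivZ z0 h1))).
  move=> t tI; rewrite normcM ler_pM ?normc_ge0 //; first exact: fL.
  rewrite !normcM normc_circle_pt mulr1 !normc_real /= expr0n expr1n add0r sqrtr1 mulr1.
  have pi20 : 0 <= 2 * pi :> R by rewrite mulr_ge0 // ltW.
  rewrite (ger0_norm pi20) ler_wpM2l // ger0_norm; lra.
have yI : y <= y <= y + s by rewrite lexx lerDl.
have ysI : y <= y + s <= y + s by rewrite lexx lerDl s0'.
have xI : x <= x <= x + s * (b - a) by rewrite lexx lerDl.
have xsI : x <= x + s * (b - a) <= x + s * (b - a) by rewrite lexx lerDl sba.
have h1 := RL _ yI; have h2 := RL _ ysI; have h3 := TL _ xI; have h4 := TL _ xsI.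
set X := x + s * (b - a) in h1 h2 h3 h4 *; set Y := y + s in h1 h2 h3 h4 *.
set A1 := (X in normc X) in h1; set A2 := (X in normc X) in h2.
set A3 := (X in normc X) in h3; set A4 := (X in normc X) in h4.
have -> : cell_form RR TT x X y Y = A1 - A2 + (A4 - A3).
  by rewrite /cell_form /A1 /A2 /A3 /A4; ring.
have -> : e * s ^+ 2 = 2 * (eta * (s * K1)) * (s * (b - a)) + 2 * (eta * (s * K1)) * (s * (b - a)) + (2 * (eta * (s * K1) * (2 * pi * b)) * s + 2 * (eta * (s * K1) * (2 * pi * b)) * s).
  have -> : e = eta * K2 by rewrite /eta divfK // gt_eqF.
  by rewrite /K2; ring.
rewrite (le_trans (le_normcD _ _)) // lerD // (le_trans (le_normcD _ _)) // normcN.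
  exact: lerD.
exact: lerD.
Qed.

(** The polar cell of a full turn has coinciding radial sides, so the vanishing of its boundary
    integral compares the two circles. *)
Lemma circle_integral_annulus (f : R[i] -> R[i]) (r1 r2 a b : R) :
  0 <= r1 -> (forall z, r1 < normc z < r2 -> cdiff f z) ->
  r1 < a -> a <= b -> b < r2 ->
  Cint (fun t => f (b%:C * pt t) * (b%:C * pt t)) =
  Cint (fun t => f (a%:C * pt t) * (a%:C * pt t)).
Proof.
move=> r10 df r1a ab br2.
(* Room on both sides of [a, b] inside the annulus: the radial primitive starts at a' < a and is
   thus differentiable at a. The angular one starts at -1 for the same reason. *)
pose a' := (r1 + a) / 2; pose b' := (b + r2) / 2.
have a'1 : r1 < a' < a by rewrite /a'; apply/andP; split; lra.
have b'1 : b < b' < r2 by rewrite /b'; apply/andP; split; lra.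
have ab' : a' <= b' by have /andP[] := a'1; have /andP[] := b'1; lra.
have clE r : a' <= r <= b' -> clamp a' b' r = r by exact: clamp_id.
have clI r : r1 < clamp a' b' r < r2.
  have /andP[h1 h2] := a'1; have /andP[h3 h4] := b'1.
  have /andP[h5 h6] := clamp_in r ab'; apply/andP; split; lra.
have normE r t : 0 <= r -> normc (r%:C * pt t) = r.
  by move=> r0; rewrite normcM normc_circle_pt mulr1 normc_real ger0_norm.
have df' r t : r1 < r < r2 -> cdiff f (r%:C * pt t).
  move=> h; apply: df; rewrite normE //; case/andP: h => h _.
  by rewrite ltW // (le_lt_trans r10).
pose RR r t := cprim a' (fun x => f ((clamp a' b' x)%:C * pt t) * pt t) r.
pose TT r t := cprim (-1) (fun y => f (r%:C * pt y) * ((2 * pi)%:C * 'i * (r%:C * pt y))) t.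
have RRd t r : a <= r <= b -> cderiv (RR^~ t) r (f (r%:C * pt t) * pt t).
  move=> /andP[ar rb]; rewrite -[in X in cderiv _ _ X](clE r); last by apply/andP; split; lra.
  apply: cderiv_cprim; last lra.
  apply: rcontM; last exact: rcont_cst.
  apply: (@ccont_rcont _ f (fun x => (clamp a' b' x)%:C * pt t)).
    by apply: rcontM; [move=> x; apply: ccvg_real; exact: clamp_cont|exact: rcont_cst].
  by move=> x; apply: cdiff_cont; apply: df'.
have cT r : a <= r <= b -> rcont (fun y => f (r%:C * pt y) * ((2 * pi)%:C * 'i * (r%:C * pt y))).
  move=> /andP[ar rb]; have cz : rcont (fun y => r%:C * pt y).
    by apply: rcontM; [exact: rcont_cst|exact: rcont_circle_pt].
  apply: rcontM; last by apply: rcontM => //; exact: rcont_cst.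
  apply: (@ccont_rcont _ f (fun y => r%:C * pt y)) => // y.
  by apply: cdiff_cont; apply: df'; apply/andP; split; lra.
have TTd r t : a <= r <= b -> 0 <= t ->
    cderiv (TT r) t (f (r%:C * pt t) * ((2 * pi)%:C * 'i * (r%:C * pt t))).
  by move=> /cT h t0; apply: cderiv_cprim => //; lra.
have K0 : (2 * pi)%:C * 'i != 0 :> R[i].
  rewrite mulf_neq0 //; last by rewrite eq_complex /= oner_eq0 andbF.
  by rewrite -normc_eq0 normc_real normr_eq0 mulf_neq0 // gt_eqF // pi_gt0.
suff : cell_form RR TT a (a + (b - a)) 0 (0 + 1) = 0.
  rewrite /cell_form add0r subrKC.
  have RR1 r : RR r 1 = RR r 0 by rewrite /RR circle_pt0 circle_pt1.
  rewrite !RR1 subrr add0r /TT !cprimB ?ltrN10 //; try by apply: cT; rewrite lexx ab.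
  have E r : a <= r <= b -> Cint (fun t => f (r%:C * pt t) * ((2 * pi)%:C * 'i * (r%:C * pt t)))
      = ((2 * pi)%:C * 'i) * Cint (fun t => f (r%:C * pt t) * (r%:C * pt t)).
    move=> rI; rewrite -CintZ; first by congr Cint; apply/funext => t; ring.
    have /(rcontM (rcont_cst ((2 * pi)%:C * 'i)^-1)) := cT r rI.
    by congr rcont; apply/funext => t; rewrite mulrCA mulKf.
  rewrite !E ?lexx ?ab // => /eqP; rewrite -mulrBr mulf_eq0 (negbTE K0) /=.
  by rewrite subr_eq0 => /eqP.
apply: bisection_null; rewrite ?subr_ge0 ?ler01 //.
- exact: cell_formDx.
- exact: cell_formDy.
move=> p q; rewrite subrKC add0r => pI qI.
have a0 : 0 < a by exact: le_lt_trans r1a.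
have dp : cdiff f (p%:C * pt q).
  by apply: df'; case/andP: pI => *; apply/andP; split; lra.
move=> e e0; have [d d0 hd] := cell_form_small a0 ab RRd TTd pI qI dp e0.
exists d => // x y s sI ax xb xp cy; rewrite !mulr1; exact: hd.
Qed.

(** The contour integral of f(z)/z, which is analytic in the annulus since 0 lies outside it. *)
Lemma mean_annulus (f : R[i] -> R[i]) (r1 r2 a b : R) :
  0 <= r1 -> (forall z, r1 < normc z < r2 -> cdiff f z) ->
  r1 < a < r2 -> r1 < b < r2 ->
  Cint (fun t => f (a%:C * pt t)) = Cint (fun t => f (b%:C * pt t)).
Proof.
move=> r10 df; wlog ab : a b / a <= b.
  move=> h ai bi; case: (leP a b) => [ab|/ltW ba]; first exact: h.
  by symmetry; apply: h.
move=> /andP[r1a _] /andP[_ br2].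
have E r : 0 < r -> (fun t => f (r%:C * pt t)) =
    (fun t => (f (r%:C * pt t) / (r%:C * pt t)) * (r%:C * pt t)).
  move=> r0; apply/funext => t; rewrite divfK // mulf_neq0 ?circle_pt_neq0 //.
  by rewrite -normc_eq0 normc_real normr_eq0 gt_eqF.
rewrite !E; [|lra..].
symmetry.
have df' z : r1 < normc z < r2 -> cdiff (fun z => f z / z) z.
  move=> zI; apply: cdiffM; first exact: df.
  apply: cdiffV; last exact: cdiff_id.
  by rewrite -normc_gt0; case/andP: zI => h _; exact: le_lt_trans h.
exact: (@circle_integral_annulus (fun z => f z / z) r1 r2 a b r10 df' r1a ab br2).
Qed.

Lemma rcont_circle (f : R[i] -> R[i]) (a : R) : 0 <= a ->
  (forall z, normc z = a -> ccont f z) -> rcont (fun t => f (a%:C * pt t)).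
Proof.
move=> a0 cf; apply: (@ccont_rcont _ f (fun t => a%:C * pt t)).
  by apply: rcontM; [exact: rcont_cst|exact: rcont_circle_pt].
by move=> t; apply: cf; rewrite normcM normc_circle_pt mulr1 normc_real ger0_norm.
Qed.

Lemma bounded_polar (f : R[i] -> R[i]) (a b : R) : 0 <= a -> a <= b ->
  (forall z, a <= normc z <= b -> ccont f z) ->
  exists M : R, forall r t, a <= r <= b -> t \in `[0, 1] ->
    normc (f (r%:C * pt t)) <= M.
Proof.
move=> a0 ab cf; pose g (x : R * R) := normc (f ((clamp a b x.1)%:C * pt x.2)).
have cg : continuous g.
  move=> x; apply: cvg_normc.
  apply: (@ccont_ccvg _ _ (nbhs x) _ f (fun x => (clamp a b x.1)%:C * pt x.2)).
    apply: cf; rewrite normcM normc_circle_pt mulr1 normc_real ger0_norm ?clamp_in //.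
    by case/andP: (clamp_in x.1 ab) => h _; exact: le_trans h.
  apply: ccvgM; first by apply: ccvg_real; apply: (cvg_comp _ _ (@cvg_fst _ _ _ _ _)); exact: clamp_cont.
  move=> e e0; have h : y.2 @[y --> x] --> x.2 by exact: cvg_snd.
  exact: (h _ (rcont_circle_pt x.2 e0)).
have : compact (g @` (`[a, b]%classic `*` `[0, 1]%classic)).
  apply: continuous_compact; first exact: continuous_subspaceT.
  by apply: compact_setX; exact: segment_compact.
move=> /compact_bounded[M [_ hM]]; exists (M + 1) => r t rI tI.
have : `|g (r, t)| <= M + 1.
  apply: (hM (M + 1)); first by rewrite ltrDl.
  by exists (r, t) => //; split.
by apply: le_trans; rewrite /g /= clamp_id // ler_norm.
Qed.

(** Continuity of circle means in the radius, in the form needed to reach a radius p that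
    [mean_annulus] does not cover: 0, or that of a point where f is only known to be continuous. *)
Lemma circle_mean_limit (f : R[i] -> R[i]) (R0 p m : R) :
  (forall z, normc z < R0 -> ccont f z) -> 0 <= p < R0 -> 0 <= m < R0 ->
  (forall s : R, 0 < s <= 1 -> Cint (fun t => f ((p + s * (m - p))%:C * pt t)) =
    Cint (fun t => f (m%:C * pt t))) ->
  Cint (fun t => f (p%:C * pt t)) = Cint (fun t => f (m%:C * pt t)).
Proof.
move=> cf /andP[p0 pR] /andP[m0 mR] h.
pose r n : R := p + n.+1%:R^-1 * (m - p).
have s1 n : (0 : R) < n.+1%:R^-1 <= (1 : R) by rewrite invr_gt0 ltr0n invf_le1 ?ltr0n ?ler1n.
pose B := Num.max p m.
have BR : B < R0 by rewrite /B gt_max pR mR.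
have rI n : 0 <= r n <= B.
  have /andP[h1 h2] := s1 n; rewrite /r; set s := n.+1%:R^-1 in h1 h2 *.
  have -> : p + s * (m - p) = (1 - s) * p + s * m by ring.
  have s1' : 0 <= 1 - s by rewrite subr_ge0.
  rewrite addr_ge0 ?mulr_ge0 ?(ltW h1) //=.
  have -> : B = (1 - s) * B + s * B by ring.
  by rewrite lerD ?ler_wpM2l ?(ltW h1) // /B le_max lexx ?orbT.
have B0 : 0 <= B by rewrite /B le_max p0.
have [M hM] : exists M : R, forall r t, 0 <= r <= B -> t \in `[0, 1] ->
    normc (f (r%:C * pt t)) <= M.
  by apply: bounded_polar => // z /andP[_ zB]; apply: cf; exact: le_lt_trans BR.
have cfr a : 0 <= a <= B -> rcont (fun t => f (a%:C * pt t)).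
  move=> /andP[a0 aB]; apply: rcont_circle => // z za.
  by apply: cf; rewrite za; exact: le_lt_trans BR.
have pI : 0 <= p <= B by rewrite p0 /B le_max lexx.
have rp : r n @[n --> \oo] --> p.
  rewrite -[X in _ --> X]addr0 -(mul0r (m - p)); apply: cvgD; first exact: cvg_cst.
  by apply: cvgM; [exact: cvg_harmonic|exact: cvg_cst].
have : ccvg \oo (fun n => Cint (fun t => f ((r n)%:C * pt t))) (Cint (fun t => f (p%:C * pt t))).
  apply: (@Cint_cvg _ _ _ M).
  - by move=> n; exact: cfr.
  - exact: cfr.
  - by move=> n t tI; exact: hM.
  - move=> t tI; apply: (@ccont_ccvg _ _ _ _ f (fun n => (r n)%:C * pt t)).
      by apply: cf; rewrite normcM normc_circle_pt mulr1 normc_real ger0_norm.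
    by apply: ccvgM; [exact: ccvg_real|exact: ccvg_cst].
rewrite (_ : (fun n => _) = fun=> Cint (fun t => f (m%:C * pt t))); last first.
  by apply/funext => n; exact: h.
move=> hc; apply/eqP; rewrite eq_sym -subr_eq0 -normc_eq0; apply: contraT => n0.
have := hc (normc (Cint (fun t => f (m%:C * pt t)) - Cint (fun t => f (p%:C * pt t)))).
rewrite lt_def n0 normc_ge0 => /(_ isT)[N _ hN].
by have := hN N (leqnn N); rewrite ltxx.
Qed.

(** One exceptional point is allowed so that slope functions qualify. The mean is constant for radii
    below |a| and for radii above |a|, and continuity joins these ranges to each other and to the
    radius 0. *)
Lemma mean_value (f : R[i] -> R[i]) (a : R[i]) (R0 r : R) :
  normc a < R0 -> (forall z, normc z < R0 -> ccont f z) ->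
  (forall z, normc z < R0 -> z != a -> cdiff f z) -> 0 <= r < R0 ->
  Cint (fun t => f (r%:C * pt t)) = f 0.
Proof.
move=> aR cf df; set al := normc a in aR.
have al0 : 0 <= al := normc_ge0 a.
have neqa z : normc z != al -> z != a by apply: contra => /eqP ->.
pose A r := Cint (fun t => f (r%:C * pt t)).
have A0 : A 0 = f 0.
  rewrite /A (_ : (fun t => _) = fun=> f 0) ?Cint_cst //.
  by apply/funext => t; rewrite mul0r.
have A1 s : 0 < s < al -> A s = f 0.
  move=> /andP[s0 sal]; rewrite -A0; symmetry.
  apply: (@circle_mean_limit f R0) => //; [by apply/andP; split; lra..|].
  move=> u /andP[u0 u1]; rewrite add0r subr0.
  apply: (@mean_annulus f 0 al) => //.
  - by move=> z /andP[z0 z1]; apply: df; [exact: lt_trans aR|apply: neqa; rewrite lt_eqF].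
  - by rewrite mulr_gt0 //= (le_lt_trans _ sal) // ler_piMl // ltW.
  - by rewrite s0.
have A2 : A al = f 0.
  have [al00|al00] := eqVneq al 0; first by rewrite al00.
  have alp : 0 < al by rewrite lt_def al00.
  rewrite -(A1 (al / 2)); last by apply/andP; split; lra.
  apply: (@circle_mean_limit f R0) => //; [by apply/andP; split; lra..|].
  move=> u /andP[u0 u1]; rewrite -/(A _) -/(A _).
  have ua : u * al <= al by rewrite ler_piMl.
  have u0' : 0 < u * al by rewrite mulr_gt0.
  have -> : al + u * (al / 2 - al) = al - u * al / 2 by field.
  by rewrite !A1 //; apply/andP; split; lra.
move=> /andP[r0 rR]; have [ral|ral|->] := ltgtP r al; last exact: A2.
- have [->|r00] := eqVneq r 0; first exact: A0.
  by apply: A1; rewrite ral lt_def r00 r0.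
rewrite -A2; symmetry; apply: (@circle_mean_limit f R0) => //.
- by rewrite al0.
- by rewrite r0.
move=> u /andP[u0 u1]; apply: (@mean_annulus f al R0) => //.
- move=> z /andP[z0 z1]; apply: df => //; apply: neqa; by rewrite gt_eqF.
- have h1 : 0 < u * (r - al) by rewrite mulr_gt0 // subr_gt0.
  have h2 : u * (r - al) <= r - al by rewrite ler_piMl // subr_ge0 ltW.
  by apply/andP; split; lra.
- by rewrite ral.
Qed.

End circle_mean.

(** * Cauchy and Poisson formulas *)

Section cauchy_poisson.
Variable R : realType.
Local Notation mu := (@lebesgue_measure R).
Local Notation pt := (@circle_pt R).
Implicit Types (f : R[i] -> R[i]) (a z w : R[i]).

Lemma cdiff_near f g z (d : R) : 0 < d ->
  (forall w, normc (w - z) < d -> f w = g w) -> cdiff f z -> cdiff g z.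
Proof.
move=> d0 fg; apply: near_eq_derivable.
have : nbhs (z : R[i]^o) [set w | f w = g w] by rewrite nbhs_cnbhs; exists d.
by [].
Qed.

Lemma subr1_neq0 z : normc z < 1 -> 1 - z != 0.
Proof.
by apply: contraTneq => /eqP; rewrite subr_eq0 => /eqP <-; rewrite normc1 ltxx.
Qed.

Lemma subpt_neq0 a t : normc a < 1 -> pt t - a != 0.
Proof.
by apply: contraTneq => /eqP; rewrite subr_eq0 => /eqP <-; rewrite normc_circle_pt ltxx.
Qed.

Lemma mean_unit_circle f (R0 : R) : 1 < R0 ->
  (forall z, normc z < R0 -> cdiff f z) -> Cint (fun t => f (pt t)) = f 0.
Proof.
move=> R1 df; rewrite -(@mean_value _ f 0 R0 1).
- by congr Cint; apply/funext => t; rewrite mul1r.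
- by rewrite normc0 (lt_trans _ R1).
- by move=> z /df; exact: cdiff_cont.
- by move=> z /df.
- by rewrite ler01.
Qed.

(** The harmonic mean of 1 and 1/|a|, meaningful also for a = 0: a radius beyond 1 within which 1 -
    a z has no zero. *)
Definition cauchy_radius (a : R[i]) : R := 2 / (1 + normc a).

Lemma cauchy_radius_gt1 a : normc a < 1 -> 1 < cauchy_radius a.
Proof.
by move=> a1; have := normc_ge0 a => a0; rewrite /cauchy_radius ltr_pdivlMr; lra.
Qed.

Lemma cauchy_radius_lt a z : normc a < 1 -> normc z < cauchy_radius a ->
  normc (a * z) < 1.
Proof.
move=> a1; have a0 := normc_ge0 a; rewrite /cauchy_radius ltr_pdivlMr; last lra.
rewrite normcM => h; have := normc_ge0 z; set x := normc z in h *.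
move=> x0; have := mulr_ge0 a0 x0; have [xs|xs] := lerP x 1.
  have : normc a * x <= normc a by rewrite ler_piMr.
  lra.
lra.
Qed.

Lemma cdiff_geom w z : normc (w * z) < 1 -> cdiff (fun v => (1 - w * v)^-1) z.
Proof.
move=> h; apply: cdiffV; first exact: subr1_neq0.
apply: cdiffB; first exact: cdiff_cst.
by apply: cdiffM; [exact: cdiff_cst|exact: cdiff_id].
Qed.

Lemma rcont_of_cdiff f (R0 : R) : 1 < R0 ->
  (forall z, normc z < R0 -> cdiff f z) -> rcont (fun t => f (pt t)).
Proof.
move=> R1 df; apply: ccont_rcont; first exact: rcont_circle_pt.
by move=> t; apply: cdiff_cont; apply: df; rewrite normc_circle_pt.
Qed.

Lemma rcont_cauchy a : normc a < 1 -> rcont (fun t => pt t / (pt t - a)).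
Proof.
move=> a1; apply: rcontM; first exact: rcont_circle_pt.
apply: rcontV; first by move=> t; exact: subpt_neq0.
by apply: rcontB; [exact: rcont_circle_pt|exact: rcont_cst].
Qed.

Lemma cauchy_kernelE a t : normc a < 1 -> pt t / (pt t - a) = ((1 - a^* * pt t)^-1)^*.
Proof.
move=> a1; rewrite fmorphV rmorphB rmorphM rmorph1 /= conjcK.
have -> : 1 - a * (pt t)^* = (pt t - a) / pt t.
  by rewrite circle_ptV mulrBl circle_pt_conj.
by rewrite invf_div.
Qed.

(** On the circle the kernel is the conjugate of 1/(1 - conj(a) z), which is analytic past the
    circle and equals 1 at 0. *)
Lemma Cint_cauchy_kernel a : normc a < 1 -> Cint (fun t => pt t / (pt t - a)) = 1.
Proof.
move=> a1; have aJ : normc a^* < 1 by rewrite normc_conj.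
have dg z : normc z < cauchy_radius a^* -> cdiff (fun v => (1 - a^* * v)^-1) z.
  by move=> h; apply: cdiff_geom; exact: cauchy_radius_lt.
under eq_fun do rewrite cauchy_kernelE //.
rewrite (Cint_conj (rcont_of_cdiff (cauchy_radius_gt1 aJ) dg)).
by rewrite (mean_unit_circle (cauchy_radius_gt1 aJ) dg) mulr0 subr0 invr1 rmorph1.
Qed.

(** The mean value property of z phi(z), where phi is the slope function of f at a: this is
    continuous at a, analytic elsewhere and zero at 0. *)
Lemma cauchy_formula f (R0 : R) a : 1 < R0 ->
  (forall z, normc z < R0 -> cdiff f z) -> normc a < 1 ->
  Cint (fun t => f (pt t) * (pt t / (pt t - a))) = f a.
Proof.
move=> R1 df a1; have aR := lt_trans a1 R1.
have [phi cphi fE] := (cdiff_slopeP f a).1 (df a aR).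
have phiE w : w != a -> phi w = (f w - f a) / (w - a).
  by move=> wa; rewrite fE addrAC subrr add0r mulfK // subr_eq0.
have dphi z : normc z < R0 -> z != a -> cdiff phi z.
  move=> zR za; apply: (@cdiff_near (fun w => (f w - f a) / (w - a)) _ _ (normc (z - a))).
  - by rewrite normc_gt0 subr_eq0.
  - by move=> w wz; rewrite phiE //; apply: contraTneq wz => ->; rewrite normcB ltxx.
  - apply: cdiffM; first by apply: cdiffB; [exact: df|exact: cdiff_cst].
    apply: cdiffV; first by rewrite subr_eq0.
    by apply: cdiffB; [exact: cdiff_id|exact: cdiff_cst].
have := @mean_value _ (fun z => phi z * z) a R0 1 aR.
rewrite mulr0 ler01 R1 => /(_ _ _ isT).
rewrite (_ : (fun t => _) = fun t => f (pt t) * (pt t / (pt t - a)) - f a * (pt t / (pt t - a))); last first.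
  apply/funext => t; rewrite mul1r phiE; first by rewrite -mulrBl mulrAC -mulrA.
  by rewrite -subr_eq0 subpt_neq0.
have ck := rcont_cauchy a1; have cf := rcont_of_cdiff R1 df.
rewrite CintB; [|exact: rcontM|by apply: rcontM => //; exact: rcont_cst].
rewrite CintZ // Cint_cauchy_kernel // mulr1 => h; apply/eqP; rewrite -subr_eq0; apply/eqP; apply: h.
- move=> z zR; apply: ccvgM; last exact: ccvg_id.
  by have [->//|za] := eqVneq z a; apply: cdiff_cont; exact: dphi.
- by move=> z zR za; apply: cdiffM; [exact: dphi|exact: cdiff_id].
Qed.

(** The Poisson kernel: for z on the circle the denominator is |z - a|^2. *)
Definition pker (a z : R[i]) : R := (1 - normc a ^+ 2) / normc (1 - a^* * z) ^+ 2.

Lemma pker_ge0 a z : normc a < 1 -> 0 <= pker a z.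
Proof.
move=> a1; rewrite mulr_ge0 ?invr_ge0 ?sqr_ge0 // subr_ge0.
by rewrite expr_le1 ?normc_ge0 // ltW.
Qed.

(** Cauchy kernel plus a term analytic inside and zero at 0. The second term integrates to 0 against
    analytic functions, so Cauchy's formula yields Poisson's; the same split rearranges the Toeplitz
    kernel. *)
Lemma pkerE a t : normc a < 1 ->
  (pker a (pt t))%:C = pt t / (pt t - a) + a^* * pt t / (1 - a^* * pt t).
Proof.
move=> a1; rewrite /pker rmorphM rmorphB rmorph1 fmorphV /= !sqr_normc_conj.
have -> : (1 - a^* * pt t)^* = 1 - a * (pt t)^-1.
  by rewrite rmorphB rmorphM rmorph1 /= conjcK circle_ptV.
have h1 : 1 - a^* * pt t != 0.
  by apply: subr1_neq0; rewrite normcM normc_circle_pt mulr1 normc_conj.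
have h2 := subpt_neq0 t a1; have h3 := circle_pt_neq0 t.
by field; rewrite h1 h2 h3.
Qed.

Lemma rcont_pker a : normc a < 1 -> rcont (fun t => (pker a (pt t))%:C).
Proof.
move=> a1; under eq_fun do rewrite pkerE //.
apply: rcontD; first exact: rcont_cauchy.
have cz : rcont (fun t => a^* * pt t).
  by apply: rcontM; [exact: rcont_cst|exact: rcont_circle_pt].
apply: rcontM => //; apply: rcontV.
  by move=> t; apply: subr1_neq0; rewrite normcM normc_circle_pt mulr1 normc_conj.
by apply: rcontB => //; exact: rcont_cst.
Qed.

Lemma continuous_pker a : normc a < 1 -> continuous (fun t => pker a (pt t)).
Proof. by move=> /rcont_pker/rcont_Re. Qed.

Lemma Cint_analytic_vanish f (R0 : R) w : 1 < R0 ->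
  (forall z, normc z < R0 -> cdiff f z) -> normc w < 1 ->
  Cint (fun t => f (pt t) * (w * pt t / (1 - w * pt t))) = 0.
Proof.
move=> R1 df w1.
have R1' : 1 < Num.min R0 (cauchy_radius w) by rewrite lt_min R1 cauchy_radius_gt1.
rewrite (@mean_unit_circle (fun z => f z * (w * z / (1 - w * z))) _ R1').
  by rewrite mulr0 mul0r mulr0.
move=> z; rewrite lt_min => /andP[z1 z2]; apply: cdiffM; first exact: df.
apply: cdiffM; first by apply: cdiffM; [exact: cdiff_cst|exact: cdiff_id].
by apply: cdiff_geom; exact: cauchy_radius_lt.
Qed.

Lemma poisson_formula f (R0 : R) a : 1 < R0 ->
  (forall z, normc z < R0 -> cdiff f z) -> normc a < 1 ->
  Cint (fun t => f (pt t) * (pker a (pt t))%:C) = f a.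
Proof.
move=> R1 df a1; have aJ : normc a^* < 1 by rewrite normc_conj.
have cf := rcont_of_cdiff R1 df; have cc := rcont_cauchy a1.
have ck : rcont (fun t => a^* * pt t / (1 - a^* * pt t)).
  have := rcontB (rcont_pker a1) cc; congr rcont; apply/funext => t.
  by rewrite pkerE // addrAC subrr add0r.
under eq_fun do rewrite pkerE // mulrDr.
rewrite CintD; [|exact: rcontM..].
by rewrite (cauchy_formula R1) // (Cint_analytic_vanish R1) // addr0.
Qed.

Lemma Rintegral_pker a : normc a < 1 -> \int[mu]_(t in `[0, 1]) pker a (pt t) = 1.
Proof.
move=> a1; have := @poisson_formula (fun=> 1) 2 a _ (fun z _ => @cdiff_cst _ 1 z) a1.
under eq_fun do rewrite mul1r.
move=> h; have /(congr1 (@complex.Re _)) : Cint (fun t => (pker a (pt t))%:C) = 1.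
  by apply: h; lra.
by rewrite Re_Cint.
Qed.

Lemma integrable_pker a : normc a < 1 ->
  mu.-integrable `[0, 1] (EFin \o (fun t => pker a (pt t))).
Proof. by move=> a1; apply: continuous_itv_integrable; exact: continuous_pker. Qed.

End cauchy_poisson.

(** * The bound for dilated functions *)

Section dilated_toeplitz.
Variable R : realType.
Local Notation mu := (@lebesgue_measure R).
Local Notation pt := (@circle_pt R).
Implicit Types (a v z w zeta : R[i]).

Lemma real_complexB (x y : R) : (x - y)%:C = x%:C - y%:C.
Proof. exact: rmorphB. Qed.

Lemma real_complexM (x y : R) : (x * y)%:C = x%:C * y%:C.
Proof. exact: rmorphM. Qed.

Definition bfactor (a v : R[i]) : R[i] := (v - a) / (1 - a^* * v).

Lemma bfactor_den a v : normc a < 1 -> normc v <= 1 -> 1 - a^* * v != 0.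
Proof.
move=> a1 v1; apply: subr1_neq0; rewrite normcM normc_conj.
by rewrite (le_lt_trans _ a1) // ler_piMr // normc_ge0.
Qed.

Lemma bfactor_norm a v : normc a < 1 -> normc v <= 1 ->
  1 - normc (bfactor a v) ^+ 2 =
  (1 - normc a ^+ 2) * (1 - normc v ^+ 2) / normc (1 - a^* * v) ^+ 2.
Proof.
move=> a1 v1; have d0 := bfactor_den a1 v1.
have key : normc (1 - a^* * v) ^+ 2 - normc (v - a) ^+ 2 =
    (1 - normc a ^+ 2) * (1 - normc v ^+ 2).
  apply: (@complexI R); rewrite real_complexM !real_complexB !sqr_normc_conj.
  have -> : (1 - a^* * v)^* = 1 - a * v^*.
    by rewrite rmorphB rmorphM rmorph1 /= conjcK.
  by rewrite [(v - a)^*]rmorphB /=; ring.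
rewrite -key /bfactor normcM normcV exprMn exprVn mulrBl divff //.
by rewrite expf_neq0 // normc_eq0.
Qed.

Lemma bfactor_le1 a v : normc a < 1 -> normc v <= 1 -> normc (bfactor a v) <= 1.
Proof.
move=> a1 v1; rewrite -(@expr_le1 _ 2) ?normc_ge0 // -subr_ge0 bfactor_norm //.
rewrite mulr_ge0 ?invr_ge0 ?sqr_ge0 // mulr_ge0 // subr_ge0 expr_le1 ?normc_ge0 //.
exact: ltW.
Qed.

Lemma bfactor_unimod a v : normc a < 1 -> normc v = 1 ->
  bfactor a v * (bfactor a v)^* = 1.
Proof.
move=> a1 v1; rewrite -sqr_normc_conj.
have v1' : normc v <= 1 by rewrite v1.
have := bfactor_norm a1 v1'; rewrite v1 expr1n subrr mulr0 mul0r.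
by move=> /eqP; rewrite subr_eq0 => /eqP <-.
Qed.

Lemma cdiff_bfactor a v : 1 - a^* * v != 0 -> cdiff (bfactor a) v.
Proof.
move=> d0; apply: cdiffM; first by apply: cdiffB; [exact: cdiff_id|exact: cdiff_cst].
apply: cdiffV => //; apply: cdiffB; first exact: cdiff_cst.
by apply: cdiffM; [exact: cdiff_cst|exact: cdiff_id].
Qed.

Lemma normc_1Bprod n (be : 'I_n -> R[i]) : (forall k, normc (be k) <= 1) ->
  normc (1 - \prod_(k < n) be k) <= \sum_(k < n) normc (1 - be k).
Proof.
elim: n be => [|n ih] be h; first by rewrite !big_ord0 subrr normc0.
rewrite !big_ord_recr /=; set p := \prod_(_ < _) _.
have -> : 1 - p * be ord_max = (1 - p) + p * (1 - be ord_max) by ring.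
rewrite (le_trans (le_normcD _ _)) // lerD //.
  by apply: (ih (fun k => be (widen_ord (leqnSn n) k))) => k.
rewrite normcM ler_piMl ?normc_ge0 // /p normc_prod prodr_ile1 // => k _.
by rewrite normc_ge0 h.
Qed.

Lemma continuous_sum_ord n (u : 'I_n -> R -> R) : (forall k, continuous (u k)) ->
  continuous (fun t => \sum_(k < n) u k t).
Proof.
elim: n u => [|n ih] u cu t.
  by under eq_fun do rewrite big_ord0; exact: cvg_cst.
rewrite (_ : (fun s => _) = fun s =>
    \sum_(k < n) u (widen_ord (leqnSn n) k) s + u ord_max s); last first.
  by apply/funext => s; rewrite big_ord_recr.
apply: cvgD; last exact: cu.
by apply: (ih (fun k => u (widen_ord (leqnSn n) k))) => k; exact: cu.
Qed.

Lemma Rintegral_sum_ord n (u : 'I_n -> R -> R) : (forall k, continuous (u k)) ->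
  \int[mu]_(t in `[0, 1]) (\sum_(k < n) u k t) =
  \sum_(k < n) \int[mu]_(t in `[0, 1]) u k t.
Proof.
elim: n u => [|n ih] u cu.
  under eq_Rintegral do rewrite big_ord0; by rewrite Rintegral_cst01 big_ord0.
under eq_Rintegral do rewrite big_ord_recr.
rewrite big_ord_recr /= -ih // RintegralD //; apply: continuous_itv_integrable => //.
exact: continuous_sum_ord.
Qed.

(* 2XY <= X^2 + Y^2 splits the product of two Cauchy kernels into Poisson kernels at
   a and at conj (a w^2). *)
Lemma kernel_pointwise a w zeta : normc a < 1 -> normc w < 1 ->
  normc zeta = 1 ->
  normc (1 - bfactor a zeta * bfactor a^* (w ^+ 2 * zeta)) <=
  normc (1 - w * zeta) * (pker a zeta + pker (a * w ^+ 2)^* zeta).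
Proof.
move=> a1 w1 ze1; have w2 : normc (w ^+ 2) <= 1 by rewrite normcX expr_le1 ?normc_ge0 // ltW.
have u1 : normc (w ^+ 2 * zeta) <= 1 by rewrite normcM ze1 mulr1.
have aJ : normc a^* < 1 by rewrite normc_conj.
have ze1' : normc zeta <= 1 by rewrite ze1.
have d1 := bfactor_den a1 ze1'; have d2 := bfactor_den aJ u1.
(* The factor 1 - w zeta is the one that cancels the pole; 1 + w zeta carries the other zero of the
   difference and is bounded by 2. *)
have -> : 1 - bfactor a zeta * bfactor a^* (w ^+ 2 * zeta) =
    (1 - w * zeta) * ((1 + w * zeta) * (1 - (normc a ^+ 2)%:C) /
    ((1 - a^* * zeta) * (1 - a * (w ^+ 2 * zeta)))).
  rewrite conjcK in d2; rewrite /bfactor conjcK sqr_normc_conj.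
  by field; rewrite d1 d2.
rewrite normcM ler_wpM2l ?normc_ge0 // normcM normcV !normcM /pker !conjcK.
rewrite -mulrA in d2 *; rewrite conjcK in d2.
have a2 : 0 <= 1 - normc a ^+ 2 by rewrite subr_ge0 expr_le1 ?normc_ge0 // ltW.
have -> : normc (1 - (normc a ^+ 2)%:C) = 1 - normc a ^+ 2.
  have -> : 1 - (normc a ^+ 2)%:C = (1 - normc a ^+ 2)%:C by rewrite real_complexB.
  by rewrite normc_real ger0_norm.
have le2 : normc (1 + w * zeta) <= 2.
  rewrite (le_trans (le_normcD _ _)) // normc1 normcM ze1 mulr1; lra.
(* Replacing a by conj(a w^2), a point no farther from 0, only enlarges the numerator of the Poisson
   kernel. *)
have a'a : normc (a * w ^+ 2)^* ^+ 2 <= normc a ^+ 2.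
  by rewrite normc_conj ler_pXn2r ?nnegrE ?normc_ge0 // normcM ler_piMr ?normc_ge0.
rewrite -normc_gt0 in d1; rewrite -normc_gt0 in d2.
rewrite -[a * w ^+ 2 * zeta]mulrA.
set x := normc (1 - a^* * zeta) in d1 *.
set y := normc (1 - a * (w ^+ 2 * zeta)) in d2 *.
have xV : 0 < x^-1 by rewrite invr_gt0.
have yV : 0 < y^-1 by rewrite invr_gt0.
rewrite invfM -!exprVn; set X := x^-1 in xV *; set Y := y^-1 in yV *.
apply: (@le_trans _ _ ((1 - normc a ^+ 2) * (X ^+ 2 + Y ^+ 2))).
  have XY : 0 <= X * Y by rewrite mulr_ge0 // ltW.
  apply: (@le_trans _ _ (2 * ((1 - normc a ^+ 2) * (X * Y)))).
    by rewrite ler_wpM2r // mulr_ge0.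
  rewrite mulrCA ler_wpM2l //.
  by have := sqr_ge0 (X - Y); lra.
by rewrite mulrDr lerD2l ler_wpM2r ?sqr_ge0 // lerB.
Qed.

Lemma dilated_toeplitz_bound n (h : R[i] -> R[i]) (c : R[i]) (a : 'I_n -> R[i])
    (z : R[i]) (r : R) :
  (forall v, normc v < 1 -> cdiff h v) -> (forall v, normc v < 1 -> normc (h v) <= 1) ->
  normc c = 1 -> (forall k, normc (a k) < 1) -> normc z < 1 -> 0 < r < 1 ->
  normc (Cint (fun t => (c * \prod_(k < n) bfactor (a k) (pt t))^* *
    h (r%:C * pt t) * (pt t / (pt t - z)))) <= 1 + 2 * n%:R.
Proof.
move=> dh bh c1 a1 z1 /andP[r0 r1]; set w := z^*.
have w1 : normc w < 1 by rewrite normc_conj.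
have normr_pt (t : R) : normc (r%:C * pt t) < 1.
  by rewrite normcM normc_circle_pt mulr1 normc_real ger0_norm // ltW.
(* As |B| = 1 on the circle, there [f] equals conj(B) h(r zeta) times the product of all [be k], so
   the correction combines with the original integrand. *)
pose f v := h (r%:C * v) * (c^* * \prod_(k < n) bfactor (a k)^* (w ^+ 2 * v)).
(* The first bound keeps r v in the disc; the second keeps w v, hence w^2 v, in it. *)
pose R0 := Num.min r^-1 (cauchy_radius w).
have R01 : 1 < R0 by rewrite lt_min cauchy_radius_gt1 // invf_gt1 // r1.
have df v : normc v < R0 -> cdiff f v.
  rewrite lt_min => /andP[vr vw].
  have mulc_diff (k : R[i]) (u : R[i]) : cdiff (fun x => k * x) u.
    by apply: cdiffM; [exact: cdiff_cst|exact: cdiff_id].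
  apply: cdiffM.
    apply: (@cdiff_comp _ (fun v => r%:C * v) h) => //; apply: dh.
    by rewrite normcM normc_real ger0_norm ?ltW // -ltr_pdivlMl // mulr1.
  apply: cdiffM; first exact: cdiff_cst.
  apply: cdiff_prod => k; apply: (@cdiff_comp _ (fun v => w ^+ 2 * v)) => //.
  apply: cdiff_bfactor; apply: bfactor_den; first by rewrite normc_conj.
  rewrite expr2 -mulrA normcM mulr_ile1 ?normc_ge0 ?(ltW w1) // ltW //.
  exact: cauchy_radius_lt.
have cfac k : rcont (fun t => bfactor (a k) (pt t)).
  apply: ccont_rcont; first exact: rcont_circle_pt.
  move=> t; apply: cdiff_cont; apply: cdiff_bfactor; apply: bfactor_den => //.
  by rewrite normc_circle_pt.
have ch : rcont (fun t => h (r%:C * pt t)).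
  apply: (@ccont_rcont _ h (fun t => r%:C * pt t)).
    by apply: rcontM; [exact: rcont_cst|exact: rcont_circle_pt].
  by move=> t; apply: cdiff_cont; exact: dh.
have cI : rcont (fun t => (c * \prod_(k < n) bfactor (a k) (pt t))^* *
    h (r%:C * pt t) * (pt t / (pt t - z))).
  apply: rcontM; last exact: rcont_cauchy.
  apply: rcontM => //; apply: rcont_conj; apply: rcontM; first exact: rcont_cst.
  exact: rcont_prod.
have wp t : normc (w * pt t) < 1 by rewrite normcM normc_circle_pt mulr1.
have cw : rcont (fun t => w * pt t / (1 - w * pt t)).
  have cz : rcont (fun t => w * pt t).
    by apply: rcontM; [exact: rcont_cst|exact: rcont_circle_pt].
  apply: rcontM => //; apply: rcontV; first by move=> t; exact: subr1_neq0.
  by apply: rcontB => //; exact: rcont_cst.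
have cJ : rcont (fun t => f (pt t) * (w * pt t / (1 - w * pt t))).
  by apply: rcontM => //; exact: (rcont_of_cdiff R01).
rewrite -[X in normc X]addr0 -(Cint_analytic_vanish R01 df w1) -CintD //.
pose u t := pker z (pt t) + \sum_(k < n)
  (pker (a k) (pt t) + pker (a k * w ^+ 2)^* (pt t)).
have a'1 k : normc (a k * w ^+ 2)^* < 1.
  rewrite normc_conj normcM (le_lt_trans _ (a1 k)) // ler_piMr ?normc_ge0 //.
  by rewrite normcX expr_le1 ?normc_ge0 // ltW.
have cps k : continuous (fun t => pker (a k) (pt t) + pker (a k * w ^+ 2)^* (pt t)).
  by move=> t; apply: cvgD; exact: continuous_pker.
have cu : continuous u.
  by move=> t; apply: cvgD; [exact: continuous_pker|exact: continuous_sum_ord].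
have <- : \int[mu]_(t in `[0, 1]) u t = 1 + 2 * n%:R.
  rewrite RintegralD //=; [|exact: integrable_pker|].
    rewrite Rintegral_pker // Rintegral_sum_ord // (eq_bigr (fun=> 2)).
      by rewrite sumr_const card_ord mulr_natr.
    by move=> k _; rewrite RintegralD ?Rintegral_pker //; exact: integrable_pker.
  by apply: continuous_itv_integrable; exact: continuous_sum_ord.
apply: normc_Cint_le; [exact: rcontD|exact: continuous_itv_integrable|].
move=> t tI; set zeta := pt t.
have ze1 : normc zeta = 1 by exact: normc_circle_pt.
pose Bz := c * \prod_(k < n) bfactor (a k) zeta.
pose be k := bfactor (a k) zeta * bfactor (a k)^* (w ^+ 2 * zeta).
have BB : Bz^* * Bz = 1.
  rewrite mulrC -sqr_normc_conj /Bz normcM c1 mul1r normc_prod.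
  rewrite big1 ?expr1n // => k _; apply/eqP; rewrite -(@eqrXn2 _ 2) ?normc_ge0 //.
  by rewrite expr1n -(inj_eq (@complexI R)) sqr_normc_conj bfactor_unimod.
have bt1 k : normc (bfactor (a k)^* (w ^+ 2 * zeta)) <= 1.
  apply: bfactor_le1; first by rewrite normc_conj.
  by rewrite normcM ze1 mulr1 normcX expr_le1 ?normc_ge0 // ltW.
have be1 k : normc (be k) <= 1.
  by rewrite /be normcM mulr_ile1 ?normc_ge0 // bfactor_le1 // ze1.
have d0 : 1 - w * zeta != 0 by exact: (subr1_neq0 (wp t)).
have dz := subpt_neq0 t z1.
have -> : (c * \prod_(k < n) bfactor (a k) zeta)^* * h (r%:C * zeta) * (zeta / (zeta - z))
    + f zeta * (w * zeta / (1 - w * zeta)) =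
    Bz^* * h (r%:C * zeta) * ((pker z zeta)%:C - w * zeta / (1 - w * zeta) * (1 - \prod_(k < n) be k)).
  have -> : f zeta = (Bz^* * h (r%:C * zeta)) * \prod_(k < n) be k.
    have -> : \prod_(k < n) be k = (\prod_(k < n) bfactor (a k) zeta) *
        \prod_(k < n) bfactor (a k)^* (w ^+ 2 * zeta) by rewrite -big_split.
    rewrite /f; set Q := \prod_(k < n) bfactor (a k)^* _.
    have cc : c * c^* = 1 by rewrite -sqr_normc_conj c1 expr1n.
    transitivity (h (r%:C * zeta) * (Bz^* * Bz * c^* * Q)); first by rewrite BB mul1r.
    rewrite {2}/Bz; set P := \prod_(k < n) bfactor (a k) zeta.
    transitivity (Bz^* * h (r%:C * zeta) * (P * Q) * (c * c^*)); first by ring.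
    by rewrite cc mulr1.
  rewrite pkerE // -/zeta -/Bz -/w; ring.
rewrite normcM [normc (_ * h _)]normcM.
have -> : normc Bz^* = 1.
  rewrite normc_conj; apply/eqP; rewrite -(@eqrXn2 _ 2) ?normc_ge0 // expr1n.
  by rewrite -(inj_eq (@complexI R)) sqr_normc_conj mulrC BB.
rewrite mul1r (@le_trans _ _ (1 * normc ((pker z zeta)%:C - w * zeta / (1 - w * zeta) * (1 - \prod_(k < n) be k)))) //.
  by apply: ler_wpM2r; [exact: normc_ge0|apply: bh; exact: normr_pt].
rewrite mul1r (le_trans (le_normcD _ _)) // /u lerD //.
  by rewrite normc_real ger0_norm // pker_ge0.
rewrite normcN !normcM normcV ze1 mulr1.
apply: (@le_trans _ _ ((normc (1 - w * zeta))^-1 * normc (1 - \prod_(k < n) be k))).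
  rewrite -mulrA ler_piMl ?(ltW w1) // mulr_ge0 ?invr_ge0 ?normc_ge0 //.
rewrite ler_pdivrMl ?normc_gt0 // mulr_sumr.
rewrite (le_trans (normc_1Bprod be1)) // ler_sum // => k _.
exact: kernel_pointwise.
Qed.

End dilated_toeplitz.

(** * Fatou's theorem *)

Section real_sequences.
Variable R : realType.

(* A strict decrease would propagate, with at least the same slope, to -oo. *)
Lemma midconvex_bounded_mono (N : R -> R) :
  (forall x, x < 0 -> 0 <= N x <= 1) ->
  (forall x y, x < 0 -> y < 0 -> 2 * N ((x + y) / 2) <= N x + N y) ->
  forall x y, x <= y -> y < 0 -> N x <= N y.
Proof.
move=> N01 convex x y xy y0; have [//|lt_yx] := lerP (N x) (N y).
have nxy : x != y by apply: contraTneq lt_yx => ->; rewrite ltxx.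
have {nxy xy}xy : x < y by rewrite lt_def eq_sym nxy.
pose z k := y - k%:R * (y - x); pose d := N x - N y.
have d0 : 0 < d by rewrite subr_gt0.
have z0 k : z k < 0.
  by rewrite /z (le_lt_trans _ y0) // gerBl mulr_ge0 // subr_ge0 ltW.
have step k : d <= N (z k.+1) - N (z k).
  elim: k => [|k ih]; first by rewrite /z mul1r mul0r subr0 subKr.
  have := convex _ _ (z0 k) (z0 k.+2).
  have -> : (z k + z k.+2) / 2 = z k.+1.
    by rewrite /z -[k.+2%:R]natr1 -[k.+1%:R]natr1; field.
  move: ih; move: (N (z k)) (N (z k.+1)) (N (z k.+2)) => a b c; lra.
have grow k : N y + k%:R * d <= N (z k).
  elim: k => [|k ih]; first by rewrite /z !mul0r subr0 addr0.
  have := step k; move: ih; rewrite -natr1 mulrDl mul1r.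
  move: (N (z k)) (N (z k.+1)) (k%:R * d) => a b c; lra.
have [k hk] : exists k : nat, d^-1 < k%:R.
  exists (Num.bound d^-1); apply: archi_boundP; rewrite invr_ge0; exact: ltW.
have kd : 1 < k%:R * d by rewrite -ltr_pdivrMr // div1r.
have := grow k; have /andP[_] := N01 _ (z0 k); have /andP[+ _] := N01 _ y0.
move: kd; move: (N (z k)) (N y) (k%:R * d) => a b c; lra.
Qed.

(** N increases to its supremum L at 0. If N is within 4^-k of L at both points, or only at the
    smaller one and its midpoint with a later point, monotonicity bounds the second difference by 2L
    - 2(L - 4^-k). The rate 4^-k is the square of the rate wanted for L^1 distances. *)
Lemma midconvex_bounded_cauchy (N : R -> R) :
  (forall x, x < 0 -> 0 <= N x <= 1) ->
  (forall x y, x < 0 -> y < 0 -> 2 * N ((x + y) / 2) <= N x + N y) ->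
  exists s : nat -> R, [/\ forall k, s k < 0, s k @[k --> \oo] --> (0 : R) &
    forall k, N (s k.+1) + N (s k) - 2 * N ((s k.+1 + s k) / 2) <= 2 * 4^-1 ^+ k].
Proof.
move=> N01 convex; have mono := midconvex_bounded_mono N01 convex.
pose S := [set N x | x in [set x | x < 0]].
have S0 : S !=set0 by exists (N (-1)); exists (-1) => //=; rewrite oppr_lt0 ltr01.
have ubS : has_ubound S by exists 1 => _ [x /= x0 <-]; case/andP: (N01 x x0).
pose L := sup S.
have leL x : x < 0 -> N x <= L by move=> x0; apply: ub_le_sup => //; exists x.
have ex k : exists x, x < 0 /\ L - (4^-1) ^+ k < N x.
  have e0 : 0 < (4^-1 : R) ^+ k by rewrite exprn_gt0.
  by have [_ [x x0 <-] hx] := sup_adherent e0 (conj S0 ubS); exists x.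
have [x hx] := choice ex.
(* The maximum forces convergence to 0 and, by monotonicity, keeps N close to L. *)
pose s k := Num.max (x k) (- k.+1%:R^-1).
have s0 k : s k < 0.
  by rewrite /s gt_max oppr_lt0 invr_gt0 ltr0n andbT; case: (hx k).
have sL k : L - (4^-1) ^+ k < N (s k).
  apply: (lt_le_trans (hx k).2); apply: mono => //.
  by rewrite /s le_max lexx.
exists s; split => //.
  apply/cvgrPdist_lt => e e0.
  have /cvgrPdist_lt/(_ _ e0) := @cvg_harmonic R.
  apply: filterS => k; rewrite !sub0r !normrN.
  rewrite (ltr0_norm (s0 k)) /harmonic gtr0_norm ?invr_gt0 //; apply: le_lt_trans.
  by rewrite lerNl /s le_max lexx orbT.
move=> k.
have e4 : (4^-1 : R) ^+ k.+1 <= 4^-1 ^+ k.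
  by rewrite exprS ler_piMl ?exprn_ge0 // invf_le1 ?ler1n.
have sa := s0 k; have sb := s0 k.+1.
have mid : L - (4^-1) ^+ k <= N ((s k.+1 + s k) / 2).
  have [ss|ss] := lerP (s k) (s k.+1).
    by apply/ltW/(lt_le_trans (sL k))/mono; lra.
  apply: (@le_trans _ _ (L - 4^-1 ^+ k.+1)); first by rewrite lerD2l lerN2.
  by apply/ltW/(lt_le_trans (sL k.+1))/mono; lra.
have := leL _ sa; have := leL _ sb; move: mid.
move: (N (s k)) (N (s k.+1)) (N (_ / 2)) (4^-1 ^+ k) => a b c e; lra.
Qed.

End real_sequences.

(** * Mean squares of dilations *)

Section hardy_mean.
Variable R : realType.
Local Notation mu := (@lebesgue_measure R).
Local Notation pt := (@circle_pt R).
Variable h : R[i] -> R[i].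
Hypothesis dh : forall v, normc v < 1 -> cdiff h v.
Hypothesis bh : forall v, normc v < 1 -> normc (h v) <= 1.

Let normr_pt (r t : R) : 0 < r < 1 -> normc (r%:C * pt t) < 1.
Proof.
by move=> /andP[r0 r1]; rewrite normcM normc_circle_pt mulr1 normc_real ger0_norm // ltW.
Qed.

Lemma conjcM (x y : R[i]) : (x * y)^* = x^* * y^*.
Proof. exact: rmorphM. Qed.

Lemma rcont_dilation r : 0 < r < 1 -> rcont (fun t => h (r%:C * pt t)).
Proof.
move=> rI; apply: (@ccont_rcont _ h (fun t => r%:C * pt t)).
  by apply: rcontM; [exact: rcont_cst|exact: rcont_circle_pt].
by move=> t; apply: cdiff_cont; apply: dh; exact: normr_pt.
Qed.

(* With q = rs the integrand is the value at r zeta of h(v) conj(h(q / conj v)), which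
   is analytic in the annulus q < |v| < 1. *)
Lemma correlation_product (r s r' s' : R) : 0 < r < 1 -> 0 < s < 1 ->
  0 < r' < 1 -> 0 < s' < 1 -> r * s = r' * s' ->
  Cint (fun t => h (r%:C * pt t) * (h (s%:C * pt t))^*) =
  Cint (fun t => h (r'%:C * pt t) * (h (s'%:C * pt t))^*).
Proof.
move=> /andP[r0 r1] /andP[s0 s1] /andP[r'0 r'1] /andP[s'0 s'1] rs.
pose q := r * s; pose psi z := h z * (h ((q%:C / z)^*))^*.
have q0 : 0 < q by rewrite mulr_gt0.
have E (x y t : R) : 0 < x -> x * y = q -> h (x%:C * pt t) * (h (y%:C * pt t))^* = psi (x%:C * pt t).
  move=> x0 xyq; rewrite /psi; congr (_ * (h _)^*).
  have xC0 : x%:C != 0 by rewrite -normc_gt0 normc_real normr_gt0 gt_eqF.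
  rewrite -xyq real_complexM invfM [x%:C * _]mulrC -mulrA mulVKf // circle_ptV.
  by rewrite conjcM conjcK conjc_real.
under eq_fun do rewrite (E r s) //.
under [in RHS]eq_fun do rewrite (E r' s') //.
apply: (@mean_annulus _ psi q 1); first exact: ltW.
- move=> z /andP[qz z1]; have z0 : z != 0 by rewrite -normc_gt0 (lt_trans q0).
  apply: cdiffM; first exact: dh.
  apply: (@cdiff_comp _ (fun z => q%:C / z) (fun w => (h w^*)^*)).
    by apply: cdiffM; [exact: cdiff_cst|apply: cdiffV => //; exact: cdiff_id].
  apply: cdiff_conj; apply: dh; rewrite normc_conj normcM normcV normc_real.
  by rewrite gtr0_norm // ltr_pdivrMr ?mul1r // (lt_trans q0).
- by rewrite r1 andbT /q gtr_pMr.
- by rewrite r'1 andbT /q rs gtr_pMr.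
Qed.

Definition mean_square r := \int[mu]_(t in `[0, 1]) normc (h (r%:C * pt t)) ^+ 2.

Lemma sqr_normcB (x y : R[i]) :
  normc (x - y) ^+ 2 = normc x ^+ 2 + normc y ^+ 2 - 2 * Re (x * y^*).
Proof.
case: x y => [a b] [c d] /=; rewrite !sqr_sqrtr ?addr_ge0 ?sqr_ge0 //.
by rewrite mulrN opprK; ring.
Qed.

Lemma continuous_normc_sqr (f : R -> R[i]) : rcont f ->
  continuous (fun t => normc (f t) ^+ 2).
Proof.
move=> cf; rewrite (_ : (fun t => _) = fun t => normc (f t) * normc (f t)).
  by move=> t; apply: cvgM; exact: rcont_normc.
by apply/funext => t; rewrite expr2.
Qed.

(** Expanding the square leaves the correlation of the two dilations. It depends on rs only, so both
    radii may be replaced by the geometric mean. *)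
Lemma mean_square_dist (r s : R) : 0 < r < 1 -> 0 < s < 1 ->
  \int[mu]_(t in `[0, 1]) normc (h (r%:C * pt t) - h (s%:C * pt t)) ^+ 2 =
  mean_square r + mean_square s - 2 * mean_square (Num.sqrt (r * s)).
Proof.
move=> rI sI; set q := Num.sqrt (r * s).
have /andP[r0 r1] := rI; have /andP[s0 s1] := sI.
have rs0 : 0 < r * s by rewrite mulr_gt0.
have qI : 0 < q < 1.
  rewrite sqrtr_gt0 rs0 /= -sqrtr1 ltr_sqrt ?ltr01 //.
  by rewrite (lt_trans _ r1) // gtr_pMr.
have qq : r * s = q * q by rewrite -expr2 sqr_sqrtr // ltW.
have cr := rcont_dilation rI; have cs := rcont_dilation sI; have cq := rcont_dilation qI.
have /(congr1 (@complex.Re _)) := correlation_product rI sI qI qI qq.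
rewrite !Re_Cint => E.
have E2 : \int[mu]_(t in `[0, 1]) Re (h (q%:C * pt t) * (h (q%:C * pt t))^*) = mean_square q.
  by apply: eq_Rintegral => t _; rewrite -sqr_normc_conj.
under eq_Rintegral do rewrite sqr_normcB.
have ci : continuous (fun t => Re (h (r%:C * pt t) * (h (s%:C * pt t))^*)).
  by apply: rcont_Re; apply: rcontM => //; exact: rcont_conj.
have cn1 := continuous_normc_sqr cr; have cn2 := continuous_normc_sqr cs.
rewrite RintegralB //=; [|apply: continuous_itv_integrable => t; apply: cvgD; [exact: cn1|exact: cn2]|
  by apply: continuous_itv_integrable => t; apply: cvgM; [exact: cvg_cst|exact: ci]].
rewrite RintegralD //; [|exact: continuous_itv_integrable..].
rewrite RintegralZl //; last exact: continuous_itv_integrable.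
by rewrite E E2.
Qed.

Lemma mean_square_le1 r : 0 < r < 1 -> mean_square r <= 1.
Proof.
move=> rI; rewrite -[leRHS](Rintegral_cst01 1) /mean_square; apply: le_Rintegral => //.
- by apply: continuous_itv_integrable; apply: continuous_normc_sqr; exact: rcont_dilation.
- by apply: continuous_itv_integrable => t; exact: cvg_cst.
- by move=> t _; rewrite expr_le1 ?normc_ge0 // bh // normr_pt.
Qed.

(** The logarithmic variable turns geometric means into midpoints, so that [mean_square_dist]
    becomes a second difference; its sign is midpoint convexity. *)
Let nexp (x : R) := mean_square (expR x).

Let expI (x : R) : x < 0 -> 0 < expR x < 1.
Proof. by move=> x0; rewrite expR_gt0 expR_lt1. Qed.

Let nexp_dist (x y : R) : x < 0 -> y < 0 ->
  \int[mu]_(t in `[0, 1]) normc (h ((expR x)%:C * pt t) - h ((expR y)%:C * pt t)) ^+ 2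
  = nexp x + nexp y - 2 * nexp ((x + y) / 2).
Proof.
move=> x0 y0; rewrite mean_square_dist ?expI //; congr (_ - 2 * mean_square _).
rewrite -expRD; have {1}-> : x + y = (x + y) / 2 + (x + y) / 2 by field.
by rewrite expRD -expr2 sqrtr_sqr gtr0_norm ?expR_gt0.
Qed.

Lemma fast_radii : exists r : nat -> R, [/\ forall k, 0 < r k < 1,
  r k @[k --> \oo] --> (1 : R) &
  forall k, \int[mu]_(t in `[0, 1]) normc (h ((r k.+1)%:C * pt t) - h ((r k)%:C * pt t)) <=
    2 * 2^-1 ^+ k].
Proof.
have [||s [s0 s_to0 hs]] := @midconvex_bounded_cauchy _ nexp.
- move=> x x0; rewrite mean_square_le1 ?expI // andbT.
  by apply: Rintegral_ge0 => t _; exact: sqr_ge0.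
- move=> x y x0 y0; rewrite -subr_ge0 -nexp_dist //.
  by apply: Rintegral_ge0 => t _; exact: sqr_ge0.
exists (fun k => expR (s k)); split.
- by move=> k; exact: expI.
- by rewrite -[X in _ --> X]expR0; apply: (cvg_comp _ _ s_to0); exact: continuous_expR.
move=> k; have e4 := hs k.
have cs j := rcont_dilation (expI (s0 j)).
have cd := rcontB (cs k.+1) (cs k).
have c2 := continuous_normc_sqr cd.
set u := fun t => normc _ in c2 *.
have cu : continuous u by exact: rcont_normc.
have D : \int[mu]_(t in `[0, 1]) u t ^+ 2 <= 2 * 4^-1 ^+ k.
  by rewrite nexp_dist.
pose e : R := 2^-1 ^+ k.
have e0 : 0 < e by rewrite exprn_gt0.
have ee : 4^-1 ^+ k = e * e.
  by rewrite -exprMn; congr (_ ^+ _); field.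
(* From (u - 2e)^2 >= 0: this pointwise bound with e = 2^-k takes the place of the Cauchy-Schwarz
   inequality. *)
apply: (@le_trans _ _ (\int[mu]_(t in `[0, 1]) (e + e^-1 / 4 * u t ^+ 2))).
  apply: le_Rintegral => //; first exact: continuous_itv_integrable.
    apply: continuous_itv_integrable => t; apply: cvgD; first exact: cvg_cst.
    by apply: cvgM; [exact: cvg_cst|exact: c2].
  move=> t _; have := sqr_ge0 (u t - 2 * e) => h1.
  rewrite -subr_ge0.
  have -> : e + e^-1 / 4 * u t ^+ 2 - u t = e^-1 / 4 * (u t - 2 * e) ^+ 2.
    by field; rewrite gt_eqF.
  by rewrite mulr_ge0 // divr_ge0 // invr_ge0 ltW.
rewrite RintegralD //=; [|by apply: continuous_itv_integrable => t; exact: cvg_cst|]; last first.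
  by apply: continuous_itv_integrable => t; apply: cvgM; [exact: cvg_cst|exact: c2].
rewrite Rintegral_cst01 RintegralZl //; last exact: continuous_itv_integrable.
rewrite -/e mulr_natl mulr2n lerD2l.
apply: (@le_trans _ _ (e^-1 / 4 * (4 * (e * e)))).
  apply: ler_wpM2l; first by rewrite divr_ge0 // invr_ge0 ltW.
  rewrite -ee; apply: le_trans D _.
  by rewrite ler_wpM2r ?exprn_ge0 ?invr_ge0 // ler_nat.
have -> // : e^-1 / 4 * (4 * (e * e)) = e by field; rewrite gt_eqF.
Qed.

End hardy_mean.

(** * Boundary functions and their Poisson integrals *)

Section boundary_functions.
Variable R : realType.
Local Notation mu := (@lebesgue_measure R).
Local Notation I01 := (`[0, 1]%classic : set R).
Local Notation pt := (@circle_pt R).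

Lemma cvgn_of_summable_steps (v u : nat -> R) (M : R) :
  (forall k, `|v k.+1 - v k| <= u k) ->
  (forall n, \sum_(0 <= k < n) u k <= M) -> cvgn v.
Proof.
move=> vu uM; rewrite [X in cvgn X](_ : v = fun n => v 0%N + series (telescope v) n); last first.
  by apply/funext => n; exact: eq_sum_telescope.
apply: is_cvgD; first exact: is_cvg_cst.
apply: normed_cvg; apply: (@series_le_cvg _ _ u) => //.
- by move=> n; exact: normr_ge0.
- by move=> n; exact: le_trans (vu n).
- apply: nondecreasing_is_cvgn; last by exists M => _ [n _ <-]; exact: uM.
  by apply: nondecreasing_series => n _ _; exact: le_trans (vu n).
Qed.

(** The sum of the moduli of all steps has finite integral by monotone convergence, hence is finite
    almost everywhere, where the sequence converges absolutely. *)
Lemma ae_cvg_of_summable_steps (f : nat -> R -> R[i]) (M : R) :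
  (forall k, rcont (f k)) ->
  (forall n, \sum_(0 <= k < n) \int[mu]_(t in `[0, 1]) normc (f k.+1 t - f k t) <= M) ->
  {ae mu, forall t, t \in `[0, 1] ->
    cvgn (fun k => Re (f k t)) /\ cvgn (fun k => Im (f k t))}.
Proof.
move=> cf hM; pose u k t := normc (f k.+1 t - f k t).
have cu k : continuous (u k) by apply: rcont_normc; exact: rcontB.
have u0 k t : 0 <= u k t by exact: normc_ge0.
have iu k : mu.-integrable I01 (EFin \o u k) by exact: continuous_itv_integrable.
have mu_ k : measurable_fun I01 (EFin \o u k) by case/integrableP: (iu k).
pose F t := (\sum_(k <oo) (u k t)%:E)%E.
have mF : measurable_fun I01 F.
  by apply: (@ge0_emeasurable_sum _ _ _ _ (fun k => EFin \o u k) xpredT) => // k t _ _; rewrite lee_fin.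
have iF : mu.-integrable I01 F.
  apply/integrableP; split => //.
  have F0 t : (0 <= F t)%E by apply: nneseries_ge0 => k _ _; rewrite lee_fin.
  under eq_integral do rewrite gee0_abs //.
  rewrite integral_nneseries //; last by move=> k t _; rewrite lee_fin.
  apply: (@le_lt_trans _ _ M%:E); last exact: ltry.
  apply: lime_le; first by apply: is_cvg_nneseries => k _ _; apply: integral_ge0 => t _; rewrite lee_fin.
  apply: nearW => n; apply: le_trans (_ : (\sum_(0 <= k < n) \int[mu]_(t in `[0, 1]) u k t)%:E <= _)%E; last first.
    by rewrite lee_fin.
  rewrite -sumEFin; apply: lee_sum => k _.
  rewrite /Rintegral fineK; first exact: lexx.
  exact: integrable_fin_num (iu k).
have [|N [mN N0 sN]] := integrable_ae _ iF; first exact: measurable_itv.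
exists N; split => //; apply: subset_trans sN => t h1 h2; apply: h1 => tI.
have Ffin := h2 tI.
have Fb n : \sum_(0 <= k < n) u k t <= fine (F t).
  rewrite -lee_fin fineK // -sumEFin; apply: nneseries_lim_ge => k _ _.
  by rewrite lee_fin.
split; apply: (@cvgn_of_summable_steps _ (u^~ t) (fine (F t))) => // k.
  by rewrite -ReN -ReD; exact: normc_Re.
by rewrite -ImN -ImD; exact: normc_Im.
Qed.

Variable h : R[i] -> R[i].
Hypothesis dh : forall v, normc v < 1 -> cdiff h v.
Hypothesis bh : forall v, normc v < 1 -> normc (h v) <= 1.

Lemma pker_le (a z : R[i]) : normc a < 1 -> normc z <= 1 ->
  pker a z <= (1 - normc a) ^- 2.
Proof.
move=> a1 z1; rewrite /pker.
have h1 : 1 - normc a <= normc (1 - a^* * z).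
  apply: (@le_trans _ _ (normc 1 - normc (a^* * z))).
    by rewrite normc1 lerD2l lerN2 normcM normc_conj ler_piMr ?normc_ge0.
  by rewrite (le_trans (ler_norm _)) // ler_dist_normc.
have h2 : 0 < 1 - normc a by rewrite subr_gt0.
apply: (@le_trans _ _ (1 / normc (1 - a^* * z) ^+ 2)).
  by rewrite ler_wpM2r ?invr_ge0 ?sqr_ge0 // gerBl sqr_ge0.
rewrite div1r lef_pV2 ?posrE ?exprn_gt0 //; last exact: lt_le_trans h1.
by rewrite ler_pXn2r ?nnegrE // ?ltW // (lt_le_trans h2).
Qed.

(** Dilations along [fast_radii] converge almost everywhere, and the Poisson formula for them passes
    to the limit by domination. Existence of radial limits is not yet implied, since only one
    sequence of radii is used. *)
Lemma poisson_boundary : exists gr gi : R -> R,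
  [/\ mu.-integrable I01 (EFin \o gr), mu.-integrable I01 (EFin \o gi) &
   forall a, normc a < 1 ->
     Re (h a) = \int[mu]_(t in `[0, 1]) (gr t * pker a (pt t)) /\
     Im (h a) = \int[mu]_(t in `[0, 1]) (gi t * pker a (pt t))].
Proof.
have [r [rI r1 hr]] := fast_radii dh bh.
have cr k := rcont_dilation dh (rI k).
have norm_rpt k t : normc ((r k)%:C * pt t) < 1.
  by have /andP[r0 r1'] := rI k;
    rewrite normcM normc_circle_pt mulr1 normc_real ger0_norm // ltW.
have hM n : \sum_(0 <= k < n) \int[mu]_(t in `[0, 1])
    normc (h ((r k.+1)%:C * pt t) - h ((r k)%:C * pt t)) <= 4.
  apply: (@le_trans _ _ (\sum_(0 <= k < n) (2 * 2^-1 ^+ k))).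
    by apply: ler_sum => k _; exact: hr.
  suff -> : \sum_(0 <= k < n) (2 * 2^-1 ^+ k) = 4 - 4 * 2^-1 ^+ n :> R.
    by rewrite gerBl mulr_ge0 // exprn_ge0 // invr_ge0.
  elim: n => [|n ih]; first by rewrite big_geq // expr0 mulr1 subrr.
  by rewrite big_nat_recr //= ih exprS; field.
have [N [mN N0 sN]] := ae_cvg_of_summable_steps cr hM.
have cst_int (c : R) : mu.-integrable I01 (EFin \o cst c).
  by apply: continuous_itv_integrable => t; exact: cvg_cst.
(* Serves the real and the imaginary part. The limit [g] is chosen before the kernel [K], because
   one function must work for all points a. *)
have part (v : nat -> R -> R) : (forall k, continuous (v k)) ->
    (forall k t, `|v k t| <= 1) -> {ae mu, forall t, t \in `[0, 1] -> cvgn (v^~ t)} ->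
    exists2 g : R -> R, mu.-integrable I01 (EFin \o g) &
    forall K : R -> R, continuous K -> (exists M, forall t, `|K t| <= M) ->
      \int[mu]_(t in `[0, 1]) (v k t * K t) @[k --> \oo] -->
      \int[mu]_(t in `[0, 1]) (g t * K t).
  (* The upper limit is defined and measurable everywhere and agrees with the limit wherever that
     exists. *)
  move=> cv bv hv; pose g t := limn_sup (v^~ t).
  have mC (u : R -> R) : continuous u -> measurable_fun I01 u.
    move=> cu; have /integrableP[] := continuous_itv_integrable 0 1 cu.
    by move=> /measurable_EFinP.
  have mg : measurable_fun I01 g.
    apply: measurable_fun_limn_sup.
    - by move=> t _; exists 1 => _ [k _ <-]; rewrite (le_trans (ler_norm _)).
    - move=> t _; exists (-1) => _ [k _ <-]; rewrite lerNl.
      by rewrite (le_trans (ler_norm _)) // normrN.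
    - by move=> k; exact: mC.
  have cvg_g : {ae mu, forall t, t \in `[0, 1] -> v^~ t @ \oo --> g t}.
    have [N1 [mN1 N10 sN1]] := hv; exists N1; split => //.
    apply: subset_trans sN1 => t h1 h2; apply: h1 => /h2 cvt.
    have E : g t = limn (v^~ t) by apply: cvg_lim => //; exact: cvg_sups.
    by rewrite E.
  exists g.
    have mv k := mC _ (cv k).
    exact: (Rintegral_dominated_cvg mv mg (fun k t _ => bv k t) cvg_g).1.
  move=> K cK [M KM]; have mK := mC _ cK.
  apply: (@Rintegral_dominated_cvg _ (fun k t => v k t * K t) _ M _ _ _ _).2.
  - by move=> k; apply: measurable_funM => //; exact: mC.
  - exact: measurable_funM.
  - move=> k t _; rewrite normrM -[leRHS]mul1r.
    by apply: ler_pM => //; exact: KM.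
  - have [N1 [mN1 N10 sN1]] := cvg_g; exists N1; split => //.
    apply: subset_trans sN1 => t h1 h2; apply: h1 => /h2 cvt.
    by apply: cvgM => //; exact: cvg_cst.
have [|||gr igr hgr] := part (fun k t => Re (h ((r k)%:C * pt t))).
- by move=> k; exact: rcont_Re.
- by move=> k t; rewrite (le_trans (normc_Re _)) // bh.
- by exists N; split => //; apply: subset_trans sN => t h1 h2; apply: h1 => /h2[].
have [|||gi igi hgi] := part (fun k t => Im (h ((r k)%:C * pt t))).
- by move=> k; exact: rcont_Im.
- by move=> k t; rewrite (le_trans (normc_Im _)) // bh.
- by exists N; split => //; apply: subset_trans sN => t h1 h2; apply: h1 => /h2[].
exists gr, gi; split => // a a1.
have cK := continuous_pker a1.
have bK : exists M, forall t, `|pker a (pt t)| <= M.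
  exists ((1 - normc a) ^- 2) => t; rewrite ger0_norm ?pker_ge0 //.
  by apply: pker_le => //; rewrite normc_circle_pt.
have cvg_h : ccvg \oo (fun k => h ((r k)%:C * a)) (h a).
  apply: (ccont_ccvg (cdiff_cont (dh a1))) => //.
  rewrite -[X in ccvg _ _ X]mul1r; apply: ccvgM; first exact: ccvg_real.
  exact: ccvg_cst.
have E k : Cint (fun t => h ((r k)%:C * pt t) * (pker a (pt t))%:C) = h ((r k)%:C * a).
  have /andP[r0 r1'] := rI k.
  apply: (@poisson_formula _ (fun v => h ((r k)%:C * v)) (r k)^-1) => //.
    by rewrite invf_gt1.
  move=> z zr; apply: (@cdiff_comp _ (fun v => (r k)%:C * v) h).
    by apply: cdiffM; [exact: cdiff_cst|exact: cdiff_id].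
  apply: dh; rewrite normcM normc_real ger0_norm ?(ltW r0) //.
  by rewrite -ltr_pdivlMl // mulr1.
have /ccvg_ReImP[cRe cIm] := cvg_h.
split.
  have := hgr _ cK bK; apply: cvg_unique => //.
  suff -> : (fun k => \int[mu]_(t in `[0, 1]) (Re (h ((r k)%:C * pt t)) * pker a (pt t))) =
    (fun k => Re (h ((r k)%:C * a))) by [].
  apply/funext => k; rewrite -E Re_Cint; apply: eq_Rintegral => t _.
  by rewrite mulrC [_ * _%:C]mulrC Re_mulC.
have := hgi _ cK bK; apply: cvg_unique => //.
suff -> : (fun k => \int[mu]_(t in `[0, 1]) (Im (h ((r k)%:C * pt t)) * pker a (pt t))) =
  (fun k => Im (h ((r k)%:C * a))) by [].
apply/funext => k; rewrite -E; apply: eq_Rintegral => t _.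
by rewrite mulrC [_ * _%:C]mulrC Im_mulC.
Qed.

End boundary_functions.

(** * Radial limits of Poisson integrals at Lebesgue points *)

Section radial_limits.
Variable R : realType.
Local Notation mu := (@lebesgue_measure R).
Local Notation I01 := (`[0, 1]%classic : set R).
Local Notation pt := (@circle_pt R).

Lemma integrable_mul_bounded (v g : R -> R) (M : R) :
  mu.-integrable I01 (EFin \o v) -> measurable_fun I01 g ->
  (forall t, t \in `[0, 1] -> `|g t| <= M) ->
  mu.-integrable I01 (EFin \o (fun t => v t * g t)).
Proof.
move=> iv mg bg; have : mu.-integrable I01 ((EFin \o v) \* (EFin \o g))%E.
  apply: integrableMl => //.
  exists M; split; first exact: num_real.
  by move=> x Mx t tI /=; rewrite (le_trans (bg t tI)) // ltW.
by apply: eq_integrable => // t _ /=; rewrite EFinM.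
Qed.

Lemma integrable_dist_cst (g : R -> R) (c : R) :
  mu.-integrable I01 (EFin \o g) ->
  mu.-integrable I01 (EFin \o (fun t => g t - c)) /\
  mu.-integrable I01 (EFin \o (fun t => `|g t - c|)).
Proof.
move=> ig; have ic : mu.-integrable I01 (EFin \o cst c).
  by apply: continuous_itv_integrable => t; exact: cvg_cst.
have igc : mu.-integrable I01 (EFin \o (fun t => g t - c)).
  exact: eq_integrable (integrableB _ ig ic).
split=> //; exact: eq_integrable (integrable_abse igc).
Qed.

(** Used as a factor of the integrand, so that every integral stays over [0, 1]. *)
Definition near_ind (t0 s : R) : R -> R := \1_(ball t0 s).

Lemma near_indE (t0 s t : R) : near_ind t0 s t = if `|t0 - t| < s then 1 else 0.
Proof.
rewrite /near_ind indicE; have [h|h] := ltrP `|t0 - t| s; first by rewrite mem_set.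
by rewrite memNset // /ball /=; apply/negP; rewrite -leNgt.
Qed.

Lemma near_ind_meas (t0 s : R) : measurable_fun I01 (near_ind t0 s).
Proof. by apply: measurable_indic; exact: measurable_ball. Qed.

Lemma near_ind_norm (t0 s t : R) : `|near_ind t0 s t| <= 1.
Proof. by rewrite near_indE; case: ifP; rewrite ?normr1 ?normr0 ?ler01. Qed.

Lemma near_ind_ge0 (t0 s t : R) : 0 <= near_ind t0 s t.
Proof. by rewrite near_indE; case: ifP; rewrite ?ler01. Qed.

Section dyadic.
Variables (v K : R -> R) (t0 A eta delta : R).
Hypothesis iv : mu.-integrable I01 (EFin \o v).
Hypothesis v0 : forall t, 0 <= v t.
Hypothesis cK : continuous K.
Hypothesis K0 : forall t, 0 <= K t.
Hypotheses (eta0 : 0 < eta) (etad : eta <= delta) (A0 : 0 <= A).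
Hypothesis vA : forall s, 0 < s <= delta ->
  \int[mu]_(t in `[0, 1]) (v t * near_ind t0 s t) <= A * s.
Hypothesis K1 : forall t, t \in `[0, 1] -> K t <= 2 / eta.
Hypothesis K2 : forall t, t \in `[0, 1] -> `|t0 - t| < delta ->
  K t * (t0 - t) ^+ 2 <= 8 * eta.

Let mK : measurable_fun I01 K.
Proof.
by have /integrableP[] := continuous_itv_integrable 0 1 cK; move=> /measurable_EFinP.
Qed.

Let Kb t : t \in `[0, 1] -> `|K t| <= 2 / eta.
Proof. by move=> tI; rewrite ger0_norm ?K0 // K1. Qed.

Let ivK : mu.-integrable I01 (EFin \o (fun t => v t * K t)).
Proof. exact: integrable_mul_bounded iv mK Kb. Qed.

Let ivKb s : mu.-integrable I01 (EFin \o (fun t => v t * K t * near_ind t0 s t)).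
Proof. by apply: (integrable_mul_bounded ivK (near_ind_meas _ _)) => t _; exact: near_ind_norm. Qed.

Let ivb s : mu.-integrable I01 (EFin \o (fun t => v t * near_ind t0 s t)).
Proof. by apply: (integrable_mul_bounded iv (near_ind_meas _ _)) => t _; exact: near_ind_norm. Qed.

Let icvb c s : mu.-integrable I01 (EFin \o (fun t => c * (v t * near_ind t0 s t))).
Proof. by apply: eq_integrable (integrableZl _ c (ivb s)). Qed.

(** In the application [v] is |g - g(t0)|, [K] is the Poisson kernel of a point at distance [eta]
    from the circle, and [vA] expresses that t0 is a Lebesgue point of g. *)
Let ball_step s : 0 < s <= delta ->
  \int[mu]_(t in `[0, 1]) (v t * K t * near_ind t0 s t) <=
  \int[mu]_(t in `[0, 1]) (v t * K t * near_ind t0 (s / 2) t) + 32 * eta * A / s.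
Proof.
move=> /andP[s0 sd].
(* Outside radius s/2 one has (t0 - t)^2 >= s^2 / 4, which turns the 8 of [K2] into 32. *)
pose c := 32 * eta / s ^+ 2.
have s20 : 0 < s ^+ 2 by rewrite exprn_gt0.
have c0 : 0 <= c by rewrite divr_ge0 ?(ltW s20) // mulr_ge0 // ltW.
apply: (@le_trans _ _ (\int[mu]_(t in `[0, 1]) (v t * K t * near_ind t0 (s / 2) t
    + c * (v t * near_ind t0 s t)))).
  apply: le_Rintegral => //.
    by apply: eq_integrable (integrableD _ (ivKb (s / 2)) (icvb c s)).
  move=> t tI; rewrite !near_indE.
  have [ts|ts] := ltrP `|t0 - t| s; last first.
    rewrite !mulr0 addr0; apply: mulr_ge0; first exact: mulr_ge0.
    by case: ifP => _; rewrite ?ler01.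
  have [ts2|ts2] := ltrP `|t0 - t| (s / 2).
    by rewrite lerDl mulr_ge0 // mulr_ge0.
  rewrite mulr0 add0r !mulr1 mulrC ler_wpM2r //.
  have h1 : s ^+ 2 <= 4 * (t0 - t) ^+ 2.
    have -> : s ^+ 2 = 4 * (s / 2) ^+ 2 by field.
    rewrite ler_pM2l // -[in leRHS](real_normK (num_real (t0 - t))) ler_pXn2r ?nnegrE ?normr_ge0 //.
    by rewrite divr_ge0 // ltW.
  rewrite /c ler_pdivlMr //.
  have h2 := K2 tI (lt_le_trans ts sd).
  apply: (@le_trans _ _ (4 * (K t * (t0 - t) ^+ 2))).
    by rewrite [leRHS]mulrCA ler_wpM2l.
  have -> : 32 * eta = 4 * (8 * eta) by ring.
  by rewrite ler_pM2l.
rewrite RintegralD //= lerD2l RintegralZl //.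
apply: (@le_trans _ _ (c * (A * s))).
  by rewrite ler_wpM2l // vA // s0.
by rewrite /c le_eqVlt; apply/orP; left; apply/eqP; field; rewrite gt_eqF.
Qed.

(* The kernel is at most 32 eta / s^2 on the shell s/2 <= |t0 - t| < s, so halving the
   radius down to eta costs a geometric series. *)
Lemma dyadic_bound :
  \int[mu]_(t in `[0, 1]) (v t * K t * near_ind t0 delta t) <= 36 * A.
Proof.
have d0 : 0 < delta by exact: lt_le_trans etad.
pose s m : R := delta * 2^-1 ^+ m.
have sm0 m : 0 < s m by rewrite mulr_gt0 // exprn_gt0.
have smd m : s m <= delta by rewrite ler_piMr ?(ltW d0) // exprn_ile1 // invf_le1 ?ler1n.
have sS m : s m.+1 = s m / 2 by rewrite /s exprS; field.
have iter m : \int[mu]_(t in `[0, 1]) (v t * K t * near_ind t0 delta t) <=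
    \int[mu]_(t in `[0, 1]) (v t * K t * near_ind t0 (s m) t) + 32 * eta * A / s m.
  elim: m => [|m ih].
    rewrite /s expr0 mulr1 lerDl divr_ge0 ?(ltW d0) // !mulr_ge0 //; exact: ltW.
  apply: (le_trans ih); have := @ball_step (s m); rewrite sm0 smd => /(_ isT).
  rewrite -sS => h1.
  have -> : 32 * eta * A / s m.+1 = 32 * eta * A / s m + 32 * eta * A / s m.
    by rewrite sS; field; rewrite gt_eqF.
  by rewrite addrA lerD2r.
have ex : exists m, s m < eta.
  have : s m @[m --> \oo] --> delta * 0.
    apply: cvgM; first exact: cvg_cst.
    by apply: cvg_expr; rewrite gtr0_norm ?invr_gt0 // invf_lt1 // ltr1n.
  rewrite mulr0 => /cvgrPdist_lt/(_ _ eta0)[N _ hN]; exists N.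
  by have := hN N (leqnn N); rewrite sub0r normrN gtr0_norm.
(* Stopping one halving before the radius drops below eta leaves a radius in [eta, 2 eta). There K
   <= 2 / eta costs 4 A, and the shells removed so far cost 32 A. *)
case: (ex_minnP ex) => [[|m]] sm min.
  by have := lt_le_trans sm etad; rewrite /s expr0 mulr1 ltxx.
have etam : eta <= s m.
  by rewrite leNgt; apply/negP => /min; rewrite ltnn.
apply: (le_trans (iter m)).
have smI : 0 < s m <= delta by rewrite sm0 smd.
have h1 : \int[mu]_(t in `[0, 1]) (v t * K t * near_ind t0 (s m) t) <= 2 / eta * (A * s m).
  apply: (@le_trans _ _ (\int[mu]_(t in `[0, 1]) (2 / eta * (v t * near_ind t0 (s m) t)))).
    apply: le_Rintegral => // t tI; rewrite mulrAC mulrC ler_wpM2r ?K1 //.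
    by rewrite mulr_ge0 // near_ind_ge0.
  by rewrite RintegralZl // ler_wpM2l ?vA // divr_ge0 // ltW.
have h2 : 2 / eta * (A * s m) <= 4 * A.
  have h : s m <= 2 * eta by move: sm; rewrite sS; lra.
  rewrite mulrAC ler_pdivrMr //.
  have := ler_wpM2l A0 h; move: (A * _) => x hx.
  have -> : 4 * A * eta = 2 * (A * (2 * eta)) by ring.
  by rewrite ler_pM2l.
have h3 : 32 * eta * A / s m <= 32 * A.
  rewrite ler_pdivrMr // -!mulrA ler_pM2l // [leLHS]mulrC ler_wpM2l //.
have := lerD (le_trans h1 h2) h3; rewrite -mulrDl.
have -> : 4 + 32 = 36 :> R by rewrite -natrD.
by [].
Qed.

End dyadic.

Lemma normc_ptB_sqr (s t : R) :
  normc (pt s - pt t) ^+ 2 = 2 - 2 * cos (2 * pi * (s - t)).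
Proof.
rewrite mulrBr cosB /circle_pt /= sqr_sqrtr ?addr_ge0 ?sqr_ge0 //.
have := cos2Dsin2 (2 * pi * s); have := cos2Dsin2 (2 * pi * t).
move: (cos _) (sin _) (cos _) (sin _) => a b c d h1 h2.
have -> : (a - c) ^+ 2 + (b - d) ^+ 2 = (c ^+ 2 + d ^+ 2) + (a ^+ 2 + b ^+ 2) - 2 * (a * c + b * d).
  by ring.
by rewrite h1 h2.
Qed.

(** The margin d <= t0 <= 1 - d excludes wrap-around: it gives |t0 - t| <= 1 - d, so the two points
    are at least d apart either way round the circle. *)
Lemma pt_away (t0 d t : R) : 0 < d -> d <= t0 <= 1 - d -> t \in `[0, 1] ->
  d <= `|t0 - t| -> 2 - 2 * cos (2 * pi * d) <= normc (pt t - pt t0) ^+ 2.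
Proof.
move=> d0 /andP[dt0 t0d] tI dt; have /andP[t0' t1] : 0 <= t <= 1 by rewrite in_itv in tI.
have pi0 : 0 < pi :> R by exact: pi_gt0.
rewrite normcB normc_ptB_sqr lerD2l lerN2 ler_pM2l //.
have -> : cos (2 * pi * (t0 - t)) = cos (2 * pi * `|t0 - t|).
  by case: ger0P => // _; rewrite mulrN cosN.
set x := `|t0 - t| in dt *.
have xd : x <= 1 - d by rewrite /x ler_norml; apply/andP; split; lra.
have cos_le (y : R) : d <= y -> y <= 2^-1 -> cos (2 * pi * y) <= cos (2 * pi * d).
  move=> dy y2; rewrite leNgt; apply/negP.
  have pid : pi * d <= pi * y by rewrite ler_pM2l.
  have piy : pi * y <= pi * 2^-1 by rewrite ler_pM2l.
  have pid0 : 0 < pi * d by rewrite mulr_gt0.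
  rewrite ltr_cos ?in_itv /=; [|apply/andP; split; lra..].
  by rewrite ltNge -!mulrA ler_pM2l // pid.
(* Beyond half a turn the chord is measured the other way round, with 1 - x in place of x. *)
have [x2|x2] := lerP x 2^-1; first exact: cos_le.
have -> : cos (2 * pi * x) = cos (2 * pi * (1 - x)).
  rewrite mulrBr mulr1 cosB mulr_natl cos2pi sin2pi mul1r mul0r addr0 //.
apply: cos_le; lra.
Qed.

Lemma cos_lt1 (d : R) : 0 < d -> d <= 2^-1 -> 0 < 2 - 2 * cos (2 * pi * d).
Proof.
move=> d0 d2; have pi0 : 0 < pi :> R by exact: pi_gt0.
have pd : 0 < pi * d by rewrite mulr_gt0.
have pd2 : pi * d <= pi * 2^-1 by rewrite ler_pM2l.
have : cos (2 * pi * d) < 1.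
  have h0 : 0 \in `[0, pi :> R] by rewrite in_itv /= lexx ltW.
  have hd : 2 * pi * d \in `[0, pi :> R] by rewrite in_itv /=; apply/andP; split; lra.
  by rewrite -[ltRHS]cos0 ltr_cos // -mulrA mulr_gt0.
lra.
Qed.

(** The derivative of [circle_pt] has modulus 2 pi > 1, so close to t0 chords exceed differences of
    parameters. *)
Lemma pt_near (t0 : R) : exists2 d, 0 < d & forall t, `|t0 - t| < d ->
  `|t0 - t| <= normc (pt t - pt t0).
Proof.
have [hr hi] := cderiv_circle_pt t0.
have quot (u : R -> R) (l : R) : is_derive t0 1 u l ->
    x^-1 * (u (x + t0) - u t0) @[x --> (0 : R)^'] --> l.
  move=> [du <-]; suff -> : (fun x => x^-1 * (u (x + t0) - u t0)) =
    (fun x => x^-1 *: ((u \o shift t0) (x *: 1) - u t0)) by exact: du.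
  by apply/funext => x /=; rewrite [x *: 1]mulr1.
have : ccvg ((0 : R)^') (fun x : R => x^-1%:C * (pt (x + t0) - pt t0))
    ((2 * pi)%:C * 'i * pt t0).
  apply/ccvg_ReImP; split.
    by under eq_fun do rewrite Re_mulC ReD ReN; exact: quot.
  by under eq_fun do rewrite Im_mulC ImD ImN; exact: quot.
move=> /cvg_normc; rewrite !normcM normc_circle_pt mulr1 normc_real.
have -> : normc 'i = 1 :> R by rewrite /= expr0n expr1n add0r sqrtr1.
have pi2 : 2 <= pi :> R by exact: pi_ge2.
rewrite mulr1 ger0_norm; last by rewrite mulr_ge0 // (le_trans _ pi2).
have pi1 : 1 < 2 * pi :> R by lra.
move=> /(cvgr_gt _)/(_ _ pi1); rewrite near_withinE => -[d d0 hd].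
exists d; first exact: d0.
move=> t td; have [->|tt0] := eqVneq t t0; first by rewrite !subrr normr0 normc_ge0.
have : 1 < normc ((t - t0)^-1%:C * (pt (t - t0 + t0) - pt t0)).
  by apply: (hd (t - t0)); [rewrite /ball_ /= sub0r opprB|rewrite subr_eq0].
rewrite subrK normcM normc_real normrV ?unitfE ?subr_eq0 //.
by rewrite ltr_pdivlMl ?normr_gt0 ?subr_eq0 // mulr1 distrC => /ltW.
Qed.


(** With d = |pt t - a| one has d >= 1 - rho, and the triangle inequality gives |pt t - pt t0| <= 2
    d. The numerator is at most 2 (1 - rho), whence 8 = 2 times 2^2. *)
Lemma pker_pt_le (rho t0 t : R) : 0 <= rho -> rho < 1 ->
  pker (rho%:C * pt t0) (pt t) <= 2 / (1 - rho) /\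
  pker (rho%:C * pt t0) (pt t) * normc (pt t - pt t0) ^+ 2 <= 8 * (1 - rho).
Proof.
move=> r0 r1; set a := rho%:C * pt t0.
have na : normc a = rho by rewrite normcM normc_circle_pt mulr1 normc_real ger0_norm.
have e0 : 0 < 1 - rho by rewrite subr_gt0.
pose d := normc (pt t - a).
have dE : normc (1 - a^* * pt t) = d.
  have -> : 1 - a^* * pt t = (pt t - a)^* * pt t.
    rewrite rmorphB mulrBl /=; congr (_ - _).
    by rewrite mulrC circle_pt_conj.
  by rewrite normcM normc_conj normc_circle_pt mulr1.
have d1 : 1 - rho <= d.
  rewrite -na -(normc_circle_pt t); apply: le_trans (ler_norm _) _.
  exact: ler_dist_normc.
have d0 : 0 < d by exact: lt_le_trans e0 d1.
have d2 : normc (pt t - pt t0) <= 2 * d.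
  have -> : pt t - pt t0 = (pt t - a) + (rho - 1)%:C * pt t0.
    by rewrite real_complexB /a; ring.
  rewrite (le_trans (le_normcD _ _)) // normcM normc_circle_pt mulr1 normc_real.
  rewrite -/d distrC ger0_norm ?(ltW e0) //; lra.
have num : 1 - rho ^+ 2 <= 2 * (1 - rho).
  have -> : 1 - rho ^+ 2 = (1 + rho) * (1 - rho) by ring.
  by rewrite ler_pM2r //; lra.
have num0 : 0 <= 1 - rho ^+ 2 by rewrite subr_ge0 expr_le1 // ltW.
rewrite /pker dE na; split.
  rewrite ler_pdivrMr ?exprn_gt0 // mulrAC ler_pdivlMr //.
  apply: (@le_trans _ _ (2 * (1 - rho) * (1 - rho))).
    by rewrite ler_pM2r.
  by rewrite -mulrA ler_pM2l // -expr2 ler_pXn2r ?nnegrE // ltW.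
rewrite mulrAC ler_pdivrMr ?exprn_gt0 //.
apply: (@le_trans _ _ (2 * (1 - rho) * (2 * d) ^+ 2)); last first.
  by rewrite le_eqVlt; apply/orP; left; apply/eqP; ring.
apply: ler_pM => //; first exact: sqr_ge0.
by rewrite ler_pXn2r ?nnegrE ?normc_ge0 // mulr_ge0 // ltW.
Qed.

(** The ball has length 2s, so an average below A/2 yields A s. Small s also keeps the ball inside
    [0, 1], where the restriction of g is g itself. *)
Lemma lebesgue_pt_small (g : R -> R) (t0 A : R) : 0 < t0 < 1 -> 0 < A ->
  mu.-integrable I01 (EFin \o g) -> lebesgue_pt (g \_ I01) t0 ->
  exists2 d, 0 < d & forall s, 0 < s < d ->
    \int[mu]_(t in `[0, 1]) (`|g t - g t0| * near_ind t0 s t) <= A * s.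
Proof.
move=> /andP[t00 t01] A0 ig lpt.
have A20 : (0 < (A / 2)%:E)%E by rewrite lte_fin divr_gt0.
have : \forall s \near (0:R)^'+, (davg (g \_ I01) t0 s < (A / 2)%:E)%E.
  have nb : nbhs (0%E : \bar R) [set y | (y < (A / 2)%:E)%E].
    by apply: open_nbhs_nbhs; split => //; exact: open_ereal_lt_ereal.
  exact: lpt nb.
rewrite near_withinE => -[d d0 hd].
exists (Num.min d (Num.min t0 (1 - t0))).
  by rewrite !lt_min t00 subr_gt0 t01 !andbT; exact: d0.
move=> s /andP[s0]; rewrite !lt_min => /and3P[sd st0 st1].
have : (davg (g \_ I01) t0 s < (A / 2)%:E)%E.
  by apply: hd => //; rewrite /ball_ /= sub0r normrN gtr0_norm.
rewrite /davg /iavg lebesgue_measure_ball ?(ltW s0) //.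
have s2 : 0 < s *+ 2 by rewrite mulrn_wgt0.
rewrite (_ : ((s *+ 2)%:E^-1 = ((s *+ 2)^-1)%:E)%E); last by rewrite inver gt_eqF.
have subI : ball t0 s `<=` I01.
  move=> t; rewrite /ball /= ltr_distlC in_itv /= => /andP[h1 h2]; apply/andP; split; lra.
have iv : mu.-integrable I01 (EFin \o (fun t => `|g t - g t0|)).
  exact: (integrable_dist_cst (g t0) ig).2.
rewrite (_ : (\int[mu]_(y in ball t0 s) `|((center ((g \_ I01) t0) \o g \_ I01) y)%:E|)%E =
   (\int[mu]_(t in `[0, 1]) (`|g t - g t0| * near_ind t0 s t))%:E); last first.
  have E : (\int[mu]_(y in ball t0 s) `|((center ((g \_ I01) t0) \o g \_ I01) y)%:E|)%E =
    (\int[mu]_(t in `[0%R, 1%R]) (`|g t - g t0| * near_ind t0 s t)%:E)%E.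
    rewrite -(setIidr subI) integral_mkcondr; apply: eq_integral => t /set_mem tI.
    rewrite /patch near_indE; case: ifPn => [/set_mem tb|/negP tb].
      have t0I : t0 \in I01 by apply/mem_set; rewrite /= in_itv /= !ltW.
      have -> : `|t0 - t| < s by exact: tb.
      by rewrite t0I mulr1 /= mem_set.
    rewrite ifF ?mulr0 //; apply/negP => h; apply: tb; exact/mem_set.
  rewrite E /Rintegral fineK //; apply: integrable_fin_num => //.
  apply: (integrable_mul_bounded iv (near_ind_meas _ _)) => t _; exact: near_ind_norm.
rewrite -EFinM lte_fin ltr_pdivrMl // => /ltW.
by have -> : s *+ 2 * (A / 2) = A * s by field.
Qed.


(** As the kernel has mean 1, the error is at most the integral of |g - g(t0)| times the kernel.
    Near t0 the dyadic bound applies; farther away the kernel tends uniformly to 0. *)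
Lemma poisson_radial (g : R -> R) (t0 : R) : 0 < t0 < 1 ->
  mu.-integrable I01 (EFin \o g) -> lebesgue_pt (g \_ I01) t0 ->
  \int[mu]_(t in `[0, 1]) (g t * pker (rho%:C * pt t0) (pt t)) @[rho --> (1 : R)^'-]
    --> g t0.
Proof.
move=> t0I ig lpt; have /andP[t00 t01] := t0I.
apply/cvgrPdist_le => e e0.
(* Then the near part, at most 36 A, is e / 2. *)
pose A := e / 72; have A0 : 0 < A by rewrite divr_gt0.
have [d1 d10 hd1] := lebesgue_pt_small t0I A0 ig lpt.
have [d2 d20 hd2] := pt_near t0.
pose d := Num.min (d1 / 2) (Num.min d2 (Num.min t0 (1 - t0))).
have d0 : 0 < d by rewrite !lt_min d20 t00 subr_gt0 t01 divr_gt0.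
have dd1 : d < d1.
  apply: (@le_lt_trans _ _ (d1 / 2)); last lra.
  by rewrite /d ge_min lexx.
have dd2 : d <= d2 by rewrite /d !ge_min lexx !orbT.
have dt0 : d <= t0 <= 1 - d.
  have h1 : d <= t0 by rewrite /d !ge_min lexx !orbT.
  have h2 : d <= 1 - t0 by rewrite /d !ge_min lexx !orbT.
  apply/andP; split; lra.
have d2' : d <= 2^-1 by case/andP: dt0; lra.
pose v t := `|g t - g t0|.
have v0 t : 0 <= v t by exact: normr_ge0.
have [igc iv] := integrable_dist_cst (g t0) ig.
pose V := \int[mu]_(t in `[0, 1]) v t.
have V0 : 0 <= V by apply: Rintegral_ge0 => t _.
pose c := 2 - 2 * cos (2 * pi * d).
have c0 : 0 < c by exact: cos_lt1.
have vA s : 0 < s <= d -> \int[mu]_(t in `[0, 1]) (v t * near_ind t0 s t) <= A * s.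
  by move=> /andP[s0 sd]; apply: hd1; rewrite s0 (le_lt_trans sd).
near=> rho.
have rho0 : 0 <= rho by near: rho; apply: nbhs_left_ge; exact: ltr01.
have rho1 : rho < 1 by near: rho; exact: nbhs_left_lt.
set eta := 1 - rho.
have eta0 : 0 < eta by rewrite subr_gt0.
have etad : eta <= d.
  have : 1 - d <= rho by near: rho; apply: nbhs_left_ge; rewrite gtrBl.
  rewrite /eta; lra.
(* At parameter distance at least d the squared chord is at least c, so the kernel is at most 8 eta
   / c. V + 1 instead of V in the threshold covers V = 0. *)
have etac : 8 * eta / c * V <= e / 2.
  have : 1 - e / 2 * c / 8 / (V + 1) <= rho.
    near: rho; apply: nbhs_left_ge.
    by rewrite gtrBl !mulr_gt0 ?invr_gt0 // ltr_wpDl.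
  have V1 : 0 < V + 1 by rewrite ltr_wpDl.
  have -> : e / 2 * c / 8 / (V + 1) = e / 2 * (c / (8 * (V + 1))).
    by field; rewrite gt_eqF.
  move=> h; have : eta <= e / 2 * (c / (8 * (V + 1))) by rewrite /eta; lra.
  rewrite mulrA ler_pdivlMr ?mulr_gt0 // => h'.
  rewrite mulrAC ler_pdivrMr //; apply: le_trans h'.
  have := ltW eta0; have := mulr_ge0 (ltW eta0) V0.
  by rewrite [8 * eta * V]mulrC [V * (8 * eta)]mulrCA [V * eta]mulrC => x1 x2; lra.
pose a := rho%:C * pt t0; pose K t := pker a (pt t).
have na : normc a < 1 by rewrite normcM normc_circle_pt mulr1 normc_real ger0_norm.
have K0 t : 0 <= K t by exact: pker_ge0.
have cK : continuous K by exact: continuous_pker.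
have K1 t : K t <= 2 / eta by have [] := pker_pt_le t0 t rho0 rho1.
have K2 t : K t * normc (pt t - pt t0) ^+ 2 <= 8 * eta by have [] := pker_pt_le t0 t rho0 rho1.
have mK : measurable_fun I01 K.
  by have /integrableP[] := continuous_itv_integrable 0 1 cK; move=> /measurable_EFinP.
have Kb t : t \in `[0, 1] -> `|K t| <= 2 / eta by move=> _; rewrite ger0_norm.
have igK := integrable_mul_bounded ig mK Kb.
have igcK := integrable_mul_bounded igc mK Kb.
have ivK := integrable_mul_bounded iv mK Kb.
have icK : mu.-integrable I01 (EFin \o (fun t => g t0 * K t)).
  by apply: eq_integrable (integrableZl _ (g t0) (integrable_pker na)).
have ivKb : mu.-integrable I01 (EFin \o (fun t => v t * K t * near_ind t0 d t)).
  by apply: (integrable_mul_bounded ivK (near_ind_meas _ _)) => t _; exact: near_ind_norm.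
have icv : mu.-integrable I01 (EFin \o (fun t => 8 * eta / c * v t)).
  by apply: eq_integrable (integrableZl _ (8 * eta / c) iv).
have dyad : \int[mu]_(t in `[0, 1]) (v t * K t * near_ind t0 d t) <= 36 * A.
  apply: (@dyadic_bound v K t0 A eta d) => //; first exact: ltW.
  move=> t tI td; apply: le_trans (K2 t); rewrite ler_wpM2l //.
  rewrite -[in leLHS](real_normK (num_real (t0 - t))) ler_pXn2r ?nnegrE ?normc_ge0 //.
  by apply: hd2; exact: lt_le_trans dd2.
have split_int : \int[mu]_(t in `[0, 1]) (v t * K t) <= e.
  apply: (@le_trans _ _ (\int[mu]_(t in `[0, 1]) (v t * K t * near_ind t0 d t + 8 * eta / c * v t))).
    apply: le_Rintegral => //.
      exact: eq_integrable (integrableD _ ivKb icv).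
    move=> t tI; rewrite near_indE; have [td|td] := ltrP `|t0 - t| d.
      by rewrite mulr1 lerDl mulr_ge0 // divr_ge0 ?(ltW c0) // mulr_ge0 // ltW.
    rewrite mulr0 add0r mulrC ler_wpM2r // ler_pdivlMr //.
    by apply: le_trans (K2 t); rewrite ler_wpM2l // pt_away.
  rewrite RintegralD //= RintegralZl // (le_trans (lerD dyad etac)) //.
  have -> : 36 * A = e / 2 by rewrite /A; field.
  by rewrite -splitr.
rewrite distrC.
have -> : \int[mu]_(t in `[0, 1]) (g t * pker a (pt t)) - g t0 =
    \int[mu]_(t in `[0, 1]) ((g t - g t0) * K t).
  under [RHS]eq_Rintegral do rewrite mulrBl.
  rewrite RintegralB // RintegralZl //; last exact: integrable_pker.
  by rewrite Rintegral_pker // mulr1.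
rewrite (le_trans (le_normr_Rintegral _ igcK)) //.
under eq_Rintegral do rewrite normrM (ger0_norm (K0 _)).
exact: split_int.
Unshelve. all: by end_near. Qed.

(** The exceptional set consists of the points that fail to be Lebesgue points of one of the two
    boundary functions. The end points 0 and 1, where the parametrization closes up, are set
    aside. *)
Theorem fatou_radial (h : R[i] -> R[i]) :
  (forall v, normc v < 1 -> cdiff h v) -> (forall v, normc v < 1 -> normc (h v) <= 1) ->
  {ae mu, forall t, 0 < t < 1 -> exists l, ccvg ((1 : R)^'-) (fun r => h (r%:C * pt t)) l}.
Proof.
move=> dh bh; have [gr [gi [igr igi hg]]] := poisson_boundary dh bh.
have lr := lebesgue_differentiation (integrable_locally (measurable_itv _) igr).
have li := lebesgue_differentiation (integrable_locally (measurable_itv _) igi).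
have [N1 [mN1 N10 sN1]] := lr; have [N2 [mN2 N20 sN2]] := li.
exists (N1 `|` N2); split; first exact: measurableU.
  by rewrite null_set_setU.
move=> t /not_implyP[tI nl].
have [t1|t1] := pselect (lebesgue_pt (gr \_ I01) t); last by left; exact: sN1.
have [t2|t2] := pselect (lebesgue_pt (gi \_ I01) t); last by right; exact: sN2.
exfalso; apply: nl; exists (gr t +i* gi t).
apply/ccvg_ReImP; split => /=.
  have := poisson_radial tI igr t1; apply: cvg_trans; apply: near_eq_cvg.
  near=> r; have r0 : 0 <= r by near: r; apply: nbhs_left_ge; exact: ltr01.
  have r1 : r < 1 by near: r; exact: nbhs_left_lt.
  by rewrite (hg _ _).1 // normcM normc_circle_pt mulr1 normc_real ger0_norm.
have := poisson_radial tI igi t2; apply: cvg_trans; apply: near_eq_cvg.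
near=> r; have r0 : 0 <= r by near: r; apply: nbhs_left_ge; exact: ltr01.
have r1 : r < 1 by near: r; exact: nbhs_left_lt.
by rewrite (hg _ _).2 // normcM normc_circle_pt mulr1 normc_real ger0_norm.
Unshelve. all: by end_near. Qed.

End radial_limits.

(** * The upper bound *)

Section null_sets.
Context d (T : measurableType d) (R : realType) (mu : {measure set T -> \bar R}).
Import HBNNSimple.
Local Open Scope ereal_scope.

(* No measurability of the functions is required: the integral is a supremum over
   simple functions, which can be truncated outside the null set. *)
Lemma integral_eq_off_null (D N : set T) (f g : T -> \bar R) :
  measurable N -> mu N = 0 -> (forall x, D x -> ~ N x -> f x = g x) ->
  \int[mu]_(x in D) f x = \int[mu]_(x in D) g x.
Proof.
move=> mN N0 fg.
have half (u v : T -> \bar R) : (forall x, 0 <= v x) -> (forall x, ~ N x -> u x = v x) ->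
    ereal_sup [set sintegral mu s | s in [set s : {nnsfun T >-> R} | forall x, (s x)%:E <= u x]] <=
    ereal_sup [set sintegral mu s | s in [set s : {nnsfun T >-> R} | forall x, (s x)%:E <= v x]].
  move=> v0 uv; apply: ge_ereal_sup => _ [s /= su <-].
  pose s' := proj_nnsfun s (measurableC mN).
  have s'E x : s' x = (s x * \1_(~` N) x)%R by [].
  rewrite (_ : sintegral mu s = sintegral mu s'); last first.
    rewrite -!integralT_nnsfun; apply: ae_eq_integral => //.
    - exact/measurable_EFinP.
    - exact/measurable_EFinP.
    exists N; split => // x; apply: contra_notP => xN _.
    by rewrite s'E indicE mem_set // mulr1.
  apply: ereal_sup_ubound; exists s' => // x; rewrite s'E indicE.
  have [xN|xN] := pselect (N x); first by rewrite memNset ?mulr0 // => /(_ xN).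
  by rewrite mem_set // mulr1 -uv.
have eqN x : ~ N x -> (f \_ D) x = (g \_ D) x.
  by move=> xN; rewrite /patch; case: ifPn => // /set_mem xD; exact: fg.
rewrite /integral; congr (_ - _); apply/eqP; rewrite eq_le !half //;
  try (by move=> x xN; rewrite ?funeposE ?funenegE eqN //);
  by move=> x; rewrite ?funepos_ge0 ?funeneg_ge0.
Qed.

End null_sets.

(** * Passage from dilations to boundary values *)

Section toeplitz_upper_bound.
Variable R : realType.
Local Notation mu := (@lebesgue_measure R).
Local Notation I01 := (`[0, 1]%classic : set R).
Local Notation pt := (@circle_pt R).

(** The limit u will involve [boundary_value], which is controlled only off N and whose
    measurability is not at hand. It is replaced by a function vanishing on N, measurable as a
    pointwise limit, with the same integral. *)
Lemma Rintegral_cvg_off_null (un : nat -> R -> R) (u : R -> R) (M : R) (N : set R) :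
  measurable N -> mu N = 0%E -> (forall n, continuous (un n)) ->
  (forall n t, t \in `[0, 1] -> `|un n t| <= M) ->
  (forall t, t \in `[0, 1] -> ~ N t -> un n t @[n --> \oo] --> u t) ->
  \int[mu]_(t in `[0, 1]) un n t @[n --> \oo] --> \int[mu]_(t in `[0, 1]) u t.
Proof.
move=> mN N0 cu bu h; pose chi (t : R) : R := \1_(~` N) t.
have mchi : measurable_fun I01 chi by apply: measurable_indic; exact: measurableC.
have mu_ n : measurable_fun I01 (un n).
  have /integrableP[] := continuous_itv_integrable 0 1 (cu n).
  by move=> /measurable_EFinP.
pose v t := u t * chi t.
have chiE t : ~ N t -> chi t = 1 by move=> tN; rewrite /chi indicE mem_set.
have mv : measurable_fun I01 v.
  apply: (@measurable_fun_cvg _ _ _ _ (fun n t => un n t * chi t)) => //.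
  - by move=> n; exact: measurable_funM.
  - move=> t tI; rewrite /v; have [tN|tN] := pselect (N t).
      have -> : chi t = 0 by rewrite /chi indicE memNset // => /(_ tN).
      by rewrite mulr0; under eq_fun do rewrite mulr0; exact: cvg_cst.
    by rewrite chiE // mulr1; under eq_fun do rewrite mulr1; exact: h.
have uv : \int[mu]_(t in `[0, 1]) v t = \int[mu]_(t in `[0, 1]) u t.
  have vu t : I01 t -> ~ N t -> (EFin \o v) t = (EFin \o u) t.
    by move=> _ tN; rewrite /= /v chiE // mulr1.
  rewrite /Rintegral; congr fine.
  exact: (@integral_eq_off_null _ _ _ (@lebesgue_measure R) _ _ _ _ mN N0 vu).
rewrite -uv; apply: (@Rintegral_dominated_cvg _ _ _ M _ _ _ _).2 => //.
exists N; split => //= t /not_implyP[tI]; apply: contra_notP => tN.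
by rewrite /v chiE // mulr1; exact: h.
Qed.

Lemma Cint_cvg_off_null (fn : nat -> R -> R[i]) (f : R -> R[i]) (M : R) (N : set R) :
  measurable N -> mu N = 0%E -> (forall n, rcont (fn n)) ->
  (forall n t, t \in `[0, 1] -> normc (fn n t) <= M) ->
  (forall t, t \in `[0, 1] -> ~ N t -> ccvg \oo (fn ^~ t) (f t)) ->
  ccvg \oo (fun n => Cint (fn n)) (Cint f).
Proof.
move=> mN N0 cf bf h; apply/ccvg_ReImP; split.
  apply: (Rintegral_cvg_off_null mN N0) => [n|n t tI|t tI tN].
  - exact: rcont_Re.
  - exact: le_trans (normc_Re _) (bf n t tI).
  - by have /ccvg_ReImP[] := h t tI tN.
apply: (Rintegral_cvg_off_null mN N0) => [n|n t tI|t tI tN].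
- exact: rcont_Im.
- exact: le_trans (normc_Im _) (bf n t tI).
- by have /ccvg_ReImP[] := h t tI tN.
Qed.

Lemma disc_normc (z : R[i]) : disc z <-> normc z < 1.
Proof. by rewrite /disc /= norm_normc -[1]/(1%:C) ltcR. Qed.

Lemma circle_normc (z : R[i]) : circle z <-> normc z = 1.
Proof.
rewrite /circle /= norm_normc -[1]/(1%:C); split => [/complexI//|->//].
Qed.

Lemma ray_disc (eps : R) (xi : R[i]) : ray eps xi `<=` @disc R.
Proof. by move=> z [/andP[]]. Qed.

Lemma Hinf_norm_le (f : R[i] -> R[i]) (M : R) :
  (Hinf_norm f <= M%:E)%E <-> forall z, normc z < 1 -> normc (f z) <= M.
Proof.
split=> [h z /disc_normc z1|h].
  by rewrite -lee_fin; apply: le_trans h; apply: ereal_sup_ubound; exists z.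
by apply: ge_ereal_sup => _ [z /disc_normc /h zM <-]; rewrite lee_fin.
Qed.

Lemma blaschkeE n (E : set R[i]) (B : R[i] -> R[i]) : blaschke_products n E B <->
  exists (c : R[i]) (a : 'I_n -> R[i]), [/\ normc c = 1, forall k, E (a k) &
    B = fun z => c * \prod_(k < n) bfactor (a k) z].
Proof.
by split=> -[c [a [/circle_normc c1 aE ->]]]; exists c, a; split.
Qed.

Lemma toeplitz_bound n (h B : R[i] -> R[i]) (z : R[i]) :
  Hinf h -> (Hinf_norm h <= 1)%E -> blaschke_products n (@disc R) B ->
  normc z < 1 -> normc (toeplitz B h z) <= 1 + 2 * n%:R.
Proof.
move=> [ah _] /Hinf_norm_le bh /blaschkeE[c [a [c1 aD BE]]] z1.
have dh v : normc v < 1 -> cdiff h v by move=> /disc_normc; exact: ah.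
have a1 k : normc (a k) < 1 by exact/disc_normc.
have [N [mN N0 sN]] := fatou_radial dh bh.
(* The end points are added since [fatou_radial] speaks of the open interval only. *)
pose N' := N `|` [set 0] `|` [set 1 : R].
have mN' : measurable N' by do 2?apply: measurableU.
have N'0 : mu N' = 0%E.
  have p0 (x : R) : mu [set x] = 0%E by exact: lebesgue_measure_set1.
  have mp (x : R) : measurable [set x] by exact: measurable_set1.
  have mN0 : measurable (N `|` [set 0]) by exact: measurableU.
  by rewrite (null_set_setU mN0 (mp 1) _ (p0 1)) // (null_set_setU mN (mp 0) N0 (p0 0)).
(* The shift by 2 makes r 0 = 1/2 positive. *)
pose r k : R := 1 - k.+2%:R^-1.
have r01 k : 0 < r k < 1.
  rewrite /r subr_gt0 invf_lt1 ?ltr0n // ltr1n /= gtrBl invr_gt0 ltr0n //.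
pose F k t := (B (pt t))^* * h ((r k)%:C * pt t) * (pt t / (pt t - z)).
have cB : rcont (fun t => (B (pt t))^*).
  rewrite BE; apply: rcont_conj; apply: rcontM; first exact: rcont_cst.
  apply: rcont_prod => k; apply: ccont_rcont; first exact: rcont_circle_pt.
  move=> t; apply: cdiff_cont; apply: cdiff_bfactor; apply: bfactor_den => //.
  by rewrite normc_circle_pt.
have cF k : rcont (F k).
  apply: rcontM; last exact: rcont_cauchy.
  apply: rcontM => //; exact: rcont_dilation.
have [M bM] : exists M, forall k t, t \in `[0, 1] -> normc (F k t) <= M.
  exists (1 - normc z)^-1 => k t _.
  rewrite /F !normcM normc_conj BE normcM c1 mul1r normc_prod big1 ?mul1r; last first.
    move=> j _; have := bfactor_unimod (a1 j) (normc_circle_pt t).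
    rewrite -sqr_normc_conj -[1]/(1%:C) => /complexI /eqP.
    by rewrite expr2 -expr2 sqrp_eq1 ?normc_ge0 // => /eqP.
  rewrite normc_circle_pt mul1r -[leRHS]mul1r ler_pM ?normc_ge0 //.
    apply: bh; rewrite normcM normc_circle_pt mulr1 normc_real.
    by have /andP[r0 r1] := r01 k; rewrite ger0_norm // ltW.
  rewrite normcV lef_pV2 ?posrE ?subr_gt0 ?normc_gt0 ?subpt_neq0 //.
  have := ler_dist_normc (pt t) z; rewrite normc_circle_pt; apply: le_trans.
  exact: ler_norm.
have lim_ : ccvg \oo (fun k => Cint (F k)) (toeplitz B h z).
  rewrite /toeplitz circle_integralE; apply: (Cint_cvg_off_null mN' N'0 cF bM) => t tI tN.
  have t01 : 0 < t < 1.
    move: tI; rewrite in_itv /= => /andP[t0 t1]; rewrite !lt_neqAle t0 t1 !andbT.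
    by apply/andP; split; apply/eqP => tE; apply: tN; [left; right|right].
  have [l hl] : exists l, ccvg ((1 : R)^'-) (fun r => h (r%:C * pt t)) l.
    apply: contrapT => nl; apply: tN; left; left; apply: sN => /(_ t01); exact: nl.
  have hlE : boundary_value h (pt t) = l by exact: ccvg_lim.
  rewrite [X in ccvg _ _ X](_ : _ = (B (pt t))^* * l * (pt t / (pt t - z))); last first.
    rewrite -hlE; change ((B (pt t))^* * boundary_value h (pt t) / (pt t - z) * pt t =
      (B (pt t))^* * boundary_value h (pt t) * (pt t / (pt t - z))).
    by rewrite mulrA mulrAC.
  rewrite /F; apply: ccvgM; last exact: ccvg_cst.
  apply: ccvgM; first exact: ccvg_cst.
  move=> e e0; have := hl e e0; rewrite /at_left => -[d /= d0 hd].
  near=> k; apply: hd.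
    rewrite /= /r opprB addrC subrK gtr0_norm ?invr_gt0 ?ltr0n //.
    apply: lt_trans (_ : k.+1%:R^-1 < d); first by rewrite ltf_pV2 ?posrE ?ltr0n // ltr_nat.
    by near: k; exact: (near_infty_natSinv_lt (PosNum d0)).
  by have /andP[] := r01 k.
have limB := cvg_normc (FF := eventually_filter) lim_; rewrite -(cvg_lim _ limB) //.
apply: limr_le; first by apply/cvg_ex; eexists; exact: limB.
apply: nearW => k; rewrite /F BE; exact: dilated_toeplitz_bound.
Unshelve. all: by end_near. Qed.

Lemma Omega_le n (E : set R[i]) : E `<=` @disc R ->
  (Omega n E <= (1 + 2 * n%:R)%:E)%E.
Proof.
move=> ED; apply: ge_ereal_sup => _ [h [B [hh h1 [c [a [c1 aE BE]]] ->]]].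
apply/Hinf_norm_le => z z1; apply: toeplitz_bound => //.
by exists c, a; split => // k; exact: ED.
Qed.

End toeplitz_upper_bound.

(** * The lower bound *)

Section partial_fractions.
Variables (F : fieldType) (n : nat) (x : nat -> F).
Hypothesis xI : injective x.

Lemma ord_nodes_neq0 (i j : 'I_n) : j != i -> x i - x j != 0.
Proof. by apply: contra; rewrite subr_eq0 => /eqP/xI/val_inj ->. Qed.

(** A polynomial of degree below n is its own Lagrange interpolant [q] at n nodes: [p - q] has n
    distinct roots. *)
Lemma lagrange_partial_fractions (p : {poly F}) (z : F) :
  (size p <= n)%N -> (forall i, z != x i) ->
  p.[z] / \prod_(i < n) (z - x i) =
  \sum_(i < n) p.[x i] / \prod_(j < n | j != i) (x i - x j) / (z - x i).
Proof.
move=> sp zx.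
pose w (i : 'I_n) := \prod_(j < n | j != i) (x i - x j).
have w0 i : w i != 0 by apply/prodf_neq0 => j; exact: ord_nodes_neq0.
pose L (i : 'I_n) : {poly F} := \prod_(j < n | j != i) ('X - (x j)%:P).
have LE i y : (L i).[y] = \prod_(j < n | j != i) (y - x j).
  by rewrite horner_prod; apply: eq_bigr => j _; rewrite hornerXsubC.
pose q := \sum_(i < n) (p.[x i] / w i) *: L i.
have qE y : q.[y] = \sum_(i < n) p.[x i] / w i * \prod_(j < n | j != i) (y - x j).
  by rewrite horner_sum; apply: eq_bigr => i _; rewrite hornerZ LE.
have pq : p = q.
  apply/eqP; rewrite -subr_eq0; apply/eqP.
  apply: (@roots_geq_poly_eq0 _ _ [seq x (val i) | i <- enum 'I_n]).
  - apply/allP => _ /mapP[i _ ->]; rewrite rootE !hornerE qE (bigD1 i) //=.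
    rewrite [X in _ - (_ + X)]big1 ?addr0 => [|k ki]; last first.
      by rewrite (bigD1 i) 1?eq_sym //= subrr mul0r mulr0.
    by rewrite -/(w i) divfK // subrr.
  - by rewrite map_inj_uniq ?enum_uniq // => i j /xI/val_inj.
  - rewrite size_map size_enum_ord (leq_trans (size_polyD _ _)) // size_polyN geq_max sp.
    apply: (leq_trans (size_sum _ _ _)); apply/bigmax_leqP => i _.
    apply: leq_trans (size_scale_leq _ _) _.
    rewrite /L -big_filter size_prod_XsubC -sum1_size big_filter sum1_card cardC1.
    by rewrite card_ord prednK // (leq_ltn_trans _ (ltn_ord i)).
rewrite {1}pq qE mulr_suml; apply: eq_bigr => i _.
rewrite [in X in _ / X](bigD1 i) //= -/(w i) invfM -!mulrA; congr (_ * (_ * _)).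
rewrite mulrCA divff ?mulr1 //; apply/prodf_neq0 => j _.
by rewrite subr_eq0.
Qed.

End partial_fractions.

(** * Evaluation of the Toeplitz operator by residues *)

Section toeplitz_nodes.
Variable R : realType.
Local Notation pt := (@circle_pt R).

Lemma boundary_value_cont (h : R[i] -> R[i]) (t : R) :
  ccont h (pt t) -> boundary_value h (pt t) = h (pt t).
Proof.
move=> ch; apply: ccvg_lim; apply: ccont_ccvg ch _.
rewrite -[X in ccvg _ _ X]mul1r; apply: ccvgM; last exact: ccvg_cst.
by apply: ccvg_real; apply: cvg_at_left_filter; exact: cvg_id.
Qed.

Lemma prod_ord_neq_max n (f : 'I_n.+1 -> R[i]) :
  \prod_(j < n.+1 | j != ord_max) f j = \prod_(k < n) f (widen_ord (leqnSn n) k).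
Proof.
rewrite big_mkcond big_ord_recr /= eqxx mulr1; apply: eq_bigr => k _.
by rewrite -val_eqE /= neq_ltn ltn_ord.
Qed.

Lemma prod_ord_neq_widen n (f : 'I_n.+1 -> R[i]) (i : 'I_n) :
  \prod_(j < n.+1 | j != widen_ord (leqnSn n) i) f j =
  (\prod_(k < n | k != i) f (widen_ord (leqnSn n) k)) * f ord_max.
Proof.
rewrite big_mkcond big_ord_recr /= -val_eqE /= eq_sym neq_ltn ltn_ord; congr (_ * _).
by rewrite [RHS]big_mkcond.
Qed.

(* On the circle conj B = 1/B, so the integrand is h times a rational function with
   simple poles at the nodes x 0, ..., x n. *)
Lemma toeplitz_nodes n (x : nat -> R[i]) (u : R[i]) (h : R[i] -> R[i]) (R0 : R) :
  injective x -> (forall i, normc (x i) < 1) -> normc u = 1 -> 1 < R0 ->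
  (forall v, normc v < R0 -> cdiff h v) ->
  toeplitz (fun v => \prod_(k < n) (u * bfactor (x k) v)) h (x n) =
  h (x n) / \prod_(k < n) (u * bfactor (x k) (x n)) +
  \sum_(i < n) h (x i) * ((1 - (x i)^* * x i) / (u * (x i - x n))) /
    \prod_(k < n | k != i) (u * bfactor (x k) (x i)).
Proof.
move=> xI x1 u1 R01 dh.
have u0 : u != 0 by rewrite -normc_gt0 u1.
pose p : {poly R[i]} := \prod_(k < n) (1 - (x k)^* *: 'X).
have pE v : p.[v] = \prod_(k < n) (1 - (x k)^* * v).
  by rewrite horner_prod; apply: eq_bigr => k _; rewrite !hornerE.
(* The numerator of 1/B has degree at most n, while there are n + 1 nodes: the evaluation point
   [x n] is the pole of the Cauchy kernel. *)
have sp : (size p <= n.+1)%N.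
  have s2 k : (size (1 - (x k)^* *: 'X : {poly R[i]})%R <= 2)%N.
    rewrite (leq_trans (size_polyD _ _)) // size_polyN geq_max size_poly1 /=.
    by rewrite (leq_trans (size_scale_leq _ _)) // size_polyX.
  apply: leq_trans (size_poly_prod_leq _ _) _.
  rewrite leq_subLR cardT size_enum_ord addnS ltnS addnn -muln2.
  rewrite -[X in (_ <= X * 2)%N](card_ord n) -sum_nat_const.
  by apply: leq_sum => k _; exact: s2.
pose U := \prod_(k < n) u.
pose A (i : 'I_n.+1) := p.[x i] / \prod_(j < n.+1 | j != i) (x i - x j) / U.
have TE t : (\prod_(k < n) (u * bfactor (x k) (pt t)))^* * h (pt t) / (pt t - x n) * pt t =
    \sum_(i < n.+1) A i * (h (pt t) * (pt t / (pt t - x i))).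
  transitivity (p.[pt t] / \prod_(i < n.+1) (pt t - x i) / U * (h (pt t) * pt t)).
    have -> : (\prod_(k < n) (u * bfactor (x k) (pt t)))^* =
        p.[pt t] / \prod_(k < n) (pt t - x k) / U.
      rewrite rmorph_prod /= pE -prodf_div -prodf_div; apply: eq_bigr => k _.
      have b1 := bfactor_unimod (x1 k) (normc_circle_pt t).
      have uu : u * u^* = 1 by rewrite -sqr_normc_conj u1 expr1n.
      have b0 : bfactor (x k) (pt t) != 0.
        by apply: contra_eq_neq b1 => ->; rewrite mul0r eq_sym oner_eq0.
      rewrite conjcM -(mulKf b0 (bfactor _ _)^*) b1 -(mulKf u0 u^*) uu !mulr1.
      by rewrite mulrC /bfactor invf_div.
    by rewrite big_ord_recr /= invfM; ring.
  rewrite (lagrange_partial_fractions xI sp); last first.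
    by move=> i; rewrite -subr_eq0 subpt_neq0.
  rewrite 2!mulr_suml; apply: eq_bigr => i _; rewrite /A; ring.
have crk := rcont_of_cdiff R01 dh.
rewrite /toeplitz circle_integralE.
transitivity (Cint (fun t => \sum_(i < n.+1) A i * (h (pt t) * (pt t / (pt t - x i))))).
  congr Cint; apply/funext => t /=; rewrite boundary_value_cont ?TE //.
  by apply: cdiff_cont; apply: dh; rewrite normc_circle_pt.
have ch i : rcont (fun t => h (pt t) * (pt t / (pt t - x i))).
  by apply: rcontM => //; exact: rcont_cauchy.
rewrite Cint_sum; last by move=> i; apply: rcontM; [exact: rcont_cst|exact: ch].
under eq_bigr do rewrite CintZ // (cauchy_formula R01 dh) //.
rewrite big_ord_recr /= addrC; congr (_ + _).
  rewrite /A prod_ord_neq_max /= pE /U mulrC -!mulrA; congr (_ * _).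
  rewrite mulrA -2!prodf_div -prodfV; apply: eq_bigr => k _.
  by rewrite /bfactor invfM invf_div mulrC.
apply: eq_bigr => i _; rewrite /A prod_ord_neq_widen /= pE /U.
rewrite (bigD1 i) //= [\prod_(k < n) u](bigD1 i) //=.
rewrite big_split /= /bfactor prodf_div.
by rewrite !invfM invrK; ring.
Qed.

End toeplitz_nodes.

(** * The extremal configuration on a ray *)

Section extremal_sequence.
Variable R : realType.
Local Notation pt := (@circle_pt R).
Implicit Types (tau : R) (i j k : nat).

(** Indices start at 0: below 2n the even nodes are the zeros of B and the odd ones those of h; node
    2n is the evaluation point. *)
Definition node tau i : R := 1 - tau ^+ i.+1.

(** The value at node j of the Blaschke factor with zero at node i. *)
Definition node_factor tau i j : R :=
  (node tau j - node tau i) / (1 - node tau i * node tau j).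

Lemma node_in01 tau i : 0 < tau < 1 -> 0 < node tau i < 1.
Proof.
move=> /andP[t0 t1]; rewrite /node subr_gt0 exprn_ilt1 ?ltW //=.
by rewrite gtrBl exprn_gt0.
Qed.

Lemma node_inj tau : 0 < tau < 1 -> injective (node tau).
Proof.
move=> /andP[t0 t1] i j /addrI/oppr_inj /eqP; rewrite eq_le !ler_iXn2l //.
by rewrite !ltnS -eqn_leq => /eqP.
Qed.

Lemma node_ge_first tau i : 0 < tau < 1 -> 1 - tau <= node tau i.
Proof.
move=> /andP[t0 t1]; rewrite lerD2l lerN2 exprS ler_piMr ?exprn_ile1 ?ltW //.
Qed.

Lemma node_le tau i j : 0 < tau < 1 -> (i <= j)%N -> node tau i <= node tau j.
Proof.
by move=> /andP[t0 t1] ij; rewrite lerD2l lerN2 ler_iXn2l ?ltnS.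
Qed.

Lemma node_den tau i j : 0 < tau < 1 -> 0 < 1 - node tau i * node tau j.
Proof.
move=> t01; have /andP[i0 i1] := node_in01 i t01; have /andP[j0 j1] := node_in01 j t01.
by rewrite subr_gt0 mulr_ilt1 ?ltW.
Qed.

Lemma node_factorC tau i j : node_factor tau i j = - node_factor tau j i.
Proof. by rewrite /node_factor -[node tau j - _]opprB mulNr [node tau j * node tau i]mulrC. Qed.

Lemma node_factor_lt tau i j : 0 < tau < 1 -> (i < j)%N ->
  node_factor tau i j = (1 - tau ^+ (j - i)) / (1 + tau ^+ (j - i) - tau ^+ j.+1).
Proof.
move=> t01 ij; have ti0 : tau ^+ i.+1 != 0.
  by rewrite expf_neq0 // gt_eqF //; case/andP: t01.
have d := node_den i j t01.
have E : tau ^+ j.+1 = tau ^+ i.+1 * tau ^+ (j - i) by rewrite -exprD addSn subnKC // ltnW.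
have E1 : node tau j - node tau i = tau ^+ i.+1 * (1 - tau ^+ (j - i)).
  by rewrite /node E; ring.
have E2 : 1 - node tau i * node tau j =
    tau ^+ i.+1 * (1 + tau ^+ (j - i) - tau ^+ j.+1).
  by rewrite /node E; ring.
by rewrite /node_factor E1 E2 invfM mulrACA divff ?mul1r.
Qed.

Lemma cvg_exprn_right0 k : (0 < k)%N -> tau ^+ k @[tau --> (0 : R)^'+] --> (0 : R).
Proof.
move=> k0; apply: cvg_at_right_filter.
have := @exprn_continuous R k 0; rewrite /continuous_at.
by case: k k0 => // k _; rewrite expr0n.
Qed.

Lemma near_right0 (e : R) : 0 < e -> \forall tau \near (0 : R)^'+, 0 < tau < e.
Proof.
move=> e0; near=> tau; apply/andP; split; near: tau; first exact: nbhs_right_gt.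
exact: nbhs_right_lt.
Unshelve. all: by end_near. Qed.

(** As tau -> 0 the nodes separate in the hyperbolic metric, and a factor remembers only on which
    side of its zero it is evaluated. *)
Lemma node_factor_cvg i j : i != j ->
  node_factor tau i j @[tau --> (0 : R)^'+] --> (if (i < j)%N then 1 else -1 : R).
Proof.
have lt_case i' j' : (i' < j')%N -> node_factor tau i' j' @[tau --> (0 : R)^'+] --> (1 : R).
  move=> ij; have : (1 - tau ^+ (j' - i')) / (1 + tau ^+ (j' - i') - tau ^+ j'.+1)
      @[tau --> (0 : R)^'+] --> ((1 - 0) / (1 + 0 - 0) : R).
    apply: cvgM; first by apply: cvgB; [exact: cvg_cst|apply: cvg_exprn_right0; rewrite subn_gt0].
    apply: cvgV; first by rewrite addr0 subr0 oner_eq0.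
    apply: cvgB; last exact: cvg_exprn_right0.
    by apply: cvgD; [exact: cvg_cst|apply: cvg_exprn_right0; rewrite subn_gt0].
  rewrite subr0 addr0 subr0 divr1; apply: cvg_trans; apply: near_eq_cvg.
  near=> tau; rewrite node_factor_lt //; near: tau; exact: near_right0.
rewrite neq_ltn => /orP[ij|ji]; first by rewrite ij; exact: lt_case.
rewrite ltnNge ltnW //=; under eq_fun do rewrite node_factorC.
by apply: cvgN; exact: lt_case.
Unshelve. all: by end_near. Qed.

(** The part of the residue at a zero of B that is not a Blaschke factor: the numerator comes from
    the factor of B vanishing there, the denominator from the Cauchy kernel. *)
Definition node_weight tau i j : R := (1 - node tau i ^+ 2) / (node tau i - node tau j).

Lemma node_weight_cvg i j : (i < j)%N ->
  node_weight tau i j @[tau --> (0 : R)^'+] --> (- 2 : R).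
Proof.
move=> ij; have : - ((2 - tau ^+ i.+1) / (1 - tau ^+ (j - i)))
    @[tau --> (0 : R)^'+] --> (- ((2 - 0) / (1 - 0)) : R).
  apply: cvgN; apply: cvgM; first by apply: cvgB; [exact: cvg_cst|exact: cvg_exprn_right0].
  apply: cvgV; first by rewrite subr0 oner_eq0.
  by apply: cvgB; [exact: cvg_cst|apply: cvg_exprn_right0; rewrite subn_gt0].
rewrite !subr0 divr1; apply: cvg_trans; apply: near_eq_cvg.
near=> tau; have t01 : 0 < tau < 1 by near: tau; exact: near_right0.
have ti0 : tau ^+ i.+1 != 0 by rewrite expf_neq0 // gt_eqF //; case/andP: t01.
have E : tau ^+ j.+1 = tau ^+ i.+1 * tau ^+ (j - i) by rewrite -exprD addSn subnKC // ltnW.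
have E1 : 1 - node tau i ^+ 2 = tau ^+ i.+1 * (2 - tau ^+ i.+1) by rewrite /node; ring.
have E2 : node tau i - node tau j = tau ^+ i.+1 * - (1 - tau ^+ (j - i)).
  by rewrite /node E; ring.
by rewrite /node_weight E1 E2 invfM mulrACA divff ?mul1r // invrN mulrN.
Unshelve. all: by end_near. Qed.

(** Each zero of h is paired with the preceding zero of B. In term i the factor of B that vanishes
    at node 2i is replaced by the weight. *)
Definition extremal_value n tau : R[i] :=
  \prod_(k < n) ((node_factor tau k.*2.+1 n.*2)%:C / (node_factor tau k.*2 n.*2)%:C) +
  \sum_(i < n) \prod_(k < n)
    (if k == i then (node_weight tau i.*2 n.*2)%:C * (node_factor tau i.*2.+1 i.*2)%:C
     else (node_factor tau k.*2.+1 i.*2)%:C / (node_factor tau k.*2 i.*2)%:C).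

(* Both factors have the same limit, 1 or -1. *)
Lemma extremal_ratio_cvg k i : k != i ->
  ccvg (0 : R)^'+ (fun tau => (node_factor tau k.*2.+1 i.*2)%:C / (node_factor tau k.*2 i.*2)%:C) 1.
Proof.
(* For k different from i, nodes 2k and 2k + 1 lie on the same side of node 2i. *)
move=> ki; pose s : R := if (k < i)%N then 1 else -1.
have s0 : s != 0 by rewrite /s; case: ifP => _; rewrite ?oppr_eq0 oner_eq0.
rewrite (_ : 1 = s%:C / s%:C); last by rewrite divff // (inj_eq (@complexI R) s 0).
apply: ccvgM.
  apply: ccvg_real; rewrite /s (_ : (k < i)%N = (k.*2.+1 < i.*2)%N); last by lia.
  by apply: node_factor_cvg; lia.
apply: ccvgV; first by rewrite (inj_eq (@complexI R) s 0).
apply: ccvg_real; rewrite /s -ltn_double; apply: node_factor_cvg.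
by rewrite (inj_eq double_inj).
Qed.

Lemma extremal_value_cvg n : ccvg (0 : R)^'+ (extremal_value n) (1 + 2 * n%:R)%:C.
Proof.
have -> : (1 + 2 * n%:R)%:C = \prod_(k < n) 1 +
    \sum_(i < n) \prod_(k < n) (if k == i then (-2)%:C * (-1)%:C else 1) :> R[i].
  rewrite big1_eq (eq_bigr (fun=> 2%:C)) => [|i _].
    by rewrite sumr_const card_ord mulr_natr rmorphD rmorph1 rmorphMn.
  rewrite (bigD1 i) //= eqxx big1 => [|k /negPf ->//].
  by rewrite mulr1 -real_complexM mulrNN mulr1.
apply: ccvgD.
  by apply: ccvg_prod => k; apply: extremal_ratio_cvg; rewrite ltn_eqF.
apply: ccvg_sum => i; apply: ccvg_prod => k.
case: eqP => [_|/eqP ki]; last exact: extremal_ratio_cvg.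
apply: ccvgM; apply: ccvg_real; first by apply: node_weight_cvg; rewrite ltn_double.
have := @node_factor_cvg i.*2.+1 i.*2; rewrite ltnNge leqnSn /=; apply.
by rewrite gtn_eqF.
Qed.

(** The unimodular constant conj xi in each factor undoes the rotation to the ray: all values at the
    nodes become the real numbers [node_factor]. *)
Lemma toeplitz_extremal n tau (xi : R[i]) : 0 < tau < 1 -> normc xi = 1 ->
  toeplitz (fun v => \prod_(k < n) (xi^* * bfactor ((node tau k.*2)%:C * xi) v))
    (fun v => \prod_(k < n) (xi^* * bfactor ((node tau k.*2.+1)%:C * xi) v))
    ((node tau n.*2)%:C * xi) = extremal_value n tau.
Proof.
move=> t01 xi1; pose x i := (node tau i)%:C * xi.
have xixi : xi * xi^* = 1 by rewrite -sqr_normc_conj xi1 expr1n.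
have xi0 : xi != 0 by rewrite -normc_gt0 xi1.
have xn i : normc (x i) = node tau i.
  rewrite normcM xi1 mulr1 normc_real ger0_norm //.
  by have /andP[/ltW] := node_in01 i t01.
have x1 i : normc (x i) < 1 by rewrite xn; have /andP[] := node_in01 i t01.
have xI : injective x by move=> i j /(mulIf xi0)/complexI/(node_inj t01).
have xx i j : (x i)^* * x j = (node tau i * node tau j)%:C.
  rewrite conjcM conjc_real real_complexM mulrACA [xi^* * _]mulrC xixi mulr1.
  by [].
have bx i j : xi^* * bfactor (x i) (x j) = (node_factor tau i j)%:C.
  rewrite /bfactor xx -mulrBl -!real_complexB /node_factor mulrA mulrCA.
  by rewrite [xi^* * xi]mulrC xixi mulr1 rmorphM fmorphV.
pose h v := \prod_(k < n) (xi^* * bfactor (x k.*2.+1) v).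
(* The evaluation point has the largest modulus among the nodes used, so its radius serves every
   zero of h. *)
have dh v : normc v < cauchy_radius (x n.*2) -> cdiff h v.
  move=> vr; apply: cdiff_prod => k; apply: cdiffM; first exact: cdiff_cst.
  apply: cdiff_bfactor; apply: subr1_neq0; have := cauchy_radius_lt (x1 n.*2) vr.
  apply: le_lt_trans; rewrite normcM [normc (x n.*2 * v)]normcM normc_conj ler_wpM2r ?normc_ge0 // !xn.
  by apply: node_le => //; rewrite ltn_double.
have x2I : injective (fun k => x k.*2) by move=> i j /xI/double_inj.
have xiJ : normc xi^* = 1 by rewrite normc_conj.
rewrite (toeplitz_nodes n x2I _ xiJ (cauchy_radius_gt1 (x1 n.*2)) dh); last by move=> i.
rewrite /extremal_value; congr (_ + _).
  by rewrite /h -prodf_div; apply: eq_bigr => k _; rewrite !bx.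
apply: eq_bigr => i _; rewrite [RHS](bigD1 i) //= eqxx /h.
rewrite (bigD1 i) //= bx.
have -> : (1 - (x i.*2)^* * x i.*2) / (xi^* * (x i.*2 - x n.*2)) =
    (node_weight tau i.*2 n.*2)%:C.
  rewrite xx -mulrBl -real_complexB mulrCA [xi^* * xi]mulrC xixi mulr1.
  by rewrite -real_complexB /node_weight expr2 rmorphM fmorphV.
rewrite [_ * (node_weight _ _ _)%:C]mulrC -!mulrA; congr (_ * (_ * _)).
rewrite -prodf_div; apply: eq_bigr => k ki; rewrite (negPf ki) !bx.
by [].
Qed.

End extremal_sequence.

Section lower_bound.
Variable R : realType.

Lemma Omega_subset n (E F : set R[i]) : E `<=` F -> (Omega n E <= Omega n F)%E.
Proof.
move=> EF; apply: ge_ereal_sup => _ [h [B [hh h1 [c [a [c1 aE BE]]] ->]]].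
apply: ereal_sup_ubound; exists h, B; split => //.
by exists c, a; split => // k; exact: EF.
Qed.

(** Every node is at least 1 - tau, so a small tau places the whole configuration in the ray,
    however close eps is to 1. *)
Lemma ray_node (eps tau : R) (xi : R[i]) i : 0 < tau < 1 -> tau < 1 - eps ->
  normc xi = 1 -> ray eps xi ((node tau i)%:C * xi).
Proof.
move=> t01 te xi1; have /andP[s0 s1] := node_in01 i t01.
have nE : `|(node tau i)%:C * xi| = (node tau i)%:C :> R[i].
  by rewrite norm_normc normcM xi1 mulr1 normc_real gtr0_norm.
split; rewrite nE.
  rewrite lecR -[1]/(1%:C) ltcR s1 andbT (le_trans _ (node_ge_first i t01)) //.
  by rewrite lerBrDr addrC -lerBrDr ltW.
by rewrite mulrC mulKf // (inj_eq (@complexI R) _ 0) gt_eqF.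
Qed.

Lemma Omega_ray_ge_extremal n (eps tau : R) (xi : R[i]) : 0 < tau < 1 ->
  tau < 1 - eps -> normc xi = 1 ->
  ((normc (extremal_value n tau))%:E <= Omega n (ray eps xi))%E.
Proof.
move=> t01 te xi1.
have xiJ : normc xi^* = 1 by rewrite normc_conj.
have x1 i : normc ((node tau i)%:C * xi) < 1.
  by apply/disc_normc; apply: ray_disc (ray_node i t01 te xi1).
rewrite -(toeplitz_extremal n t01 xi1).
set B := fun v => _; set h := fun v => _; set z := _ * xi.
have h1 v : normc v < 1 -> normc (h v) <= 1.
  move=> v1; rewrite /h normc_prod prodr_ile1 // => k _.
  by rewrite normc_ge0 normcM xiJ mul1r bfactor_le1 // ltW.
have h1' : (Hinf_norm h <= 1)%E by apply/Hinf_norm_le.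
apply: (@le_trans _ _ (Hinf_norm (toeplitz B h))).
  by apply: ereal_sup_ubound; exists z => //; apply/disc_normc; exact: x1.
apply: ereal_sup_ubound; exists h, B; split => //.
- split; last exact: le_lt_trans h1' (ltry _).
  move=> v /disc_normc v1; apply: cdiff_prod => k.
  apply: cdiffM; first exact: cdiff_cst.
  by apply: cdiff_bfactor; apply: bfactor_den => //; exact: ltW.
- apply/blaschkeE; exists (xi^* ^+ n), (fun k => (node tau k.*2)%:C * xi); split.
  + by rewrite normcX xiJ expr1n.
  + by move=> k; exact: ray_node.
  + by apply/funext => v; rewrite /B big_split /= prodr_const card_ord.
Qed.

Lemma Omega_ray_ge n (eps : R) (xi : R[i]) : 0 < eps < 1 -> normc xi = 1 ->
  ((1 + 2 * n%:R)%:E <= Omega n (ray eps xi))%E.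
Proof.
move=> /andP[e0 e1] xi1.
have := cvg_normc (FF := at_right_proper_filter 0) (@extremal_value_cvg R n).
rewrite normc_real ger0_norm; last by rewrite addr_ge0 // mulr_ge0.
move=> lim_; have limE : (normc (extremal_value n tau))%:E @[tau --> (0 : R)^'+] -->
    (1 + 2 * n%:R)%:E by apply: cvg_EFin lim_; exact: nearW.
rewrite -(cvg_lim _ limE) //; apply: lime_le; first by apply/cvg_ex; eexists; exact: limE.
near=> tau; apply: Omega_ray_ge_extremal => //; near: tau; first exact: near_right0.
by apply: nbhs_right_lt; rewrite subr_gt0.
Unshelve. all: by end_near. Qed.

End lower_bound.

Theorem theorem1 (R : realType) (n : nat) (eps : R) (xi : R[i])
  (hn : (1 <= n)%N) (heps : 0 < eps < 1) (hxi : circle xi) :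
  Omega n (@disc R) = (1 + 2 * n%:R)%:E /\
  Omega n (ray eps xi) = (1 + 2 * n%:R)%:E.
Proof.
have /circle_normc xi1 := hxi; have ge := Omega_ray_ge n heps xi1.
(* Monotonicity in E closes the chain: the lower bound for the ray passes to the disc, and the upper
   bound for the disc covers the ray. *)
split; apply/eqP; rewrite eq_le Omega_le //=.
  exact: le_trans ge (Omega_subset n (@ray_disc _ eps xi)).
exact: ray_disc.
Qed.
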